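(* Define $g:\mathbb{R}\to\mathbb{R}$ by $$g(x) = -\frac{\sqrt{2}}{\pi^{3/2}} \sum_{n\in\mathbb{Z}^2,\ n \neq 0} |n|^{-5/2} \cos\left(|n|x - \frac{\pi}{4}\right),$$ which is a uniformly almost periodic function with mean value zero. Then $$A(R) = g(R^{1/2})\, R^{-1/4} + O(R^{-3/4}) \quad \text{as } R \to \infty.$$ More generally, there exists a sequence of uniformly almost periodic functions $g_1, g_2, \ldots$ with $g_1 = g$ such that for every integer $m\ge 1$, $$A(R) = \sum_{j=1}^m g_j(R^{1/2})\, R^{\frac{1}{4} - \frac{j}{2}} + O\left(R^{-\frac{1}{4} - \frac{m}{2}}\right)\quad \text{as } R\to\infty.$$
   Context: $|\cdot|$ is the Euclidean norm on $\mathbb{R}^2$. For $t\ge 0$ let $N(t) = \#\{ n \in \mathbb{Z}^2 : |n| \leq \sqrt{t}/2\pi \}$, the number of lattice points in the closed disk of radius $\sqrt{t}/2\pi$ about the origin (equivalently, the number of eigenvalues $\le t$, with multiplicity, of the Laplacian on the standard flat torus $\mathbb{R}^2/\mathbb{Z}^2$). Let $D(t) = N(t) - \frac{t}{4\pi}$, and for $R>0$ let $$A(R) = \frac{1}{R} \int_0^R D(t)\, dt.$$ ''Uniformly almost periodic'' means almost periodic in the sense of Bohr (a uniform limit on $\mathbb{R}$ of finite linear combinations of functions $e^{i\lambda x}$, $\lambda\in\mathbb{R}$). The mean value of such a function $f$ is $\lim_{T\to\infty}\frac{1}{2T}\int_{-T}^T f(x)\,dx$. *)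

(* Defs.v *)
From mathcomp Require Import all_boot all_order all_algebra finmap.
From mathcomp Require Import complex.
From mathcomp Require Import all_classical all_reals all_analysis.
From mathcomp.analysis.showcase Require Import summability.

Set Implicit Arguments.
Unset Strict Implicit.
Unset Printing Implicit Defensive.

Import Order.TTheory GRing.Theory Num.Theory.
Import numFieldNormedType.Exports.

Local Open Scope classical_set_scope.
Local Open Scope ring_scope.

(* Landau notations need a bundled filter; none is provided at [+oo]. *)
Canonical pinfty_filter_on (R : numFieldType) :=
  FilterType (pinfty_nbhs R) (_).

Section LatticePoints.
Context {R : realType}.

Definition enorm (n : int * int) : R :=
  Num.sqrt (n.1%:~R ^+ 2 + n.2%:~R ^+ 2).

Definition lattice_disk (t : R) : set (int * int) :=
  [set n | enorm n <= Num.sqrt t / (2 * pi)].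

(* [fset_set] is [fset0] on infinite sets, hence this lemma. *)
Lemma finite_lattice_disk (t : R) : finite_set (lattice_disk t).
Proof.
have [K hK] : exists K : nat, Num.sqrt t / (2 * pi) < K%:R :> R.
  by exists (Num.truncn (Num.sqrt t / (2 * pi) : R)).+1; exact: truncnS_gt.
pose S := [set x : int | exists2 k : nat, (k < K)%N & x = k%:Z \/ x = - k%:Z].
have finS : finite_set S.
  apply: (@sub_finite_set _ _
    ((fun k : nat => k%:Z) @` `I_K `|` (fun k : nat => - k%:Z) @` `I_K)).
    by move=> x [k kK [->|->]]; [left|right]; exists k.
  by rewrite finite_setU; split; apply: finite_image; exact: finite_II.
have inS (x : int) : `|x%:~R| < K%:R :> R -> S x.
  move=> xK; exists `|x|%N; last by case: x {xK} => k; [left|right].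
  by move: xK; rewrite -intr_norm -abszE -[K%:R]/((Posz K)%:~R) ltr_int.
apply: (@sub_finite_set _ _ (S `*` S)); last exact: finite_setX.
move=> [a b] /= /le_lt_trans /(_ hK) abK.
by split; apply: inS; apply: le_lt_trans abK;
  rewrite -sqrtr_sqr ler_wsqrtr//= ?lerDl ?lerDr sqr_ge0.
Qed.

Definition lattice_count (t : R) : nat := #|` fset_set (lattice_disk t)|.

Definition discrepancy (t : R) : R := (lattice_count t)%:R - t / (4 * pi).

Definition avg_discrepancy (r : R) : R :=
  r^-1 * \int[lebesgue_measure]_(t in `[0, r]) discrepancy t.

(* Extending by [0] at the origin turns a sum over the nonzero lattice vectors
   into one over the whole index type. *)
Definition g_term (x : R) (n : int * int) : R :=
  if n == 0 then 0 else enorm n `^ (- (5 / 2)) * cos (enorm n * x - pi / 4).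

(* [sum] (from [summability]) is the unordered sum: the limit of the partial sums over finite
   subsets of the index type, directed by inclusion. *)
Definition g (x : R) : R :=
  - (Num.sqrt 2 / pi `^ (3 / 2)) * sum (g_term x).

End LatticePoints.

Section AlmostPeriodic.
Context {R : realType}.
Local Open Scope complex_scope.

(* e^{iu}, by Euler's formula: the library has no complex exponential. *)
Definition cis (u : R) : R[i] := cos u +i* sin u.

Definition trig_poly (m : nat) (c : 'I_m -> R[i]) (l : 'I_m -> R) (x : R) :
  R[i] := \sum_(k < m) c k * cis (l k * x).

(* Bohr almost periodicity: [f] is a uniform limit of trigonometric
   polynomials. *)
Definition uniformly_almost_periodic (f : R -> R[i]) : Prop :=
  forall e : R, 0 < e ->
    exists (m : nat) (c : 'I_m -> R[i]) (l : 'I_m -> R),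
      forall x : R, `|f x - trig_poly c l x| <= e%:C.

Definition uniformly_almost_periodic_real (f : R -> R) : Prop :=
  uniformly_almost_periodic (fun x => (f x)%:C).

Definition has_mean_value (f : R -> R) (a : R) : Prop :=
  (2 * T)^-1 * (\int[lebesgue_measure]_(x in `[- T, T]) f x)
    @[T --> +oo] --> a.

End AlmostPeriodic.

(* Main.v *)
Require Import Defs.
From mathcomp Require Import all_boot all_order all_algebra finmap complex.
From mathcomp Require Import all_classical all_reals all_analysis.
From mathcomp.analysis.showcase Require summability.
From mathcomp Require Import ring lra zify.
Import Order.TTheory GRing.Theory Num.Theory.
Import numFieldNormedType.Exports.
Local Open Scope classical_set_scope.
Local Open Scope ring_scope.
Set Implicit Arguments.
Unset Strict Implicit.
Unset Printing Implicit Defensive.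

(** The integral of the lattice point count is a first Riesz mean: integrating
    in [t] replaces the indicator function of a disk by the paraboloid
    [max 0 (q^2 - |y|^2)] ([cap]), whose Fourier transform is summable over
    the lattice, so that Poisson's formula applies to it. With [x = sqrt R] it
    becomes Hardy's formula [A(R) = R / (4 pi^2) * sum_(n != 0) Psi (x |n|)]
    ([avg_discrepancy_dual]), where [Psi] ([cap_hat]) is the transform of
    [(1 - |y|^2)_+], that is [4 pi J_2(p) / p^2]; the zero frequency is
    exactly the area term which [D] subtracts.

    The asymptotic expansion of the Bessel function ([cap_hat_expansion]),
    [Psi p = p^(-5/2) (sum_(k < N) p^-k (a_k cos p + b_k sin p) + O(p^-N))],
    is then inserted in each term at [p = x |n|]. Every order in [x] gives a
    series [sum_n |n|^(-5/2 - k) (a_k cos (|n| x) + b_k sin (|n| x))], the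
    function [g_(k+1)] up to the factor [1 / (4 pi^2)]. These series are
    dominated by the summable weight [|n|^(-5/2)] ([sum_weight]); hence they
    are uniform limits of finite trigonometric sums, so almost periodic, and
    of mean value zero because no frequency [|n|] vanishes. The same
    domination sums the error terms.

    Poisson's formula is proved with Fejer kernels: a Fejer mean of the
    Fourier coefficients over boxes is the integral of the paraboloid against
    the product of two Fejer kernels, which evaluates a Lipschitz function at
    the lattice points ([fejer_poisson]), while absolute summability makes the
    same mean converge to the sum of all coefficients ([cesaro_has_sum]). The
    transform of the paraboloid is radial because a rotation is a product of
    three shears ([integ2_rotation]).

    The expansion comes from the differential equation: [w = p^(5/2) Psi]
    satisfies [w'' + (1 - 15 / (4 p^2)) w = 0], and the solutions of such an
    equation have a full expansion determined by its leading term
    ([liouville_expansion]). The two leading constants are those of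
    [K x = int_0^pi cos (x cos t) dt = pi J_0(x)]. They are read off the
    Laplace transforms of two combinations of [K] and [K'] in which the
    oscillation cancels, by comparison with the Gauss integral ([abelian],
    [sbessel_leading]). *)

(** * Derivatives and continuity of explicit functions *)

Section Derivatives.
Context {R : realType}.
Implicit Types (f g : R -> R) (x a b c : R).

(** The class [is_derive] behind a constant without instances, so that the
    rules [hd_add], [hd_mul], ... are selected by the shape of the function
    alone and compute the derivative by unification. *)
Definition hasder f x a : Prop := is_derive x 1 f a.

(** Separates the computation of a derivative from its simplification. *)
Lemma hd_eq f x a b : hasder f x a -> a = b -> hasder f x b.
Proof. by move=> h <-. Qed.

Lemma hd_cst c x : hasder (fun _ : R => c) x 0.
Proof. exact: is_derive_cst. Qed.

Lemma hd_id x : hasder (fun t : R => t) x 1.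
Proof. exact: is_derive_id. Qed.

Lemma hd_add f g x a b : hasder f x a -> hasder g x b ->
  hasder (fun t => f t + g t) x (a + b).
Proof. by move=> hf hg; exact: (is_deriveD hf hg). Qed.

Lemma hd_opp f x a : hasder f x a -> hasder (fun t => - f t) x (- a).
Proof. by move=> hf; exact: (is_deriveN hf). Qed.

Lemma hd_mul f g x a b : hasder f x a -> hasder g x b ->
  hasder (fun t => f t * g t) x (a * g x + f x * b).
Proof.
move=> hf hg; apply: (hd_eq (is_deriveM hf hg)).
rewrite addrC; congr (_ + _); exact: mulrC.
Qed.

Lemma hd_pow n f x a : hasder f x a ->
  hasder (fun t => f t ^+ n) x (n%:R * f x ^+ n.-1 * a).
Proof.
move=> hf; have -> : (fun t => f t ^+ n) = f ^+ n.
  apply/funext => t; elim: n => [|n IH]; first by rewrite !expr0.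
  by rewrite !exprS IH.
exact: (is_deriveX n hf).
Qed.

Lemma hd_comp (h : R -> R) f x a b : hasder h (f x) b ->
  hasder f x a -> hasder (fun t => h (f t)) x (b * a).
Proof. by move=> hh hf; exact: (@is_derive1_comp R h f x b a hh hf). Qed.

Lemma hd_inv f x a : f x != 0 -> hasder f x a ->
  hasder (fun t => (f t)^-1) x (- (f x) ^- 2 * a).
Proof. by move=> h0 hf; exact: (@is_deriveV R f x a 1 h0 hf). Qed.

Lemma hd_sin f x a : hasder f x a ->
  hasder (fun t => sin (f t)) x (cos (f x) * a).
Proof. by apply: hd_comp; exact: is_derive_sin. Qed.

Lemma hd_cos f x a : hasder f x a ->
  hasder (fun t => cos (f t)) x (- sin (f x) * a).
Proof. by apply: hd_comp; exact: is_derive_cos. Qed.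

Lemma hd_exp f x a : hasder f x a ->
  hasder (fun t => expR (f t)) x (expR (f x) * a).
Proof. by apply: hd_comp; exact: is_derive_expR. Qed.

Lemma hd_atan f x a : hasder f x a ->
  hasder (fun t => atan (f t)) x ((1 + f x ^+ 2)^-1 * a).
Proof. by apply: hd_comp; exact: is_derive1_atan. Qed.

Lemma hd_ln f x a : 0 < f x -> hasder f x a ->
  hasder (fun t => ln (f t)) x ((f x)^-1 * a).
Proof. by move=> fx0; apply: hd_comp; exact: is_derive1_ln. Qed.

Lemma hd_sqrt f x a : 0 < f x -> hasder f x a ->
  hasder (fun t => Num.sqrt (f t)) x ((2 * Num.sqrt (f x))^-1 * a).
Proof. by move=> fx0; apply: hd_comp; exact: is_derive1_sqrt. Qed.

Lemma hd_sum (I : Type) (s : seq I) (P : pred I) (h : I -> R -> R) (d : I -> R) x :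
  (forall i, hasder (h i) x (d i)) ->
  hasder (fun t => \sum_(i <- s | P i) h i t) x (\sum_(i <- s | P i) d i).
Proof.
move=> hd; elim: s => [|i s IH].
  by under eq_fun do rewrite big_nil; rewrite big_nil; exact: hd_cst.
under eq_fun do rewrite big_cons; rewrite big_cons; case: ifP => // _.
exact: hd_add.
Qed.

Lemma hd_continuous f x a : hasder f x a -> {for x, continuous f}.
Proof. by move=> [h _]; exact/differentiable_continuous/derivable1_diffP. Qed.

(** As for [hasder]: the rules [cont_add], ... are applied by the shape of the
    function, not by unfolding the filters in [continuous]. *)
Definition conti f : Prop := continuous f.

Lemma cont_cst c : conti (fun _ : R => c).
Proof. by move=> x; exact: cvg_cst. Qed.
Lemma cont_id : conti (fun t : R => t).
Proof. by move=> x; exact: cvg_id. Qed.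
Lemma cont_add f g : conti f -> conti g ->
  conti (fun t => f t + g t).
Proof. by move=> hf hg x; apply: cvgD; [exact: hf|exact: hg]. Qed.
Lemma cont_opp f : conti f -> conti (fun t => - f t).
Proof. by move=> hf x; apply: cvgN; exact: hf. Qed.
Lemma cont_mul f g : conti f -> conti g ->
  conti (fun t => f t * g t).
Proof. by move=> hf hg x; apply: cvgM; [exact: hf|exact: hg]. Qed.
Lemma cont_comp f g : conti g -> conti f -> conti (fun t => g (f t)).
Proof. by move=> hg hf x; apply: continuous_comp; [exact: hf|exact: hg]. Qed.
Lemma cont_pow n f : conti f -> conti (fun t => f t ^+ n).
Proof. by move=> hf; apply: (@cont_comp f (fun t => t ^+ n)) => //; exact: exprn_continuous. Qed.
Lemma cont_sin f : conti f -> conti (fun t => sin (f t)).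
Proof. by apply: cont_comp; exact: continuous_sin. Qed.
Lemma cont_cos f : conti f -> conti (fun t => cos (f t)).
Proof. by apply: cont_comp; exact: continuous_cos. Qed.
Lemma cont_exp f : conti f -> conti (fun t => expR (f t)).
Proof. by apply: cont_comp; exact: continuous_expR. Qed.
Lemma cont_sqrt f : conti f -> conti (fun t => Num.sqrt (f t)).
Proof. by apply: cont_comp; exact: sqrt_continuous. Qed.
Lemma cont_norm f : conti f -> conti (fun t => `|f t|).
Proof. by apply: cont_comp; exact: norm_continuous. Qed.
Lemma cont_inv f : (forall x, f x != 0) -> conti f -> conti (fun t => (f t)^-1).
Proof. by move=> h0 hf x; apply: cvgV; [exact: h0|exact: hf]. Qed.
Lemma cont_sum (I : Type) (s : seq I) (P : pred I) (h : I -> R -> R) :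
  (forall i, conti (h i)) -> conti (fun t => \sum_(i <- s | P i) h i t).
Proof.
move=> hc; elim: s => [|i s IH].
  rewrite (_ : (fun _ => _) = fun=> 0); first exact: cont_cst.
  by apply/funext => t; rewrite big_nil.
case Pi: (P i).
  rewrite (_ : (fun _ => _) = fun t => h i t + \sum_(i <- s | P i) h i t).
    exact: cont_add.
  by apply/funext => t; rewrite big_cons Pi.
rewrite (_ : (fun _ => _) = fun t => \sum_(i <- s | P i) h i t) //.
by apply/funext => t; rewrite big_cons Pi.
Qed.

End Derivatives.

Ltac hd_step := first [eassumption | eapply hd_cst | eapply hd_id
  | eapply hd_add | eapply hd_opp
  | eapply hd_pow | eapply hd_mul | eapply hd_inv | eapply hd_sin | eapply hd_cos
  | eapply hd_exp | eapply hd_atan | eapply hd_ln | eapply hd_sqrt | eapply hd_sum].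
Ltac der := repeat hd_step.
Ltac cont_step := first [assumption | lazymatch goal with
  | |- continuous _ => refine (_ : conti _)
  | |- conti (fun _ => ?c) => refine (@cont_cst _ c)
  | |- conti (fun t => t) => refine (@cont_id _)
  | |- conti (fun t => GRing.add (@?f t) (@?g t)) => refine (@cont_add _ f g _ _)
  | |- conti (fun t => GRing.opp (@?f t)) => refine (@cont_opp _ f _)
  | |- conti (fun t => GRing.mul (@?f t) (@?g t)) => refine (@cont_mul _ f g _ _)
  | |- conti (fun t => GRing.exp (@?f t) ?n) => refine (@cont_pow _ n f _)
  | |- conti (fun t => sin (@?f t)) => refine (@cont_sin _ f _)
  | |- conti (fun t => cos (@?f t)) => refine (@cont_cos _ f _)
  | |- conti (fun t => expR (@?f t)) => refine (@cont_exp _ f _)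
  | |- conti (fun t => Num.sqrt (@?f t)) => refine (@cont_sqrt _ f _)
  | |- conti (fun t => Num.norm (@?f t)) => refine (@cont_norm _ f _)
  | |- conti (fun t => bigop.body _ _ _) => apply: cont_sum => ?
  end ].
Ltac cont := repeat cont_step.

(** * Integrals over segments *)

Section Integral.
Context {R : realType}.
Implicit Types (f g F G : R -> R) (a b c x : R).
Local Notation mu := (@lebesgue_measure R).

Lemma continuous_integrable f a b : continuous f ->
  mu.-integrable `[a, b] (EFin \o f).
Proof.
move=> cf; apply: continuous_compact_integrable; first exact: segment_compact.
exact: continuous_subspaceT.
Qed.

Lemma is_derive_Rintegral f a x : continuous f -> a < x ->
  hasder (fun t => \int[mu]_(u in `[a, t]) f u) x (f x).
Proof.
move=> cf ax.
have x1 : x < x + 1 by rewrite ltrDl.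
have [d e] := continuous_FTC1_closed x1
   (continuous_integrable a (x + 1) cf) ax (cf x).
by rewrite /hasder; apply: DeriveDef; [exact: d|rewrite -derive1E; exact: e].
Qed.

(** The Lebesgue integral from a base point is an antiderivative to the right
    of that point only. Near [x], the function [F] differs by a constant from
    the integral based at [- (`|x| + 1)]. *)
Lemma exists_primitive f : continuous f ->
  exists F, forall x, hasder F x (f x).
Proof.
move=> cf.
pose I a b := \int[mu]_(u in `[a, b]) f u.
pose F x := if 0 <= x then I 0 x else - I x 0.
have Icat a b c : a <= b -> b <= c -> I a b + I b c = I a c.
  move=> ab bc.
  have := @Rintegral_itvB R f (BLeft a) (BRight c) b (continuous_integrable a c cf).
  rewrite !bnd_simp => /(_ ab bc).
  move=> E; rewrite Rintegral_itv_obnd_cbnd in E; last first.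
    apply: (integrableS _ _ _ (@continuous_integrable f b c cf)) => //.
    by apply: subset_itvr; rewrite bnd_simp.
  by rewrite addrC; apply/eqP; rewrite eq_sym -subr_eq; apply/eqP; exact: E.
exists F => x.
pose M : R := `|x| + 1.
have Mx : - M < x by have := ler_norm (- x); rewrite normrN /M; lra.
have M0 : - M < 0 by have := normr_ge0 x; rewrite /M; lra.
have FE t : - M < t -> F t = I (- M) t - I (- M) 0.
  move=> Mt; rewrite /F; case: (leP 0 t) => t0.
    by rewrite -(Icat _ _ _ (ltW M0) t0); ring.
  by rewrite -(Icat _ _ _ (ltW Mt) (ltW t0)); ring.
have h : hasder (fun t => I (- M) t - I (- M) 0) x (f x).
  apply: hd_eq; first by apply: hd_add; [exact: is_derive_Rintegral|exact: hd_cst].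
  by rewrite addr0.
apply: (@near_eq_is_derive R R R (fun t => I (- M) t - I (- M) 0) F x 1 (f x)) => //.
near=> t; rewrite FE//; near: t.
exact: lt_nbhsr.
Unshelve. all: end_near. Qed.

(** An antiderivative chosen once and for all: with [integ] defined as a
    difference of its values, orientation, additivity and substitution require
    no integrability conditions. The link with Lebesgue's integral is
    [integ_Rintegral]. *)
Definition prim f := xget (fun=> 0) [set F | forall x, hasder F x (f x)].

Definition integ f a b := prim f b - prim f a.

Lemma primP f : continuous f -> forall x, hasder (prim f) x (f x).
Proof.
move=> cf; have [F hF] := exists_primitive cf.
exact: (@xgetI _ (fun=> 0) [set F | forall x, hasder F x (f x)] F hF).
Qed.

Lemma prim_continuous f : continuous f -> continuous (prim f).
Proof. by move=> cf x; apply: hd_continuous; exact: primP. Qed.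

Lemma mvt F f a b : a <= b -> (forall x, a <= x <= b -> hasder F x (f x)) ->
  exists2 c, a <= c <= b & F b - F a = f c * (b - a).
Proof.
move=> ab dF; have [||c] := @MVT_segment R F f a b ab.
- move=> x; rewrite in_itv /= => /andP[ax xb]; apply: dF.
  by rewrite (ltW ax) (ltW xb).
- apply: continuous_in_subspaceT => x; rewrite inE /= in_itv /= => /dF.
  exact: hd_continuous.
- by rewrite in_itv /= => cab E; exists c.
Qed.

(** The mean value theorem for [F - G], whose derivative vanishes. *)
Lemma derive_eq_sub F G f a b : a <= b -> continuous F -> continuous G ->
  (forall x, a < x < b -> hasder F x (f x)) ->
  (forall x, a < x < b -> hasder G x (f x)) -> F b - F a = G b - G a.
Proof.
move=> ab cF cG dF dG.
have [||c _] := @MVT_segment R (fun t => F t - G t) (fun=> 0) a b ab.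
- move=> x; rewrite in_itv /= => xab.
  apply: hd_eq; first by apply: hd_add; [exact: dF|apply: hd_opp; exact: dG].
  by rewrite subrr.
- by apply: continuous_subspaceT; apply: cont_add => //; apply: cont_opp.
- by rewrite mul0r => h; move: h; lra.
Qed.

(** The derivative is only asked for inside the segment, so that a piecewise
    defined [f] can be integrated on the segments where it follows one
    formula. *)
Lemma integ_FTC f F a b : a <= b -> continuous f -> continuous F ->
  (forall x, a < x < b -> hasder F x (f x)) -> integ f a b = F b - F a.
Proof.
move=> ab cf cF dF; apply: (@derive_eq_sub _ _ f) => //.
- exact: prim_continuous.
- by move=> x _; exact: primP.
Qed.

Definition primitive F f := forall x, hasder F x (f x).

Lemma integE f F a b : primitive F f -> integ f a b = F b - F a.
Proof.
move=> dF.
have dp : forall x, hasder (prim f) x (f x).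
  exact: (@xgetI _ (fun=> 0) [set F | forall x, hasder F x (f x)] F dF).
have cF : continuous F by move=> x; apply: hd_continuous.
have cp : continuous (prim f) by move=> x; apply: hd_continuous.
case: (leP a b) => [ab|/ltW ab]; rewrite /integ.
  exact: (@derive_eq_sub _ _ f).
by rewrite -[LHS]opprB -[RHS]opprB; congr (- _); exact: (@derive_eq_sub _ _ f).
Qed.

Lemma integ_Rintegral f a b : a <= b -> continuous f ->
  \int[mu]_(x in `[a, b]) f x = integ f a b.
Proof.
rewrite le_eqVlt => /predU1P[-> _|ab cf].
  by rewrite set_itv1 Rintegral_set1 /integ subrr.
rewrite /Rintegral (@continuous_FTC2 R f (prim f)) //.
- exact: continuous_subspaceT.
- split.
  + by move=> x _; case: (primP cf x).
  + by apply: cvg_at_right_filter; exact: prim_continuous.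
  + by apply: cvg_at_left_filter; exact: prim_continuous.
- by move=> x _; rewrite derive1E; case: (primP cf x).
Qed.

Lemma integ_refl f a : integ f a a = 0.
Proof. exact: subrr. Qed.

Lemma integ_swap f a b : integ f a b = - integ f b a.
Proof. by rewrite /integ opprB. Qed.

Lemma integ_cat f a b c : integ f a b + integ f b c = integ f a c.
Proof. by rewrite /integ; ring. Qed.

Lemma integD f g a b : continuous f -> continuous g ->
  integ (fun x => f x + g x) a b = integ f a b + integ g a b.
Proof.
move=> cf cg; rewrite (@integE _ (fun x => prim f x + prim g x)).
  by rewrite /integ; ring.
by move=> x; apply: hd_add; exact: primP.
Qed.

Lemma integZ k f a b : continuous f -> integ (fun x => k * f x) a b = k * integ f a b.
Proof.
move=> cf; rewrite (@integE _ (fun x => k * prim f x)).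
  by rewrite /integ; ring.
move=> x; apply: hd_eq; first by apply: hd_mul; [exact: hd_cst|exact: primP].
by rewrite /=; ring.
Qed.

Lemma integZr k f a b : continuous f -> integ (fun x => f x * k) a b = integ f a b * k.
Proof.
move=> cf; rewrite mulrC -integZ //.
by congr integ; apply/funext => x; rewrite mulrC.
Qed.

Lemma integN f a b : continuous f -> integ (fun x => - f x) a b = - integ f a b.
Proof.
move=> cf; rewrite -[RHS]mulN1r -integZ //.
by congr integ; apply/funext => x; rewrite mulN1r.
Qed.

Lemma integB f g a b : continuous f -> continuous g ->
  integ (fun x => f x - g x) a b = integ f a b - integ g a b.
Proof. by move=> cf cg; rewrite integD ?integN//; exact: cont_opp. Qed.

Lemma integ_lin (k l : R) f g a b : continuous f -> continuous g ->
  integ (fun x => k * f x + l * g x) a b = k * integ f a b + l * integ g a b.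
Proof.
move=> cf cg; rewrite -(integZ k a b cf) -(integZ l a b cg) integD //; cont.
Qed.

Lemma integ_cst k a b : integ (fun=> k) a b = k * (b - a).
Proof.
rewrite (@integE _ (fun x => k * x)); first by ring.
by move=> x; apply: hd_eq; [der|rewrite /=; ring].
Qed.

Lemma integ_sum (I : Type) (s : seq I) (P : pred I) (h : I -> R -> R) a b :
  (forall i, continuous (h i)) ->
  integ (fun x => \sum_(i <- s | P i) h i x) a b = \sum_(i <- s | P i) integ (h i) a b.
Proof.
move=> ch; rewrite (@integE _ (fun x => \sum_(i <- s | P i) prim (h i) x)).
  by rewrite -sumrB.
by move=> x; apply: hd_sum => i; exact: primP.
Qed.

Lemma eq_integ f g a b : a <= b -> continuous f -> continuous g ->
  (forall x, a < x < b -> f x = g x) -> integ f a b = integ g a b.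
Proof.
move=> ab cf cg fg; apply: integ_FTC => //; first exact: prim_continuous.
by move=> x xab; rewrite fg//; exact: primP.
Qed.

Lemma le_integ f g a b : a <= b -> continuous f -> continuous g ->
  (forall x, a <= x <= b -> f x <= g x) -> integ f a b <= integ g a b.
Proof.
move=> ab cf cg fg; rewrite -!integ_Rintegral //.
apply: le_Rintegral => //.
- exact: continuous_integrable.
- exact: continuous_integrable.
Qed.

Lemma integ_ge0 f a b : a <= b -> continuous f ->
  (forall x, a <= x <= b -> 0 <= f x) -> 0 <= integ f a b.
Proof.
move=> ab cf f0; have := @le_integ (fun=> 0) f a b ab _ cf f0.
by rewrite integ_cst mul0r; apply; cont.
Qed.

Lemma ler_norm_integ f g a b : a <= b -> continuous f -> continuous g ->
  (forall x, a <= x <= b -> `|f x| <= g x) -> `|integ f a b| <= integ g a b.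
Proof.
move=> ab cf cg fg; rewrite ler_norml -integN //.
apply/andP; split; apply: le_integ => //; try exact: cont_opp.
  by move=> x /fg; rewrite ler_norml => /andP[].
by move=> x /fg; rewrite ler_norml => /andP[].
Qed.

Lemma ler_norm_integ_cst f M a b : a <= b -> continuous f ->
  (forall x, a <= x <= b -> `|f x| <= M) -> `|integ f a b| <= M * (b - a).
Proof.
by move=> ab cf fM; rewrite -integ_cst; apply: ler_norm_integ => //; exact: cont_cst.
Qed.

Lemma integ_shift f c a b : continuous f ->
  integ (fun x => f (x + c)) a b = integ f (a + c) (b + c).
Proof.
move=> cf; rewrite (@integE _ (fun x => prim f (x + c))) // => x.
apply: hd_eq; first by apply: hd_comp; [exact: primP|der].
by ring.
Qed.

Lemma integ_reflect f c a b : continuous f ->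
  integ (fun x => f (c - x)) a b = integ f (c - b) (c - a).
Proof.
move=> cf; rewrite (@integE _ (fun x => - prim f (c - x))).
  by rewrite /integ; ring.
move=> x.
apply: hd_eq; first by apply: hd_opp; apply: hd_comp; [exact: primP|der].
by ring.
Qed.

(** The local Lipschitz bound on the partial derivative stands in for a
    dominating function. *)
Lemma hd_integ (G G1 : R -> R -> R) a b x0 (L : R) : a <= b ->
  (forall x, continuous (G x)) -> continuous (G1 x0) ->
  (forall x t, hasder (G ^~ t) x (G1 x t)) ->
  (forall x t, `|x - x0| <= 1 -> a <= t <= b ->
     `|G1 x t - G1 x0 t| <= L * `|x - x0|) ->
  hasder (fun x => integ (G x) a b) x0 (integ (G1 x0) a b).
Proof.
move=> ab cG cG1 dG lip.
set D := integ (G1 x0) a b.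
have L0 : 0 <= L.
  have := lip (x0 + 1) a; rewrite addrC addKr normr1 lexx ab lexx /= mulr1.
  by move=> h; apply: (le_trans (normr_ge0 _) (h _ _)).
have key h : `|h| <= 1 ->
  `|integ (G (x0 + h)) a b - integ (G x0) a b - h * D| <= L * (b - a) * `|h| ^+ 2.
  move=> h1.
  have c2 : continuous (fun t => G (x0 + h) t - G x0 t).
    by apply: cont_add; [exact: cG|apply: cont_opp; exact: cG].
  have c3 : continuous (fun t => h * G1 x0 t) by apply: cont_mul => //; exact: cont_cst.
  rewrite /D -(integZ h a b cG1) -integB; [|exact: cG|exact: cG].
  rewrite -(integB a b c2 c3) mulrAC; apply: ler_norm_integ_cst => //.
    by apply: cont_add => //; exact: cont_opp.
  move=> t tab.
  pose P x := G x t - x * G1 x0 t.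
  have dP x : hasder P x (G1 x t - G1 x0 t).
    apply: hd_eq; first by apply: hd_add; [exact: dG|apply: hd_opp; der].
    by rewrite /=; ring.
  have -> : G (x0 + h) t - G x0 t - h * G1 x0 t = P (x0 + h) - P x0.
    by rewrite /P; ring.
  have cP : continuous P by move=> x; apply: hd_continuous.
  have [h0|h0] := leP 0 h.
    have x0h : x0 <= x0 + h by rewrite lerDl.
    have [c /andP[c1 c4] ->] := mvt x0h (fun x _ => dP x).
    have ch : `|c - x0| <= `|h| by rewrite !ger0_norm; lra.
    have -> : x0 + h - x0 = h by ring.
    rewrite normrM expr2 mulrA ler_wpM2r //.
    by apply: le_trans (lip _ _ _ tab) _; [lra|rewrite ler_wpM2l].
  have x0h : x0 + h <= x0 by lra.
  have [c /andP[c1 c4]] := mvt x0h (fun x _ => dP x).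
  have ch : `|c - x0| <= `|h| by rewrite (ltr0_norm h0) ler0_norm; lra.
  rewrite distrC => ->.
  have -> : x0 - (x0 + h) = - h by ring.
  rewrite normrM normrN expr2 mulrA ler_wpM2r //.
  by apply: le_trans (lip _ _ _ tab) _; [lra|rewrite ler_wpM2l].
have cvg : h^-1 *: ((fun x => integ (G x) a b) (h *: 1 + x0) - integ (G x0) a b)
    @[h --> 0^'] --> D.
  apply/cvgrPdist_le => e e0.
  set C := L * (b - a) in key.
  have C0 : 0 <= C by rewrite mulr_ge0// subr_ge0.
  near=> h.
  have h0 : h != 0 by near: h; exact: nbhs_dnbhs_neq.
  have hh : `|h| <= Num.min 1 (e / (C + 1)).
    near: h; apply: dnbhs0_le.
    by rewrite lt_min ltr01 divr_gt0// ltr_wpDl.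
  move: hh; rewrite le_min => /andP[h1 he].
  have := key h h1.
  rewrite /= [h *: 1]mulr1 (addrC h) => k; rewrite distrC.
  have -> : h^-1 *: (integ (G (x0 + h)) a b - integ (G x0) a b) - D =
    h^-1 * (integ (G (x0 + h)) a b - integ (G x0) a b - h * D).
    by rewrite mulrBr mulrA mulVf// mul1r.
  rewrite normrM normfV ler_pdivrMl ?normr_gt0//.
  apply: (le_trans k); rewrite expr2 mulrA mulrC ler_wpM2l//.
  move: he; rewrite ler_pdivlMr ?ltr_wpDl// => he.
  by apply: le_trans he; rewrite mulrC ler_wpM2l// lerDl.
apply: DeriveDef; first by apply/cvg_ex; exists D.
exact: cvg_lim cvg.
Unshelve. all: end_near. Qed.

End Integral.

(** * Lipschitz functions of two variables *)

Section Lipschitz.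
Context {R : realType}.
Implicit Types (f g : R -> R) (F : R -> R -> R) (a b c d x : R).

Lemma lipschitz_continuous f (L : R) :
  (forall x y, `|f x - f y| <= L * `|x - y|) -> continuous f.
Proof.
move=> lf x; apply/cvgrPdist_le => e e0.
have L1 : 0 < `|L| + 1 by rewrite ltr_wpDl.
near=> y.
apply: (le_trans (lf x y)).
have : `|x - y| <= e / (`|L| + 1).
  near: y; apply/nbhs_ballP; exists (e / (`|L| + 1)) => /=; first by rewrite divr_gt0.
  by move=> z /= /ltW.
rewrite ler_pdivlMr// => h; apply: le_trans h.
rewrite mulrC ler_wpM2l//; apply: (le_trans (ler_norm L)); by rewrite lerDl.
Unshelve. all: end_near. Qed.

(** A class of integrands which contains the paraboloid, whose gradient jumps
    on a circle, and which is stable under the shears used below. *)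
Definition lip2 F (L : R) := forall u u' v v',
  `|F u v - F u' v'| <= L * (`|u - u'| + `|v - v'|).

Lemma lip2_contr F L u : lip2 F L -> continuous (F u).
Proof.
move=> lF; apply: (@lipschitz_continuous _ L) => v v'.
by apply: (le_trans (lF _ _ _ _)); rewrite subrr normr0 add0r.
Qed.

Lemma lip2_contl F L v : lip2 F L -> continuous (F ^~ v).
Proof.
move=> lF; apply: (@lipschitz_continuous _ L) => u u'.
by apply: (le_trans (lF _ _ _ _)); rewrite subrr normr0 addr0.
Qed.

Lemma lip2_swap F L : lip2 F L -> lip2 (fun v u => F u v) L.
Proof. by move=> lF u u' v v'; rewrite (addrC `|u - u'|); exact: lF. Qed.

Lemma integ_lip F L a b u u' : (forall u, continuous (F u)) ->
  (forall u u' v, `|F u v - F u' v| <= L * `|u - u'|) ->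
  `|integ (F u) a b - integ (F u') a b| <= L * `|b - a| * `|u - u'|.
Proof.
move=> cF lF; wlog ab : a b / a <= b.
  move=> W; case: (leP a b) => [/W//|/ltW/W h].
  rewrite (integ_swap (F u)) (integ_swap (F u')) -opprD normrN (distrC b).
  exact: h.
have [c1 c2] := (cF u, cF u').
rewrite -integB // mulrAC (ger0_norm (_ : 0 <= b - a)) ?subr_ge0//.
by apply: ler_norm_integ_cst => //; cont.
Qed.

Lemma integ_continuous F L a b : (forall u, continuous (F u)) ->
  (forall u u' v, `|F u v - F u' v| <= L * `|u - u'|) ->
  continuous (fun u => integ (F u) a b).
Proof.
move=> cF lF; apply: (@lipschitz_continuous _ (L * `|b - a|)) => u u'.
exact: integ_lip.
Qed.

Lemma integ_lip_continuous F L a b : lip2 F L -> continuous (fun u => integ (F u) a b).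
Proof.
move=> lF; apply: (@integ_continuous _ L) => [u|u u' v]; first exact: lip2_contr lF.
by apply: (le_trans (lF _ _ _ _)); rewrite subrr normr0 addr0.
Qed.

(** Both iterated integrals, as functions of the upper endpoint of the outer
    one, have the same derivative. *)
Lemma integ_fubini F L a b c d : c <= d -> lip2 F L ->
  integ (fun u => integ (F u) c d) a b = integ (fun v => integ (F ^~ v) a b) c d.
Proof.
move=> cd lF.
pose phi x := integ (fun v => integ (F ^~ v) a x) c d.
have dphi x : hasder phi x (integ (F x) c d).
  apply: (@hd_integ R (fun x v => integ (F ^~ v) a x) F c d x L) => //.
  - by move=> y; apply: (integ_lip_continuous (L := L)); exact: lip2_swap.
  - exact: lip2_contr lF.
  - move=> y v; have := primP (@lip2_contl F L v lF) y => h.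
    apply: hd_eq; first by apply: hd_add; [exact: h|exact: hd_cst].
    by rewrite addr0.
  - move=> y v _ _; apply: (le_trans (lF _ _ _ _)).
    by rewrite subrr normr0 addr0.
rewrite (integE a b dphi) /phi.
rewrite (_ : (fun v => integ (F ^~ v) a a) = fun=> 0).
  by rewrite integ_cst mul0r subr0.
by apply/funext => v; rewrite integ_refl.
Qed.

Lemma lip2M F G L L' C C' : lip2 F L -> lip2 G L' -> 0 <= L -> 0 <= L' ->
  (forall u v, `|F u v| <= C) -> (forall u v, `|G u v| <= C') ->
  lip2 (fun u v => F u v * G u v) (L * C' + C * L').
Proof.
move=> lF lG L0 L0' bF bG u u' v v'.
have -> : F u v * G u v - F u' v' * G u' v' =
  (F u v - F u' v') * G u v + F u' v' * (G u v - G u' v') by ring.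
apply: (le_trans (ler_normD _ _)); rewrite !normrM.
set D := `|u - u'| + `|v - v'|.
have D0 : 0 <= D by rewrite addr_ge0.
rewrite mulrDl; apply: lerD.
  by rewrite mulrAC; apply: ler_pM => //; exact: lF.
by rewrite -mulrA; apply: ler_pM => //; exact: lG.
Qed.

Lemma cos_lip (x y : R) : `|cos x - cos y| <= `|x - y|.
Proof.
wlog xy : x y / y <= x.
  by move=> W; case: (leP y x) => [/W//|/ltW/W]; rewrite distrC (distrC y).
have dc t : y <= t <= x -> hasder cos t (- sin t).
  by move=> _; apply: hd_eq; [apply: hd_cos; exact: hd_id|rewrite mulr1].
have [c _ ->] := mvt xy dc.
rewrite normrM normrN ler_piMl// ler_norml.
by rewrite sin_geN1 sin_le1.
Qed.

Lemma cos_bound (x : R) : `|cos x| <= 1.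
Proof. by rewrite ler_norml cos_geN1 cos_le1. Qed.

Lemma sin_bound (x : R) : `|sin x| <= 1.
Proof. by rewrite ler_norml sin_geN1 sin_le1. Qed.

Lemma lip2_cos (a b : R) : lip2 (fun u v => cos (a * u + b * v)) (`|a| + `|b|).
Proof.
move=> u u' v v'; apply: (le_trans (cos_lip _ _)).
have -> : a * u + b * v - (a * u' + b * v') = a * (u - u') + b * (v - v') by ring.
apply: (le_trans (ler_normD _ _)); rewrite !normrM mulrDl.
by apply: lerD; rewrite ler_wpM2l// ?lerDl ?lerDr.
Qed.

End Lipschitz.

(** * The Fejer kernel *)

Section Fejer.
Context {R : realType}.
Implicit Types (f g : R -> R) (a b c d x t : R).

Definition wave (k : int) t : R := cos (2 * pi * k%:~R * t).

Lemma wave_continuous k : continuous (wave k).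
Proof. by rewrite /wave; cont. Qed.

Lemma sin_int_pi (k : int) : sin (k%:~R * pi) = 0 :> R.
Proof.
have sn n : sin (n%:R * pi) = 0 :> R.
  elim: n => [|n IH]; first by rewrite mul0r sin0.
  by rewrite -natr1 mulrDl mul1r sinDpi IH oppr0.
by case: k => n; rewrite ?NegzE ?mulrNz ?mulNr ?sinN ?sn ?oppr0.
Qed.

Lemma integ_wave k c : integ (wave k) (c - 2^-1) (c + 2^-1) = (k == 0)%:R.
Proof.
have [->|k0] := eqVneq k 0.
  rewrite (_ : wave 0 = fun=> 1) ?integ_cst /=; first by field.
  by apply/funext => t; rewrite /wave mulr0 mul0r cos0.
have p0 : 2 * pi * k%:~R != 0 :> R.
  by rewrite !mulf_eq0 !negb_or intr_eq0 k0 pnatr_eq0 /= andbT gt_eqF ?pi_gt0.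
rewrite (@integE R _ (fun t => sin (2 * pi * k%:~R * t) / (2 * pi * k%:~R))).
  have -> : 2 * pi * k%:~R * (c + 2^-1) = 2 * pi * k%:~R * c + k%:~R * pi by field.
  have -> : 2 * pi * k%:~R * (c - 2^-1) = 2 * pi * k%:~R * c - k%:~R * pi by field.
  by rewrite sinD sinB sin_int_pi !mulr0 addr0 subr0 subrr.
move=> t; apply: hd_eq; first der; rewrite /wave /=.
have pn : pi != 0 :> R by rewrite gt_eqF ?pi_gt0.
by move: pn; move: (pi : R) => p pn; field; rewrite intr_eq0 k0.
Qed.

(** The form which is visibly a trigonometric polynomial; [fejerE] shows that
    it is a sum of two squares. *)
Definition fejer (N : nat) t : R :=
  N%:R^-1 * \sum_(i < N) \sum_(j < N) wave (i%:Z - j%:Z) t.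

Lemma fejerE N t : fejer N t = N%:R^-1 *
  ((\sum_(i < N) cos (2 * pi * i%:R * t)) ^+ 2 +
   (\sum_(i < N) sin (2 * pi * i%:R * t)) ^+ 2).
Proof.
rewrite /fejer; congr (_ * _).
rewrite !expr2 !big_distrlr /= -big_split /=; apply: eq_bigr => i _.
rewrite -big_split /=; apply: eq_bigr => j _.
by rewrite /wave rmorphB /= mulrBr mulrBl cosB.
Qed.

Lemma fejer_ge0 N t : 0 <= fejer N t.
Proof. by rewrite fejerE mulr_ge0 ?invr_ge0// addr_ge0// sqr_ge0. Qed.

Lemma fejer_continuous N : continuous (fejer N).
Proof. by rewrite /fejer; cont; exact: wave_continuous. Qed.

Lemma integ_fejer N c : (0 < N)%N ->
  integ (fejer N) (c - 2^-1) (c + 2^-1) = 1.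
Proof.
move=> N0; rewrite integZ; last by cont; exact: wave_continuous.
rewrite integ_sum; last by move=> i; cont; exact: wave_continuous.
under eq_bigr => i _.
  rewrite integ_sum; last by move=> j; exact: wave_continuous.
  under eq_bigr => j _ do rewrite integ_wave subr_eq0.
  rewrite (bigD1 i) //= eqxx big1 ?addr0; last first.
    by move=> j ji; rewrite eqz_nat eq_sym -val_eqE/= in ji *; rewrite (negbTE ji).
  over.
by rewrite sumr_const card_ord mulVf// pnatr_eq0 -lt0n.
Qed.

(** The weight [sin^2 (pi t) = (1 - wave 1 t) / 2] shifts frequencies by one,
    and of the shifted ones only the [2 (N - 1)] pairs with [i - j = 1] or
    [i - j = - 1] have a nonzero mean. *)
Lemma fejer_moment N c : (0 < N)%N ->
  integ (fun t => (1 - wave 1 t) / 2 * fejer N t) (c - 2^-1) (c + 2^-1) <= N%:R^-1.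
Proof.
move=> N0.
pose S t := \sum_(i < N) \sum_(j < N)
  (wave (i%:Z - j%:Z + 1) t + wave (i%:Z - j%:Z - 1) t).
have wc := wave_continuous.
have cS : continuous S by rewrite /S; cont; exact: wc.
have E t : (1 - wave 1 t) / 2 * fejer N t =
    2^-1 * fejer N t + (- (4 * N%:R)^-1) * S t.
  have -> : S t = 2 * wave 1 t * \sum_(i < N) \sum_(j < N) wave (i%:Z - j%:Z) t.
    rewrite /S mulr_sumr; apply: eq_bigr => i _; rewrite mulr_sumr.
    apply: eq_bigr => j _.
    move: (i%:Z - j%:Z)%R => z; rewrite /wave rmorphB rmorphD /=.
    set k : R := z%:~R.
    have -> : 2 * pi * (k + 1) * t = 2 * pi * k * t + 2 * pi * 1 * t by ring.
    have -> : 2 * pi * (k - 1) * t = 2 * pi * k * t - 2 * pi * 1 * t by ring.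
    by rewrite cosD cosB; ring.
  by rewrite /fejer; field; rewrite pnatr_eq0 -lt0n.
under [X in integ X]eq_fun do rewrite E.
have fc := @fejer_continuous N.
rewrite (integ_lin _ _ _ _ fc cS) integ_fejer // mulr1 mulNr.
have : N%:R *+ 2 - 2 <= integ S (c - 2^-1) (c + 2^-1).
  rewrite integ_sum; last by move=> i; cont; exact: wc.
  have -> : \sum_(i < N) integ (fun t => \sum_(j < N) (wave (i%:Z - j%:Z + 1) t +
       wave (i%:Z - j%:Z - 1) t)) (c - 2^-1) (c + 2^-1) =
     \sum_(i < N) \sum_(j < N) ((i.+1 == j :> nat)%:R + (i == j.+1 :> nat)%:R).
    apply: eq_bigr => i _; rewrite integ_sum; last by move=> j; cont; exact: wc.
    apply: eq_bigr => j _; rewrite integD; [|exact: wc..].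
    rewrite !integ_wave; congr (_%:R + _%:R).
      by apply/eqP/eqP; lia.
    by apply/eqP/eqP; lia.
  have A : N%:R - 1 <= \sum_(i < N) \sum_(j < N) (i.+1 == j :> nat)%:R :> R.
    case: N {S cS E fc N0} => [|n]; first by rewrite big_ord0; lra.
    rewrite big_ord_recr /= -[leLHS]addr0 lerD//; last by apply: sumr_ge0.
    rewrite -natr1 addrK -[leLHS]/(n%:R) -{1}(card_ord n) -sumr_const ler_sum// => i _.
    rewrite (bigD1 (lift ord0 i)) //= /bump /= add1n eqxx lerDl.
    by apply: sumr_ge0.
  under eq_bigr do rewrite big_split /=.
  rewrite big_split /= mulr2n opprD [X in _ <= _ + X]exchange_big /=.
  have -> : \sum_(j < N) \sum_(i < N) (i == j.+1 :> nat)%:R =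
     \sum_(i < N) \sum_(j < N) (i.+1 == j :> nat)%:R :> R.
    by apply: eq_bigr => i _; apply: eq_bigr => j _; rewrite eq_sym.
  by move: A; lra.
move=> h; have N1 : 0 < N%:R :> R by rewrite ltr0n.
have : (4 * N%:R)^-1 * (N%:R *+ 2 - 2) <= (4 * N%:R)^-1 * integ S (c - 2^-1) (c + 2^-1).
  by rewrite ler_wpM2l// invr_ge0 mulr_ge0.
have -> : (4 * N%:R)^-1 * (N%:R *+ 2 - 2) = 2^-1 - (2 * N%:R)^-1 :> R.
  by rewrite -mulr_natr; field; rewrite gt_eqF.
have : (2 * N%:R)^-1 <= N%:R^-1 :> R by rewrite lef_pV2 ?posrE; lra.
by lra.
Qed.

(** The derivative of [sin t - t cos t] is [t sin t]. *)
Lemma sin_ge_xcos x : 0 <= x <= pi / 2 -> x * cos x <= sin x.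
Proof.
move=> /andP[x0 xpi].
have d t : 0 <= t <= x -> hasder (fun t => sin t - t * cos t) t (t * sin t).
  by move=> _; apply: hd_eq; [der|rewrite /=; ring].
have [c /andP[c0 cx]] := mvt x0 d.
rewrite sin0 mul0r !subr0 => E; rewrite -subr_ge0 E mulr_ge0// mulr_ge0//.
by rewrite sin_ge0_pi// c0 (le_trans cx)// (le_trans xpi)// ler_pdivrMr// ler_peMr ?pi_ge0// ler1n.
Qed.

(** [sin x = 2 sin (x / 2) cos (x / 2)] and [sin y >= y cos y] give
    [sin x >= x (1 + cos x) / 2]. *)
Lemma sin_ge_half x : 0 <= x <= pi / 2 -> x / 2 <= sin x.
Proof.
move=> /andP[x0 xpi].
have p0 := pi_gt0 R.
have h : 0 <= x / 2 <= pi / 2 by apply/andP; split; lra.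
have := sin_ge_xcos h.
have c0 : 0 <= cos (x / 2) by apply: cos_ge0_pihalf; apply/andP; split; lra.
have cx : 0 <= cos x by apply: cos_ge0_pihalf; apply/andP; split; lra.
have e1 : sin x = 2 * (sin (x / 2) * cos (x / 2)).
  by rewrite {1}(_ : x = x / 2 + x / 2) ?sinD; [ring|field].
have e2 : cos x = 2 * cos (x / 2) ^+ 2 - 1.
  rewrite {1}(_ : x = x / 2 + x / 2) ?cosD; last by field.
  by have := cos2Dsin2 (x / 2); rewrite -!expr2; lra.
move=> hs.
have : x / 2 * cos (x / 2) * cos (x / 2) <= sin (x / 2) * cos (x / 2).
  by rewrite ler_wpM2r.
rewrite e1 -mulrA -expr2 => h2.
have : 0 <= x * cos x by rewrite mulr_ge0.
by rewrite e2; nra.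
Qed.

(** With [u = t - n] the right-hand side is [sin^2 (pi u)], and
    [sin (pi |u|) >= pi |u| / 2 >= |u|]. *)
Lemma sqr_le_wave (n : int) t : `|t - n%:~R| <= 2^-1 ->
  (t - n%:~R) ^+ 2 <= (1 - wave 1 t) / 2.
Proof.
set u := t - n%:~R => hu.
have -> : wave 1 t = cos (2 * (pi * `|u|)).
  have -> : cos (2 * (pi * `|u|)) = cos (2 * (pi * u)).
    by case: (ger0P u) => // _; rewrite !mulrN cosN.
  have sn : sin (2 * pi * n%:~R) = 0 :> R.
    have -> : 2 * pi * n%:~R = (n + n)%:~R * pi :> R by rewrite rmorphD /=; ring.
    exact: sin_int_pi.
  have cn : cos (2 * pi * n%:~R) = 1 :> R.
    have -> : 2 * pi * n%:~R = n%:~R * pi + n%:~R * pi :> R by ring.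
    rewrite cosD sin_int_pi mulr0 subr0 -expr2.
    by have := cos2Dsin2 (n%:~R * pi : R); rewrite sin_int_pi expr0n /= addr0.
  have -> : 2 * (pi * u) = 2 * pi * 1 * t - 2 * pi * n%:~R by rewrite /u; ring.
  by rewrite /wave cosB sn cn mulr0 addr0 mulr1.
have p0 := pi_gt0 R; have p2 := pi_ge2 R.
have h : 0 <= pi * `|u| <= pi / 2.
  by rewrite mulr_ge0 ?pi_ge0//= ler_wpM2l// pi_ge0.
have := sin_ge_half h; rewrite -[u ^+ 2]real_normK ?num_real//.
have -> : cos (2 * (pi * `|u|)) = 1 - 2 * sin (pi * `|u|) ^+ 2.
  rewrite mulr2n mulrDl mul1r cosD -!expr2.
  by have := cos2Dsin2 (pi * `|u|); lra.
set v := `|u|; set s := sin _ => hs.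
have v0 : 0 <= v by rewrite /v.
have : v <= s by nra.
by nra.
Qed.

(** A Lipschitz function is reproduced by the Fejer kernel up to the first
    absolute moment of the kernel, which is bounded through the second one
    since [|u| <= d + u^2 / d]. *)
Lemma fejer_approx g (L d : R) N (n : int) : (0 < N)%N -> 0 < d -> 0 <= L ->
  continuous g ->
  (forall x, `|x - n%:~R| <= 2^-1 -> `|g x - g n%:~R| <= L * `|x - n%:~R|) ->
  `|integ (fun t => fejer N t * g t) (n%:~R - 2^-1) (n%:~R + 2^-1) - g n%:~R|
    <= L * (d + (d * N%:R)^-1).
Proof.
move=> N0 d0 L0 cg lg; set c : R := n%:~R.
have fc := @fejer_continuous N; have wc := @wave_continuous 1.
have N1 : 0 < N%:R :> R by rewrite ltr0n.
have -> : g c = integ (fun t => fejer N t * g c) (c - 2^-1) (c + 2^-1).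
  by rewrite integZr // integ_fejer // mul1r.
rewrite -integB; [|by cont..].
have c2 : c - 2^-1 <= c + 2^-1 by lra.
pose m t := (1 - wave 1 t) / 2 * fejer N t.
have cm : continuous m by rewrite /m; cont.
have : `|integ (fun t => fejer N t * g t - fejer N t * g c) (c - 2^-1) (c + 2^-1)| <=
   integ (fun t => L * (d * fejer N t + d^-1 * m t)) (c - 2^-1) (c + 2^-1).
  apply: ler_norm_integ => //; [by cont..|] => t /andP[t1 t2].
  have tc : `|t - c| <= 2^-1 by rewrite ler_norml; lra.
  rewrite -mulrBr normrM ger0_norm ?fejer_ge0// mulrC.
  apply: (@le_trans _ _ (L * `|t - c| * fejer N t)).
    by rewrite ler_wpM2r ?fejer_ge0//; exact: lg.
  have -> : d * fejer N t + d^-1 * m t =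
      (d + d^-1 * ((1 - wave 1 t) / 2)) * fejer N t by rewrite /m; ring.
  rewrite -mulrA ler_wpM2l// ler_wpM2r ?fejer_ge0//.
  have := sqr_le_wave tc; rewrite -[_ ^+ 2]real_normK ?num_real//.
  set v := `|_|; set w := _ / 2 => hv.
  have v0 : 0 <= v by rewrite /v.
  have : d * v <= d ^+ 2 + v ^+ 2 by nra.
  move=> h; rewrite -(ler_pM2l d0) mulrDr mulrA mulfV ?gt_eqF// mul1r.
  by apply: (le_trans h); rewrite expr2 lerD2l.
move=> h; apply: (le_trans h).
rewrite integZ; last by cont.
have -> : integ (fun t => d * fejer N t + d^-1 * m t) (c - 2^-1) (c + 2^-1) =
    d * integ (fejer N) (c - 2^-1) (c + 2^-1) + d^-1 * integ m (c - 2^-1) (c + 2^-1).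
  exact: integ_lin.
rewrite integ_fejer // mulr1 ler_wpM2l// lerD2l invfM ler_wpM2l ?invr_ge0 ?(ltW d0)//.
exact: fejer_moment.
Qed.

End Fejer.

(** * Poisson summation by Fejer means *)

Section Poisson.
Context {R : realType}.
Implicit Types (f g : R -> R) (a b c d x t : R).

Definition node (M : nat) (i : nat) : R := i%:R - M%:R.
Definition half_side (M : nat) : R := M%:R + 2^-1.

Lemma nodeE M i : node M i = (i%:Z - M%:Z)%:~R.
Proof. by rewrite rmorphB. Qed.

Lemma integ_unit_steps f M : \sum_(i < M.*2.+1)
    integ f (node M i - 2^-1) (node M i + 2^-1) =
  integ f (- half_side M) (half_side M).
Proof.
(* The integer nodes are the midpoints of consecutive unit intervals. *)
pose x0 : R := - half_side M.
have E n : \sum_(i < n) integ f (x0 + i%:R) (x0 + i.+1%:R) = integ f x0 (x0 + n%:R).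
  elim: n => [|n IH]; first by rewrite big_ord0 addr0 integ_refl.
  by rewrite big_ord_recr /= IH integ_cat.
have e : half_side M = x0 + M.*2.+1%:R.
  have -> : M.*2.+1%:R = 2 * M%:R + 1 :> R by rewrite -natr1 -mul2n natrM.
  by rewrite /x0 /half_side; field.
rewrite [X in integ f _ X]e -/x0 -E; apply: eq_bigr => i _.
have -> : i.+1%:R = i%:R + 1 :> R by rewrite natr1.
by congr integ; rewrite /x0 /half_side /node; field.
Qed.

Definition grid_size M : R := M.*2.+1%:R.

Lemma integ_fejer_box N M : (0 < N)%N ->
  integ (fejer N) (- half_side M) (half_side M) = grid_size M.
Proof.
move=> N0; rewrite -integ_unit_steps (eq_bigr (fun=> 1)).
  by rewrite sumr_const card_ord.
by move=> i _; exact: integ_fejer.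
Qed.

Lemma sum_le_cst n (h : 'I_n -> R) c : (forall i, h i <= c) -> \sum_(i < n) h i <= n%:R * c.
Proof.
move=> hc; rewrite mulr_natl; apply: (@le_trans _ _ (\sum_(i < n) c)).
  by apply: ler_sum => i _; exact: hc.
by rewrite sumr_const card_ord.
Qed.

Lemma fejer_sum g (L d : R) N M : (0 < N)%N -> 0 < d -> 0 <= L ->
  (forall x y, `|g x - g y| <= L * `|x - y|) ->
  `|integ (fun t => fejer N t * g t) (- half_side M) (half_side M) -
    \sum_(i < M.*2.+1) g (node M i)| <= grid_size M * (L * (d + (d * N%:R)^-1)).
Proof.
move=> N0 d0 L0 lg; have cg := lipschitz_continuous lg.
rewrite -integ_unit_steps -sumrB; apply: (le_trans (ler_norm_sum _ _ _)).
apply: sum_le_cst => i; rewrite nodeE.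
by apply: fejer_approx.
Qed.

Section TwoVariables.
Variables (F : R -> R -> R) (L : R) (M : nat).
Hypotheses (lF : lip2 F L) (L0 : 0 <= L).
Let B : R := half_side M.

(** For [F] even in each variable and supported in the box, this is the
    Fourier transform of [F] at the point [(k, l)]. *)
Definition fourier k l : R :=
  integ (fun u => wave k u * integ (fun v => wave l v * F u v) (- B) B) (- B) B.

Let inner_continuous l : continuous (fun u => integ (fun v => wave l v * F u v) (- B) B).
Proof.
apply: (@integ_continuous _ _ L) => [u|u u' v].
  by have cF := lip2_contr (u := u) lF; have cw := @wave_continuous R l; cont.
rewrite -mulrBr normrM -[leRHS]mul1r ler_pM ?cos_bound//.
by apply: (le_trans (lF _ _ _ _)); rewrite subrr normr0 addr0.
Qed.

Let fejer_inner N u : integ (fun v => fejer N v * F u v) (- B) B =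
  N%:R^-1 * \sum_(i < N) \sum_(j < N)
    integ (fun v => wave (i%:Z - j%:Z) v * F u v) (- B) B.
Proof.
have cw k := @wave_continuous R k.
have cF := lip2_contr (u := u) lF.
under [X in integ X]eq_fun => v.
  rewrite /fejer -mulrA mulr_suml.
  under eq_bigr => i _ do rewrite mulr_suml.
  over.
rewrite integZ; last by cont; exact: cw.
rewrite integ_sum; last by move=> i; cont; exact: cw.
congr (_ * _); apply: eq_bigr => i _.
by rewrite integ_sum // => j; cont; exact: cw.
Qed.

Let fejer_fourier N : integ (fun u => fejer N u *
    integ (fun v => fejer N v * F u v) (- B) B) (- B) B =
  N%:R^-1 * \sum_(i < N) \sum_(j < N) (N%:R^-1 * \sum_(i' < N) \sum_(j' < N)
    fourier (i%:Z - j%:Z) (i'%:Z - j'%:Z)).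
Proof.
have cw k := @wave_continuous R k.
under [X in integ X]eq_fun => u.
  rewrite fejer_inner /fejer -mulrA mulr_suml.
  under eq_bigr => i _.
    rewrite mulr_suml.
    under eq_bigr => j _.
      rewrite mulrCA mulr_sumr.
      under eq_bigr => i' _ do rewrite mulr_sumr.
      over.
    over.
  over.
have ci l := inner_continuous l.
rewrite integZ; last by cont; first [exact: cw|exact: ci].
congr (_ * _); rewrite integ_sum; last by move=> i; cont; first [exact: cw|exact: ci].
apply: eq_bigr => i _; rewrite integ_sum; last by move=> j; cont; first [exact: cw|exact: ci].
apply: eq_bigr => j _; rewrite integZ; last by cont; first [exact: cw|exact: ci].
congr (_ * _); rewrite integ_sum; last by move=> i'; cont; first [exact: cw|exact: ci].
apply: eq_bigr => i' _; rewrite integ_sum //.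
by move=> j'; cont; first [exact: cw|exact: ci].
Qed.

(** Each of the two integrations against a Fejer kernel evaluates at the
    integers, up to an error which is uniform in the other variable. *)
Lemma fejer_poisson N d : (0 < N)%N -> 0 < d ->
  `|N%:R^-1 * (\sum_(i < N) \sum_(j < N) (N%:R^-1 * \sum_(i' < N) \sum_(j' < N)
      fourier (i%:Z - j%:Z) (i'%:Z - j'%:Z))) -
    \sum_(i < M.*2.+1) \sum_(j < M.*2.+1) F (node M i) (node M j)|
  <= 2 * grid_size M ^+ 2 * (L * (d + (d * N%:R)^-1)).
Proof.
move=> N0 d0; rewrite -fejer_fourier.
set H := fun u => integ (fun v => fejer N v * F u v) (- B) B.
pose S u := \sum_(j < M.*2.+1) F u (node M j).
have cF u := lip2_contr (u := u) lF.
have fc := @fejer_continuous R N.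
set e := L * (d + (d * N%:R)^-1).
have N1 : 0 < N%:R :> R by rewrite ltr0n.
have e0 : 0 <= e by rewrite /e mulr_ge0// addr_ge0 ?invr_ge0 ?mulr_ge0// ltW.
have g0 : 0 <= grid_size M by rewrite /grid_size.
have BB : - B <= B.
  have : 0 <= M%:R :> R by []; rewrite /B /half_side; lra.
have HS u : `|H u - S u| <= grid_size M * e.
  apply: fejer_sum => // x y; apply: (le_trans (lF _ _ _ _)).
  by rewrite subrr normr0 add0r.
have lS x y : `|S x - S y| <= grid_size M * L * `|x - y|.
  rewrite /S -sumrB; apply: (le_trans (ler_norm_sum _ _ _)).
  rewrite -mulrA; apply: sum_le_cst => i; apply: (le_trans (lF _ _ _ _)).
  by rewrite subrr normr0 addr0.
have cS := lipschitz_continuous lS.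
have cH : continuous H.
  rewrite (_ : H = fun u => N%:R^-1 * \sum_(i < N) \sum_(j < N)
     integ (fun v => wave (i%:Z - j%:Z) v * F u v) (- B) B).
    by cont; exact: inner_continuous.
  by apply/funext => u; exact: fejer_inner.
have A1 : `|integ (fun u => fejer N u * H u) (- B) B -
    integ (fun u => fejer N u * S u) (- B) B| <= grid_size M * (grid_size M * e).
  rewrite -integB; [|by cont..].
  rewrite -{1}(integ_fejer_box M N0) -integZr //.
  apply: ler_norm_integ => //; [by cont..|] => u _.
  by rewrite -mulrBr normrM (ger0_norm (fejer_ge0 N u)) ler_wpM2l// fejer_ge0.
have A2 := @fejer_sum S (grid_size M * L) d N M N0 d0 (mulr_ge0 g0 L0) lS.
rewrite -/B -/(S _) in A2.
have -> : 2 * grid_size M ^+ 2 * e = grid_size M * (grid_size M * e) +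
   grid_size M * (grid_size M * L * (d + (d * N%:R)^-1)) by rewrite /e; ring.
apply: le_trans (lerD A1 A2); apply: le_trans (ler_normD _ _).
by rewrite le_eqVlt; apply/orP; left; apply/eqP; congr `|_|; ring.
Qed.

End TwoVariables.
End Poisson.

(** * The Fourier transform of the paraboloid *)

Section Rotation.
Context {R : realType}.
Implicit Types (f g : R -> R) (F : R -> R -> R) (a b c d x t s m B L r : R).

Lemma integ_eq0 f a b : continuous f ->
  (forall x, Num.min a b < x < Num.max a b -> f x = 0) -> integ f a b = 0.
Proof.
move=> cf; wlog ab : a b / a <= b => [W f0|f0].
  case: (leP a b) => [/W|/ltW/W h]; first exact.
  by rewrite integ_swap h ?oppr0// minC maxC.
rewrite (@eq_integ _ f (fun=> 0)) ?integ_cst ?mul0r //; first by cont.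
by move=> x xab; apply: f0; rewrite (min_idPl ab) (max_idPr ab).
Qed.

Definition supported F m := forall u v, m < `|u| \/ m < `|v| -> F u v = 0.

Definition integ2 F B := integ (fun u => integ (F u) (- B) B) (- B) B.

Lemma integ2_swap F L B : 0 <= B -> lip2 F L -> integ2 (fun u v => F v u) B = integ2 F B.
Proof. by move=> B0 lF; rewrite /integ2 [RHS](integ_fubini _ _ _ lF) //; lra. Qed.

Lemma supported_shear F m s : 0 <= m -> `|s| <= 1 -> supported F m ->
  supported (fun u v => F u (v + s * u)) (2 * m).
Proof.
move=> m0 s1 sF u v [h|h]; apply: sF; first by left; lra.
case: (ltP m `|u|) => um; [by left|right].
have : `|s * u| <= m.
  by rewrite normrM -[leRHS]mul1r ler_pM.
have : `|v| <= `|v + s * u| + `|s * u|.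
  by rewrite -{1}(addrK (s * u) v); exact: ler_normB.
by lra.
Qed.

Lemma lip2_shear F L s : `|s| <= 1 -> lip2 F L ->
  lip2 (fun u v => F u (v + s * u)) (2 * L).
Proof.
move=> s1 lF u u' v v'; apply: (le_trans (lF _ _ _ _)).
have L0 : 0 <= L.
  have := lF 1 0 0 0; rewrite !subr0 normr0 normr1 addr0 mulr1.
  exact: le_trans (normr_ge0 _).
rewrite mulrAC mulrC ler_wpM2r//.
have -> : v + s * u - (v' + s * u') = (v - v') + s * (u - u') by ring.
have := ler_normD (v - v') (s * (u - u')); rewrite normrM.
have : `|s| * `|u - u'| <= `|u - u'| by rewrite ler_piMl.
have := normr_ge0 (v - v').
lra.
Qed.

(** For each [u] the shear is a translation in [v] which does not push the
    support out of the box. *)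
Lemma integ2_shear F L m s B : 0 <= m -> `|s| <= 1 -> 2 * m < B ->
  lip2 F L -> supported F m -> integ2 (fun u v => F u (v + s * u)) B = integ2 F B.
Proof.
move=> m0 s1 mB lF sF; rewrite /integ2; congr integ; apply/funext => u.
have cF := lip2_contr (u := u) lF.
rewrite (integ_shift (s * u) _ _ cF).
rewrite -(integ_cat _ _ (- B)) -(integ_cat _ (- B) B).
case: (ltP m `|u|) => um.
  have z : F u = fun=> 0 by apply/funext => v; apply: sF; left.
  by rewrite z !integ_cst !mul0r !addr0.
have su : `|s * u| <= m by rewrite normrM -[leRHS]mul1r ler_pM.
move: su; rewrite ler_norml => /andP[su1 su2].
rewrite (@integ_eq0 _ (- B + s * u) (- B)) // ?(@integ_eq0 _ B (B + s * u)) //.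
- by rewrite addr0 add0r.
- move=> z; rewrite gt_min => /andP[h _]; apply: sF; right.
  by rewrite gtr0_norm; case/orP: h; lra.
- move=> z; rewrite lt_max => /andP[_ h]; apply: sF; right.
  by rewrite ltr0_norm; case/orP: h; lra.
Qed.

(** A rotation is a product of three shears, of coefficients [t], [- sa], [t]
    for the half-angle tangent [t]. The latter has absolute value at most one
    because the angle is at most a right angle. Each shear may double the size
    of the support, whence the bound [8 * m]. *)
Lemma integ2_rotation F L m B (ca sa : R) : 0 <= m -> 0 <= ca ->
  ca ^+ 2 + sa ^+ 2 = 1 -> 8 * m < B -> lip2 F L -> supported F m ->
  integ2 (fun u v => F (ca * u + sa * v) (ca * v - sa * u)) B = integ2 F B.
Proof.
move=> m0 ca0 cs mB lF sF.
have ca1 : ca <= 1 by nra.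
have sa1 : `|sa| <= 1 by rewrite ler_norml; apply/andP; split; nra.
have ca2 : 0 < 1 + ca by lra.
pose t := sa / (1 + ca).
have t1 : `|t| <= 1.
  by rewrite /t normrM normfV (gtr0_norm ca2) ler_pdivrMr// mul1r; lra.
have tE : t * (1 + ca) = sa by rewrite /t divfK// gt_eqF.
pose F0 u v := F v u.
pose F1 u v := F0 u (v + t * u).
pose F1' u v := F1 v u.
pose F2 u v := F1' u (v + (- sa) * u).
pose F2' u v := F2 v u.
pose F3 u v := F2' u (v + t * u).
have l0 : lip2 F0 L by exact: lip2_swap.
have l1 : lip2 F1 (2 * L) by exact: lip2_shear.
have l1' : lip2 F1' (2 * L) by exact: lip2_swap.
have sa1' : `|- sa| <= 1 by rewrite normrN.
have l2 : lip2 F2 (2 * (2 * L)) by exact: lip2_shear.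
have l2' : lip2 F2' (2 * (2 * L)) by exact: lip2_swap.
have l3 : lip2 F3 (2 * (2 * (2 * L))) by exact: lip2_shear.
have sw G n : supported G n -> supported (fun u v => G v u) n.
  by move=> sG u v h; apply: sG; tauto.
have s0 : supported F0 m by exact: sw.
have s1 : supported F1 (2 * m) by exact: supported_shear.
have s1' : supported F1' (2 * m) by exact: sw.
have m2 : 0 <= 2 * m by lra.
have s2 : supported F2 (2 * (2 * m)) by exact: supported_shear.
have s2' : supported F2' (2 * (2 * m)) by exact: sw.
have B0 : 0 <= B by lra.
have h0 : integ2 F0 B = integ2 F B := integ2_swap B0 lF.
have h1 : integ2 F1 B = integ2 F0 B by apply: (integ2_shear m0 t1 _ l0 s0); lra.
have h1' : integ2 F1' B = integ2 F1 B := integ2_swap B0 l1.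
have h2 : integ2 F2 B = integ2 F1' B by apply: (integ2_shear m2 sa1' _ l1' s1'); lra.
have h2' : integ2 F2' B = integ2 F2 B := integ2_swap B0 l2.
have h3 : integ2 F3 B = integ2 F2' B by apply: (integ2_shear _ t1 _ l2' s2'); lra.
rewrite -h0 -h1 -h1' -h2 -h2' -h3 -(integ2_swap B0 l3); congr integ2.
apply/funext => u; apply/funext => v.
rewrite /F3 /F2' /F2 /F1' /F1 /F0.
have e1 : ca * v - sa * u = v + - sa * (u + t * v).
  have -> : v + - sa * (u + t * v) = (1 - sa * t) * v - sa * u by ring.
  congr (_ * _ - _).
  have : (1 + ca) * (1 - sa * t - ca) = 0.
    have -> : (1 + ca) * (1 - sa * t - ca) =
      (1 - ca ^+ 2) - sa * (t * (1 + ca)) by ring.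
    by rewrite tE -cs; ring.
  move/eqP; rewrite mulf_eq0 gt_eqF //= subr_eq0 => /eqP ->; by [].
rewrite -e1; congr F.
have -> : u + t * v + t * (ca * v - sa * u) = (1 - t * sa) * u + t * (1 + ca) * v by ring.
rewrite tE; congr (_ * _ + _).
have : (1 + ca) * (1 - t * sa - ca) = 0.
  have -> : (1 + ca) * (1 - t * sa - ca) =
    (1 - ca ^+ 2) - sa * (t * (1 + ca)) by ring.
  by rewrite tE -cs; ring.
by move/eqP; rewrite mulf_eq0 gt_eqF //= subr_eq0 => /eqP ->.
Qed.

(** The profile whose sum over [Z^2] is a first Riesz mean of the lattice
    point count in disks. *)
Definition cap r u v : R := Num.max 0 (r ^+ 2 - u ^+ 2 - v ^+ 2).

Lemma parabola_lip c r (x y : R) : 0 <= r -> c <= r ^+ 2 ->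
  `|Num.max 0 (c - x ^+ 2) - Num.max 0 (c - y ^+ 2)| <= 2 * r * `|x - y|.
Proof.
move=> r0 cr; rewrite -(real_normK (num_real x)) -(real_normK (num_real y)).
apply: (@le_trans _ _ (2 * r * `| `|x| - `|y| |)); last first.
  by rewrite ler_wpM2l ?mulr_ge0// ler_dist_dist.
move: (normr_ge0 x) (normr_ge0 y); move: `|x| `|y| => {}x {}y.
wlog xy : x y / x <= y.
  move=> W x0 y0; case: (leP x y) => [/W|/ltW/W h]; first exact.
  by rewrite distrC (distrC x); exact: h.
move=> x0 y0.
rewrite [X in _ <= _ * X]distrC [X in _ <= _ * X]ger0_norm ?subr_ge0//.
have hxy : 0 <= y - x by lra.
case: (leP 0 (c - y ^+ 2)) => hy.
  have hx : 0 <= c - x ^+ 2 by nra.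
  have yr : y <= r by nra.
  by rewrite (max_idPr hx) ger0_norm; nra.
rewrite subr0; case: (leP 0 (c - x ^+ 2)) => hx; last first.
  by rewrite normr0 mulr_ge0// mulr_ge0.
have xr : x <= r by nra.
rewrite ger0_norm//.
case: (leP y r) => yr; first by nra.
by apply: (@le_trans _ _ ((r - x) * (r + x))); nra.
Qed.

Lemma lip2_cap r : 0 <= r -> lip2 (cap r) (2 * r).
Proof.
move=> r0 u u' v v'; rewrite /cap.
have h1 := @parabola_lip (r ^+ 2 - u ^+ 2) r v v' r0.
have h2 := @parabola_lip (r ^+ 2 - v' ^+ 2) r u u' r0.
have e w z : r ^+ 2 - w ^+ 2 - z ^+ 2 = r ^+ 2 - z ^+ 2 - w ^+ 2 :> R by ring.
rewrite !(e _ v') in h2 *.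
rewrite mulrDr; apply: (le_trans (ler_distD (Num.max 0 (r ^+ 2 - u ^+ 2 - v' ^+ 2)) _ _)).
rewrite addrC lerD//.
- by rewrite (e u v'); apply: h2; rewrite lerBlDr lerDl sqr_ge0.
- by apply: h1; rewrite lerBlDr lerDl sqr_ge0.
Qed.

Lemma cap_bound r u v : `|cap r u v| <= r ^+ 2.
Proof.
rewrite /cap ger0_norm ?le_max ?lexx// ge_max sqr_ge0 /=.
have := sqr_ge0 u; have := sqr_ge0 v; lra.
Qed.

Lemma supported_cap r : 0 <= r -> supported (cap r) r.
Proof.
move=> r0 u v h; rewrite /cap; apply/max_idPl.
have := sqr_ge0 u; have := sqr_ge0 v.
rewrite -(real_normK (num_real u)) -(real_normK (num_real v)).
by case: h => h; nra.
Qed.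

Lemma cap_rotation r ca sa u v : ca ^+ 2 + sa ^+ 2 = 1 ->
  cap r (ca * u + sa * v) (ca * v - sa * u) = cap r u v.
Proof.
move=> cs; rewrite /cap; congr Num.max.
have -> : r ^+ 2 - (ca * u + sa * v) ^+ 2 - (ca * v - sa * u) ^+ 2 =
  r ^+ 2 - (ca ^+ 2 + sa ^+ 2) * (u ^+ 2 + v ^+ 2) by ring.
by rewrite cs; ring.
Qed.

Lemma lip2_cap_cos r a b : 0 <= r ->
  lip2 (fun u v => cap r u v * cos (a * u + b * v))
    (2 * r * 1 + r ^+ 2 * (`|a| + `|b|)).
Proof.
move=> r0; apply: lip2M.
- exact: lip2_cap.
- exact: lip2_cos.
- lra.
- by rewrite addr_ge0.
- exact: cap_bound.
- by move=> u v; exact: cos_bound.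
Qed.

(** As [cap] is radial, the frequency [(a, b)] can be rotated onto the first
    axis. *)
Lemma cap_transform_rotation r a b B : 0 < r -> 0 <= a -> 8 * r < B ->
  integ2 (fun u v => cap r u v * cos (a * u + b * v)) B =
  integ2 (fun u v => cap r u v * cos (Num.sqrt (a ^+ 2 + b ^+ 2) * u)) B.
Proof.
move=> r0 a0 rB; set p := Num.sqrt _.
have p2 : p ^+ 2 = a ^+ 2 + b ^+ 2 by rewrite sqr_sqrtr// addr_ge0 ?sqr_ge0.
have p0 : 0 <= p by exact: sqrtr_ge0.
have [pz|pn] := eqVneq p 0.
  have [az bz] : a = 0 /\ b = 0.
    by move: p2; rewrite pz expr0n /=; have := sqr_ge0 a; have := sqr_ge0 b; split; nra.
  rewrite az bz; congr integ2; apply/funext => u; apply/funext => v.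
  by rewrite !mul0r pz addr0 mul0r.
have pp : 0 < p by rewrite lt_neqAle eq_sym pn.
pose F u v := cap r u v * cos (p * u).
have lF : lip2 F (2 * r * 1 + r ^+ 2 * (`|p| + `|0 : R|)).
  rewrite (_ : F = fun u v => cap r u v * cos (p * u + 0 * v)).
    exact: lip2_cap_cos (ltW r0).
  by apply/funext => u; apply/funext => v; rewrite mul0r addr0.
have sF : supported F r.
  by move=> u v h; rewrite /F (supported_cap (ltW r0) h) mul0r.
have ca0 : 0 <= a / p by rewrite divr_ge0.
have cs : (a / p) ^+ 2 + (b / p) ^+ 2 = 1.
  rewrite !expr_div_n -mulrDl -p2 mulfV// expf_neq0//.
rewrite -[RHS](integ2_rotation (ltW r0) ca0 cs rB lF sF).
congr integ2; apply/funext => u; apply/funext => v.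
rewrite /F cap_rotation//; congr (_ * cos _).
by field.
Qed.

(** The Fourier transform of [(1 - |y|^2)_+] at a point of norm [p]; this is
    [4 pi J_2(p) / p^2]. *)
Definition cap_hat (p : R) : R :=
  4 / 3 * integ (fun t => cos (p * cos t) * sin t ^+ 4) 0 pi.

Lemma integ_cap_slice r u B : 0 < r -> r < B ->
  integ (cap r u) (- B) B = 4 / 3 * Num.sqrt (r ^+ 2 - u ^+ 2) ^+ 3.
Proof.
move=> r0 rB; have cc := lip2_contr (u := u) (lip2_cap (ltW r0)).
set s := Num.sqrt _; set c := r ^+ 2 - u ^+ 2.
have s0 : 0 <= s by exact: sqrtr_ge0.
case: (leP c 0) => hc.
  rewrite /s ler0_sqrtr// expr0n /= mulr0 (_ : cap r u = fun=> 0).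
    by rewrite integ_cst mul0r.
  apply/funext => v; rewrite /cap; apply/max_idPl; rewrite -/c.
  by have := sqr_ge0 v; lra.
have s2 : s ^+ 2 = c by rewrite sqr_sqrtr// ltW.
have sr : s <= r by have := sqr_ge0 u; rewrite /c in s2; nra.
rewrite -(integ_cat _ _ (- s)) -(integ_cat _ (- s) s).
rewrite (@integ_eq0 _ (- B) (- s)) // ?(@integ_eq0 _ s B) //.
- rewrite add0r addr0 (@integ_FTC _ _ (fun v => c * v - v ^+ 3 / 3)) //.
  + by rewrite -s2; field.
  + by lra.
  + by cont.
  + move=> v /andP[v1 v2]; apply: hd_eq; first by der.
    rewrite /cap -/c (max_idPr _) /=; last by rewrite -s2; nra.
    by field.
- move=> v; rewrite (min_idPl _) ?(max_idPr _); try lra; move=> /andP[v1 v2].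
  by rewrite /cap; apply/max_idPl; rewrite -/c -s2; nra.
- move=> v; rewrite (min_idPl _) ?(max_idPr _); try lra; move=> /andP[v1 v2].
  by rewrite /cap; apply/max_idPl; rewrite -/c -s2; nra.
Qed.

(** The slice at [u] has integral [4/3 (r^2 - u^2)^(3/2)], and the
    substitution [u = r cos t] does the rest. *)
Lemma integ2_cap_cos r p B : 0 < r -> r < B ->
  integ2 (fun u v => cap r u v * cos (p * u)) B = r ^+ 4 * cap_hat (r * p).
Proof.
move=> r0 rB.
pose h u := 4 / 3 * Num.sqrt (r ^+ 2 - u ^+ 2) ^+ 3 * cos (p * u).
have ch : continuous h by rewrite /h; cont.
have -> : integ2 (fun u v => cap r u v * cos (p * u)) B = integ h (- B) B.
  rewrite /integ2; congr integ; apply/funext => u.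
  rewrite integZr ?integ_cap_slice//.
  exact: (lip2_contr (u := u) (lip2_cap (ltW r0))).
have h0 u : r <= `|u| -> h u = 0.
  move=> ru; rewrite /h ler0_sqrtr ?expr0n ?mulr0 ?mul0r //.
  by rewrite -(real_normK (num_real u)); nra.
rewrite -(integ_cat _ _ (- r)) -(integ_cat _ (- r) r).
rewrite (@integ_eq0 _ (- B) (- r)) // ?(@integ_eq0 _ r B) //; first last.
- move=> v; rewrite (min_idPl _) ?(max_idPr _); try lra; move=> /andP[v1 v2].
  by apply: h0; rewrite ler0_norm; lra.
- move=> v; rewrite (min_idPl _) ?(max_idPr _); try lra; move=> /andP[v1 v2].
  by apply: h0; rewrite ger0_norm; lra.
rewrite add0r addr0 /cap_hat mulrA -integZ; last by cont.
rewrite [RHS](@integ_FTC _ _ (fun t => - prim h (r * cos t))).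
- by rewrite cospi cos0 /integ mulr1 mulrN1; ring.
- exact: pi_ge0.
- by cont.
- by cont; apply: cont_comp; [exact: prim_continuous|cont].
move=> t /andP[t0 tp]; apply: hd_eq.
  by apply: hd_opp; apply: hd_comp; [exact: primP|der].
have st : 0 <= sin t by apply: sin_ge0_pi; rewrite !ltW.
have -> : h (r * cos t) = 4 / 3 * (r * sin t) ^+ 3 * cos (r * p * cos t).
  rewrite /h; congr (_ * _ ^+ 3 * cos _); last by ring.
  have -> : r ^+ 2 - (r * cos t) ^+ 2 = (r * sin t) ^+ 2.
    by rewrite -[r ^+ 2]mulr1 -(cos2Dsin2 t); ring.
  by rewrite sqrtr_sqr ger0_norm// mulr_ge0// ltW.
by rewrite /=; ring.
Qed.

(** A product of cosines is the half-sum of the cosines of frequencies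
    [(k, l)] and [(k, - l)], which have the same norm. *)
Lemma fourier_cap r M k l : 0 < r -> 8 * r < half_side M ->
  fourier (cap r) M k l =
    r ^+ 4 * cap_hat (2 * pi * r * enorm (k, l)).
Proof.
move=> r0 rM; set B : R := half_side M.
have ap0 : 0 <= 2 * pi * `|k|%:~R :> R by rewrite mulr_ge0 ?mulr_ge0 ?pi_ge0 ?ler0z.
have rB : r < B by rewrite /B; lra.
pose G b u v := cap r u v * cos (2 * pi * `|k|%:~R * u + b * v).
have lG b := lip2_cap_cos (2 * pi * `|k|%:~R) b (ltW r0).
have cG b u := lip2_contr (u := u) (lG b).
have cG2 b := @integ_lip_continuous _ _ _ (- B) B (lG b).
have -> : fourier (cap r) M k l = 2^-1 *
    (integ2 (G (2 * pi * l%:~R)) B + integ2 (G (- (2 * pi * l%:~R))) B).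
  rewrite mulrDr /fourier /integ2 -(integ_lin _ _ _ _ (cG2 _) (cG2 _)).
  congr integ; apply/funext => u.
  rewrite -(integ_lin _ _ _ _ (cG _ _) (cG _ _)).
  rewrite -integZ; last first.
    have cc := lip2_contr (u := u) (lip2_cap (ltW r0)).
    by have cw := @wave_continuous R l; cont.
  congr integ; apply/funext => v.
  have -> : wave k u = cos (2 * pi * `|k|%:~R * u).
    rewrite /wave; case: (leP 0 k) => k0; first by rewrite ger0_norm.
    by rewrite ltr0_norm// rmorphN /= mulrN mulNr cosN.
  by rewrite /wave /G !mulNr cosB cosD; field.
have key b : b ^+ 2 = (2 * pi * l%:~R) ^+ 2 ->
    integ2 (G b) B = r ^+ 4 * cap_hat (2 * pi * r * enorm (k, l)).
  move=> b2; rewrite cap_transform_rotation// integ2_cap_cos//.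
  congr (_ * cap_hat _).
  have -> : (2 * pi * `|k|%:~R) ^+ 2 + b ^+ 2 =
      (2 * pi) ^+ 2 * (k%:~R ^+ 2 + l%:~R ^+ 2) :> R.
    rewrite b2 exprMn intr_norm real_normK ?num_real// exprMn; ring.
  rewrite sqrtrM ?sqr_ge0// sqrtr_sqr ger0_norm ?mulr_ge0 ?pi_ge0//.
  by rewrite /enorm /=; ring.
by rewrite !key ?sqrrN //; field.
Qed.

End Rotation.

(** * Asymptotic expansions for [w'' + (1 + mu / x^2) w = 0] *)

Section Monotone.
Context {R : realType}.
Implicit Types (F f : R -> R) (a b c x y : R).

Lemma hasder_le F f a b : a <= b -> (forall x, a <= x <= b -> hasder F x (f x)) ->
  (forall x, a <= x <= b -> 0 <= f x) -> F a <= F b.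
Proof.
move=> ab dF f0; have [c cab E] := mvt ab dF.
by rewrite -subr_ge0 E mulr_ge0 ?subr_ge0// f0.
Qed.

Lemma hasder_ge F f a b : a <= b -> (forall x, a <= x <= b -> hasder F x (f x)) ->
  (forall x, a <= x <= b -> f x <= 0) -> F b <= F a.
Proof.
move=> ab dF f0; have [c cab E] := mvt ab dF.
by rewrite -subr_le0 E mulr_le0_ge0 ?subr_ge0// f0.
Qed.

Lemma hasder_lip F f (M a b : R) : (forall x, Num.min a b <= x <= Num.max a b -> hasder F x (f x)) ->
  (forall x, Num.min a b <= x <= Num.max a b -> `|f x| <= M) -> `|F b - F a| <= M * `|b - a|.
Proof.
wlog ab : a b / a <= b => [W dF fM|].
  case: (leP a b) => [/W|/ltW/W h]; first exact.
  by rewrite distrC (distrC b); apply: h; rewrite minC maxC.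
rewrite (min_idPl ab) (max_idPr ab) => dF fM.
have [c cab ->] := mvt ab dF.
by rewrite normrM ler_wpM2r// fM.
Qed.

(** The limit exists because [p - C / x^(n+1)] increases and [p + C / x^(n+1)]
    decreases. *)
Lemma hasder_tail (p q : R -> R) (C : R) n :
  (forall x, 1 <= x -> hasder p x (q x)) ->
  (forall x, 1 <= x -> `|q x| <= C * x^-1 ^+ n.+2) ->
  exists l, forall x, 1 <= x -> `|p x - l| <= C * x^-1 ^+ n.+1.
Proof.
move=> dp qC.
have C0 : 0 <= C.
  by have := qC 1 (lexx _); rewrite invr1 expr1n mulr1; apply: le_trans.
pose U x := p x + C * x^-1 ^+ n.+1.
pose V x := p x - C * x^-1 ^+ n.+1.
have dy x : 1 <= x -> hasder (fun x => C * x^-1 ^+ n.+1) x (- (C * n.+1%:R * x^-1 ^+ n.+2)).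
  move=> x1; have x0 : x != 0 by rewrite gt_eqF// (lt_le_trans _ x1).
  apply: hd_eq; first by der.
  by rewrite /= -exprVn !exprS; ring.
have ineq x : 1 <= x -> `|q x| <= C * n.+1%:R * x^-1 ^+ n.+2.
  move=> x1; apply: (le_trans (qC x x1)); rewrite ler_wpM2r//.
    by rewrite exprn_ge0// invr_ge0 (le_trans _ x1).
  by rewrite ler_peMr// ler1n.
have Ule x y : 1 <= x -> x <= y -> U y <= U x.
  move=> x1 xy; apply: (@hasder_ge U (fun x => q x - C * n.+1%:R * x^-1 ^+ n.+2)) => // z /andP[xz _].
    by apply: hd_add; [apply: dp|apply: dy]; exact: le_trans xz.
  by have := ineq z (le_trans x1 xz); rewrite ler_norml => /andP[_]; rewrite subr_le0.
have Vle x y : 1 <= x -> x <= y -> V x <= V y.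
  move=> x1 xy; apply: (@hasder_le V (fun x => q x - - (C * n.+1%:R * x^-1 ^+ n.+2))) => // z /andP[xz _].
    by apply: hd_add; [apply: dp|apply: hd_opp; apply: dy]; exact: le_trans xz.
  by have := ineq z (le_trans x1 xz); rewrite ler_norml => /andP[+ _]; rewrite opprK -lerBlDr sub0r.
have pw0 x : 1 <= x -> 0 <= C * x^-1 ^+ n.+1.
  by move=> x1; rewrite mulr_ge0// exprn_ge0// invr_ge0 (le_trans _ x1).
have VU x y : 1 <= x -> 1 <= y -> V x <= U y.
  move=> x1 y1; have VUz z : 1 <= z -> V z <= U z.
    by move=> z1; have := pw0 z z1; rewrite /U /V; lra.
  case: (leP x y) => [xy|/ltW yx].
    by apply: (le_trans (Vle _ _ x1 xy)); exact: VUz.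
  by apply: (le_trans (VUz _ x1)); exact: Ule.
pose S := [set V x | x in [set x | 1 <= x]].
have S0 : S !=set0 by exists (V 1); exists 1 => //=.
have Sub y : 1 <= y -> ubound S (U y) by move=> y1 _ [x x1 <-]; exact: VU.
exists (sup S) => x x1.
have h1 : sup S <= U x by apply: ge_sup => //; exact: Sub.
have h2 : V x <= sup S.
  by apply: ub_le_sup; [exists (U 1); exact: Sub|exists x].
by rewrite ler_norml; move: h1 h2; rewrite /U /V => h1 h2; apply/andP; split; lra.
Qed.

End Monotone.

Section Liouville.
Context {R : realType}.
Implicit Types (a b c x y mu : R).

(** The coefficients of the formal solution
    [sum_k x^-k (al_k cos x + be_k sin x)] of [w'' + (1 + mu / x^2) w = 0]. *)
Fixpoint liouville_coef mu a b (k : nat) : R * R :=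
  if k is k'.+1 then
    let kap := (k'%:R * k'.+1%:R + mu) / (2 * k'.+1%:R) in
    (- (kap * (liouville_coef mu a b k').2), kap * (liouville_coef mu a b k').1)
  else (a, b).

Definition osc (c : R * R) x := c.1 * cos x + c.2 * sin x.
Definition osc' (c : R * R) x := c.2 * cos x - c.1 * sin x.

Definition liouville_sum mu a b N x :=
  \sum_(k < N) x^-1 ^+ k * osc (liouville_coef mu a b k) x.
Definition liouville_sum' mu a b N x :=
  \sum_(k < N) (x^-1 ^+ k * osc' (liouville_coef mu a b k) x -
    k%:R * x^-1 ^+ k.+1 * osc (liouville_coef mu a b k) x).
Definition liouville_sum'' mu a b N x :=
  \sum_(k < N) (k%:R * k.+1%:R * x^-1 ^+ k.+2 * osc (liouville_coef mu a b k) x -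
    2 * k%:R * x^-1 ^+ k.+1 * osc' (liouville_coef mu a b k) x -
    x^-1 ^+ k * osc (liouville_coef mu a b k) x).

Lemma liouville_sumS mu a b N x : liouville_sum mu a b N.+1 x =
  liouville_sum mu a b N x + x^-1 ^+ N * osc (liouville_coef mu a b N) x.
Proof. exact: big_ord_recr. Qed.

Lemma liouville_sum'S mu a b N x : liouville_sum' mu a b N.+1 x =
  liouville_sum' mu a b N x + (x^-1 ^+ N * osc' (liouville_coef mu a b N) x -
    N%:R * x^-1 ^+ N.+1 * osc (liouville_coef mu a b N) x).
Proof. exact: big_ord_recr. Qed.

Lemma liouville_sum''S mu a b N x : liouville_sum'' mu a b N.+1 x =
  liouville_sum'' mu a b N x +
  (N%:R * N.+1%:R * x^-1 ^+ N.+2 * osc (liouville_coef mu a b N) x -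
    2 * N%:R * x^-1 ^+ N.+1 * osc' (liouville_coef mu a b N) x -
    x^-1 ^+ N * osc (liouville_coef mu a b N) x).
Proof. exact: big_ord_recr. Qed.

Lemma hd_osc (c : R * R) x : hasder (osc c) x (osc' c x).
Proof. by apply: hd_eq; [rewrite /osc; der|rewrite /osc' /=; ring]. Qed.

Lemma hd_osc' (c : R * R) x : hasder (osc' c) x (- osc c x).
Proof. by apply: hd_eq; [rewrite /osc'; der|rewrite /osc /=; ring]. Qed.

Lemma osc_bound (c : R * R) x : `|osc c x| <= `|c.1| + `|c.2|.
Proof.
apply: (le_trans (ler_normD _ _)); rewrite !normrM.
by apply: lerD; rewrite -[leRHS]mulr1 ler_pM// ?cos_bound ?sin_bound.
Qed.

Lemma osc'_bound (c : R * R) x : `|osc' c x| <= `|c.1| + `|c.2|.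
Proof.
apply: (le_trans (ler_normB _ _)); rewrite !normrM addrC.
by apply: lerD; rewrite -[leRHS]mulr1 ler_pM// ?cos_bound ?sin_bound.
Qed.

Lemma hd_ipow k x : x != 0 -> hasder (fun x => x^-1 ^+ k) x (- (k%:R * x^-1 ^+ k.+1)).
Proof.
move=> x0; apply: hd_eq; first by der.
case: k => [|k]; first by rewrite /= !mul0r oppr0.
by rewrite /= -exprVn !exprS; ring.
Qed.

Lemma hd_liouville_sum mu a b N x : x != 0 ->
  hasder (liouville_sum mu a b N) x (liouville_sum' mu a b N x).
Proof.
move=> x0; apply: hd_eq.
  apply: (@hd_sum _ _ _ _ (fun k : 'I_N => fun x => x^-1 ^+ k * osc (liouville_coef mu a b k) x)).
  by move=> k; apply: hd_mul; [exact: hd_ipow|exact: hd_osc].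
by apply: eq_bigr => k _ /=; ring.
Qed.

Lemma hd_liouville_sum' mu a b N x : x != 0 ->
  hasder (liouville_sum' mu a b N) x (liouville_sum'' mu a b N x).
Proof.
move=> x0; apply: hd_eq.
  apply: (@hd_sum _ _ _ _ (fun k : 'I_N => fun x =>
    x^-1 ^+ k * osc' (liouville_coef mu a b k) x -
    k%:R * x^-1 ^+ k.+1 * osc (liouville_coef mu a b k) x)).
  move=> k; apply: hd_add; first by apply: hd_mul; [exact: hd_ipow|exact: hd_osc'].
  by apply: hd_opp; apply: hd_mul; [apply: hd_mul; [exact: hd_cst|exact: hd_ipow]|exact: hd_osc].
by apply: eq_bigr => k _ /=; ring.
Qed.

(** The recursion for the coefficients makes the residual telescope. *)
Lemma liouville_residual mu a b N x : x != 0 ->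
  liouville_sum'' mu a b N.+1 x + (1 + mu * x^-1 ^+ 2) * liouville_sum mu a b N.+1 x =
  (N%:R * N.+1%:R + mu) * x^-1 ^+ N.+2 * osc (liouville_coef mu a b N) x.
Proof.
move=> x0; elim: N => [|N IH].
  by rewrite /liouville_sum'' /liouville_sum !big_ord1 /=; ring.
rewrite (liouville_sum''S _ _ _ N.+1) (liouville_sumS _ _ _ N.+1).
rewrite (mulrDr (1 + mu * x^-1 ^+ 2)) [LHS]addrACA IH.
have N0 : N.+1%:R != 0 :> R by rewrite pnatr_eq0.
rewrite /osc /osc' /= !exprS.
move: (liouville_coef mu a b N) => [al be] /=.
have -> : N.+2%:R = N.+1%:R + 1 :> R by rewrite natr1.
have -> : N%:R = N.+1%:R - 1 :> R by rewrite -natr1 addrK.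
by move: (N.+1%:R : R) N0 => n n0; field; apply/andP; split.
Qed.

Section Solution.
Variables (w w' : R -> R) (mu : R).
Hypothesis dw : forall x, 1 <= x -> hasder w x (w' x).
Hypothesis dw' : forall x, 1 <= x -> hasder w' x (- (1 + mu * x^-1 ^+ 2) * w x).

(** The logarithmic derivative of the energy [w^2 + w'^2] is at most
    [|mu| / x^2], which is integrable at infinity. *)
Lemma liouville_bounded : exists C : R, forall x, 1 <= x -> `|w x| <= C /\ `|w' x| <= C.
Proof.
pose E x := w x ^+ 2 + w' x ^+ 2.
pose F x := E x * expR (`|mu| * x^-1).
have E0 x : 0 <= E x by rewrite addr_ge0 ?sqr_ge0.
have FF x : 1 <= x -> F x <= F 1.
  move=> x1; apply: (@hasder_ge _ F (fun x => expR (`|mu| * x^-1) *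
      (- 2 * mu * x^-1 ^+ 2 * (w x * w' x) - `|mu| * x^-1 ^+ 2 * E x))) => //.
    move=> z /andP[z1 _]; have z0 : z != 0 by rewrite gt_eqF// (lt_le_trans _ z1).
    have h1 := dw z1; have h2 := dw' z1.
    apply: hd_eq.
      by rewrite /F /E; apply: hd_mul;
        [apply: hd_add; apply: hd_pow; eassumption|apply: hd_exp; der].
    by rewrite /= -exprVn /E; ring.
  move=> z /andP[z1 _]; rewrite mulr_ge0_le0 ?expR_ge0//.
  rewrite subr_le0.
  have -> : - 2 * mu * z^-1 ^+ 2 * (w z * w' z) = z^-1 ^+ 2 * (- mu * (2 * (w z * w' z))) by ring.
  rewrite (mulrC `|mu|) -(mulrA (z^-1 ^+ 2)) ler_wpM2l ?sqr_ge0//.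
  apply: (le_trans (ler_norm _)); rewrite normrM normrN ler_wpM2l//.
  have := sqr_ge0 (w z + w' z); have := sqr_ge0 (w z - w' z).
  by rewrite /E ler_norml => h3 h4; apply/andP; split; lra.
exists (1 + F 1) => x x1.
have h : E x <= F 1.
  apply: le_trans (FF x x1); rewrite /F ler_peMr// -expR0 ler_expR.
  by rewrite mulr_ge0// invr_ge0 (le_trans _ x1).
have F0 : 0 <= F 1 by exact: le_trans h.
move: h; rewrite /E -(real_normK (num_real (w x))) -(real_normK (num_real (w' x))).
by have := normr_ge0 (w x); have := normr_ge0 (w' x); split; nra.
Qed.

(** Variation of constants: with [p = w cos - w' sin] and [q = w sin + w' cos]
    one has [w = p cos + q sin], and [p' = mu w sin / x^2],
    [q' = - mu w cos / x^2]. *)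
Lemma liouville_leading : exists a b C : R, forall x, 1 <= x ->
  `|w x - osc (a, b) x| <= C * x^-1 /\ `|w' x - osc' (a, b) x| <= C * x^-1.
Proof.
have [C hC] := liouville_bounded.
pose p x := w x * cos x - w' x * sin x.
pose q x := w x * sin x + w' x * cos x.
have B x : 1 <= x -> `|mu * w x| <= `|mu| * C.
  by move=> x1; rewrite normrM ler_wpM2l//; case: (hC x x1).
have [a ha] : exists a, forall x, 1 <= x -> `|p x - a| <= `|mu| * C * x^-1 ^+ 1.
  apply: (@hasder_tail _ p (fun x => mu * w x * sin x * x^-1 ^+ 2)) => x x1.
    have h1 := dw x1; have h2 := dw' x1.
    by apply: hd_eq; [rewrite /p; der|rewrite /=; ring].
  rewrite normrM [ `|_ ^+ 2|]ger0_norm ?sqr_ge0// ler_wpM2r ?sqr_ge0//.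
  by rewrite normrM -[leRHS]mulr1 ler_pM// ?B// sin_bound.
have [b hb] : exists b, forall x, 1 <= x -> `|q x - b| <= `|mu| * C * x^-1 ^+ 1.
  apply: (@hasder_tail _ q (fun x => - (mu * w x * cos x * x^-1 ^+ 2))) => x x1.
    have h1 := dw x1; have h2 := dw' x1.
    by apply: hd_eq; [rewrite /q; der|rewrite /=; ring].
  rewrite normrN normrM [ `|_ ^+ 2|]ger0_norm ?sqr_ge0// ler_wpM2r ?sqr_ge0//.
  by rewrite normrM -[leRHS]mulr1 ler_pM// ?B// cos_bound.
exists a, b, (2 * (`|mu| * C)) => x x1.
have e : cos x ^+ 2 + sin x ^+ 2 = 1 := cos2Dsin2 x.
have := ha x x1; have := hb x x1; rewrite expr1.
set d := `|mu| * C * x^-1 => hq hp.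
have s1 := sin_bound x; have c1 := cos_bound x.
have dE : 2 * (`|mu| * C) * x^-1 = d + d by rewrite /d; ring.
rewrite dE; split.
  have -> : w x - osc (a, b) x = (p x - a) * cos x + (q x - b) * sin x.
    rewrite /osc /p /q /= -[w x in LHS]mulr1 -e; ring.
  apply: (le_trans (ler_normD _ _)); rewrite !normrM.
  by apply: lerD; rewrite -[leRHS]mulr1 ler_pM.
have -> : w' x - osc' (a, b) x = (q x - b) * cos x - (p x - a) * sin x.
  rewrite /osc' /p /q /= -[w' x in LHS]mulr1 -e; ring.
apply: (le_trans (ler_normB _ _)); rewrite !normrM.
by apply: lerD; rewrite -[leRHS]mulr1 ler_pM.
Qed.

(** By induction on [N]: once one more term is subtracted, an error of order
    [x^-N] satisfies the equation up to [O(x^-(N+2))], and variation of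
    constants makes its coefficients [p] and [q] converge at the rate
    [x^-(N+1)]; their limits vanish since the error itself tends to zero. *)
Lemma liouville_expansion a b C1 : (forall x, 1 <= x ->
    `|w x - osc (a, b) x| <= C1 * x^-1 /\ `|w' x - osc' (a, b) x| <= C1 * x^-1) ->
  forall N, exists C : R, forall x, 1 <= x ->
    `|w x - liouville_sum mu a b N.+1 x| <= C * x^-1 ^+ N.+1 /\
    `|w' x - liouville_sum' mu a b N.+1 x| <= C * x^-1 ^+ N.+1.
Proof.
move=> h0; elim=> [|N [C hC]].
  exists C1 => x x1; rewrite expr1 /liouville_sum /liouville_sum' !big_ord1.
  by rewrite expr0 !mul1r !mul0r subr0; exact: h0.
pose d x := w x - liouville_sum mu a b N.+2 x.
pose d' x := w' x - liouville_sum' mu a b N.+2 x.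
set c := liouville_coef mu a b N.+1.
pose kap : R := N.+1%:R * N.+2%:R + mu.
have dd x : 1 <= x -> hasder d x (d' x).
  move=> x1; have x0 : x != 0 by rewrite gt_eqF// (lt_le_trans _ x1).
  by apply: hd_add; [exact: dw|apply: hd_opp; exact: hd_liouville_sum].
have dd' x : 1 <= x -> hasder d' x
    (- d x - mu * x^-1 ^+ 2 * d x - kap * x^-1 ^+ N.+3 * osc c x).
  move=> x1; have x0 : x != 0 by rewrite gt_eqF// (lt_le_trans _ x1).
  apply: hd_eq.
    by apply: hd_add; [exact: dw'|apply: hd_opp; exact: hd_liouville_sum'].
  have := liouville_residual mu a b N.+1 x0.
  rewrite -/kap -/c => <-; rewrite /d; ring.
have [K [K0 oscK oscK']] : exists K : R, [/\ 0 <= K,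
    forall x, `|osc c x| <= K & forall x, `|osc' c x| <= K].
  exists (`|c.1| + `|c.2|); split; first by rewrite addr_ge0.
    exact: osc_bound.
  exact: osc'_bound.
have y01 x : 1 <= x -> 0 <= x^-1 <= 1.
  by move=> x1; rewrite invr_ge0 invf_le1 ?(lt_le_trans _ x1)// (le_trans _ x1).
pose C2 := C + K + N.+1%:R * K.
have bd x : 1 <= x -> `|d x| <= C2 * x^-1 ^+ N.+1 /\ `|d' x| <= C2 * x^-1 ^+ N.+1.
  move=> x1; have [h1 h2] := hC x x1; have /andP[y0 y1] := y01 x x1.
  have yN : 0 <= x^-1 ^+ N.+1 by rewrite exprn_ge0.
  have KN : 0 <= N.+1%:R * K by rewrite mulr_ge0.
  split.
    rewrite /d liouville_sumS opprD addrA -/c.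
    apply: (le_trans (ler_normB _ _)); rewrite normrM (ger0_norm yN) /C2 !mulrDl.
    have : x^-1 ^+ N.+1 * `|osc c x| <= K * x^-1 ^+ N.+1.
      by rewrite mulrC ler_wpM2r.
    have : 0 <= N.+1%:R * K * x^-1 ^+ N.+1 by rewrite mulr_ge0.
    by move: h1; lra.
  rewrite /d' liouville_sum'S opprD addrA -/c.
  apply: (le_trans (ler_normB _ _)); rewrite /C2 !mulrDl -addrA; apply: lerD => //.
  apply: (le_trans (ler_normB _ _)); apply: lerD.
    by rewrite normrM (ger0_norm yN) mulrC ler_wpM2r.
  rewrite normrM ger0_norm ?mulr_ge0 ?exprn_ge0// mulrAC.
  rewrite ler_pM ?mulr_ge0 ?exprn_ge0//; first by rewrite ler_wpM2l.
  by rewrite exprS ler_piMl.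
pose C3 := `|mu| * C2 + `|kap| * K.
(* The residual of the truncated expansion is one more source term, of the
    same order as [mu * d x / x^2]. *)
pose r x := mu * x^-1 ^+ 2 * d x + kap * x^-1 ^+ N.+3 * osc c x.
have rb x : 1 <= x -> `|r x| <= C3 * x^-1 ^+ N.+3.
  move=> x1; have [h1 _] := bd x x1; have /andP[y0 y1] := y01 x x1.
  apply: (le_trans (ler_normD _ _)); rewrite /C3 [leRHS]mulrDl; apply: lerD.
    rewrite -mulrA normrM -mulrA ler_wpM2l// normrM ger0_norm ?sqr_ge0//.
    by rewrite (exprD _ 2 N.+1) mulrCA ler_wpM2l ?sqr_ge0.
  rewrite mulrAC normrM [ `|_ ^+ _|]ger0_norm ?exprn_ge0// ler_wpM2r ?exprn_ge0//.
  by rewrite normrM ler_wpM2l.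
pose p x := d x * cos x - d' x * sin x.
pose q x := d x * sin x + d' x * cos x.
have [la ha] : exists a, forall x, 1 <= x -> `|p x - a| <= C3 * x^-1 ^+ N.+2.
  apply: (@hasder_tail _ p (fun x => r x * sin x)) => x x1.
    have h1 := dd _ x1; have h2 := dd' _ x1.
    by apply: hd_eq; [rewrite /p; der|rewrite /r /=; ring].
  by rewrite normrM -[leRHS]mulr1 ler_pM// ?rb// sin_bound.
have [lb hb] : exists a, forall x, 1 <= x -> `|q x - a| <= C3 * x^-1 ^+ N.+2.
  apply: (@hasder_tail _ q (fun x => - (r x * cos x))) => x x1.
    have h1 := dd _ x1; have h2 := dd' _ x1.
    by apply: hd_eq; [rewrite /q; der|rewrite /r /=; ring].
  by rewrite normrN normrM -[leRHS]mulr1 ler_pM// ?rb// cos_bound.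
have zero (u : R -> R) l : (forall x, 1 <= x -> `|u x| <= 2 * C2 * x^-1 ^+ N.+1) ->
    (forall x, 1 <= x -> `|u x - l| <= C3 * x^-1 ^+ N.+2) -> l = 0.
  move=> hu hl; apply/eqP; rewrite -normr_eq0; apply: contraT => l0.
  have lp : 0 < `|l| by rewrite lt_neqAle eq_sym l0 normr_ge0.
  have D0 : 0 <= 2 * C2 + C3.
    have := hu 1 (lexx _); have := hl 1 (lexx _); rewrite invr1 !expr1n !mulr1.
    have := normr_ge0 (u 1 - l); have := normr_ge0 (u 1); lra.
  pose x := 1 + (2 * C2 + C3) / `|l|.
  have x1 : 1 <= x by rewrite lerDl divr_ge0.
  have x0 : 0 < x by apply: lt_le_trans x1.
  have /andP[y0 y1] := y01 x x1.
  have le : `|l| <= (2 * C2 + C3) * x^-1.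
    have -> : l = u x - (u x - l) by ring.
    apply: (le_trans (ler_normB _ _)); rewrite mulrDl; apply: lerD.
      apply: (le_trans (hu x x1)); rewrite exprS mulrA ler_piMr//; last first.
        by rewrite exprn_ile1.
      by rewrite mulr_ge0// -(pmulr_lge0 _ (_ : 0 < x^-1 ^+ N.+1)) ?exprn_gt0 ?invr_gt0//; apply: le_trans (hu x x1).
    apply: (le_trans (hl x x1)); rewrite exprS mulrA ler_piMr//; last first.
      by rewrite exprn_ile1.
    by rewrite mulr_ge0// -(pmulr_lge0 _ (_ : 0 < x^-1 ^+ N.+2)) ?exprn_gt0 ?invr_gt0//; apply: le_trans (hl x x1).
  move: le; rewrite ler_pdivlMr// /x mulrDr mulr1 mulrC divfK ?gt_eqF//.
  by rewrite -lerBrDr subrr leNgt lp.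
have pq x : 1 <= x -> `|p x| <= 2 * C2 * x^-1 ^+ N.+1 /\ `|q x| <= 2 * C2 * x^-1 ^+ N.+1.
  move=> x1; have [h1 h2] := bd x x1.
  rewrite -mulrA mulr2n mulrDl mul1r; split.
    apply: (le_trans (ler_normB _ _)); rewrite !normrM.
    by apply: lerD; rewrite -[leRHS]mulr1 ler_pM// ?cos_bound ?sin_bound.
  apply: (le_trans (ler_normD _ _)); rewrite !normrM.
  by apply: lerD; rewrite -[leRHS]mulr1 ler_pM// ?cos_bound ?sin_bound.
have la0 : la = 0 by apply: (zero p) => // x /pq[].
have lb0 : lb = 0 by apply: (zero q) => // x /pq[].
exists (2 * C3) => x x1.
have e : cos x ^+ 2 + sin x ^+ 2 = 1 := cos2Dsin2 x.
have := ha x x1; have := hb x x1; rewrite la0 lb0 !subr0.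
rewrite -mulrA; set D := C3 * _ => hq hp.
have s1 := sin_bound x; have c1 := cos_bound x.
rewrite mulr2n mulrDl mul1r; split.
  have -> : w x - liouville_sum mu a b N.+2 x = p x * cos x + q x * sin x.
    by rewrite -/(d x) /p /q -[d x in LHS]mulr1 -e; ring.
  apply: (le_trans (ler_normD _ _)); rewrite !normrM.
  by apply: lerD; rewrite -[leRHS]mulr1 ler_pM.
have -> : w' x - liouville_sum' mu a b N.+2 x = q x * cos x - p x * sin x.
  by rewrite -/(d' x) /p /q -[d' x in LHS]mulr1 -e; ring.
apply: (le_trans (ler_normB _ _)); rewrite !normrM.
by apply: lerD; rewrite -[leRHS]mulr1 ler_pM.
Qed.

End Solution.
End Liouville.

(** * An abelian theorem of order [x^(-1/2)] *)

Section Abelian.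
Context {R : realType}.
Implicit Types (a b x t u d e T M : R).

Lemma hd_integ_smooth (G G1 G2 : R -> R -> R) a b x0 (L : R) : a <= b ->
  (forall x, continuous (G x)) -> continuous (G1 x0) ->
  (forall x t, hasder (G ^~ t) x (G1 x t)) ->
  (forall x t, hasder (G1 ^~ t) x (G2 x t)) ->
  (forall x t, `|x - x0| <= 1 -> a <= t <= b -> `|G2 x t| <= L) ->
  hasder (fun x => integ (G x) a b) x0 (integ (G1 x0) a b).
Proof.
move=> ab cG cG1 dG dG1 bG2; apply: (@hd_integ _ G G1 a b x0 L) => // x t xx0 tab.
rewrite (_ : G1 x t = (G1 ^~ t) x) // (_ : G1 x0 t = (G1 ^~ t) x0) //.
apply: (@hasder_lip _ (G1 ^~ t) (G2 ^~ t) L) => // y.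
rewrite ge_min le_max => h; apply: bG2 => //.
move: xx0; rewrite !ler_norml => /andP[h1 h2].
by move: h => /andP[/orP[?|?] /orP[?|?]]; apply/andP; split; lra.
Qed.

(** The antiderivative [G] in [x] of the integrand decays like
    [expR (- (e * x))]: differentiating its integral over [a, b] exchanges the
    order of integration and shows the rate of convergence as [T] grows. *)
Lemma laplace_integ (G G1 G2 : R -> R -> R) a b e (C : R) : a <= b ->
  (forall x, continuous (G x)) -> (forall x, continuous (G1 x)) ->
  (forall x t, hasder (G ^~ t) x (G1 x t)) ->
  (forall x t, hasder (G1 ^~ t) x (G2 x t)) ->
  (forall x0, exists L : R, forall x t, `|x - x0| <= 1 -> a <= t <= b -> `|G2 x t| <= L) ->
  (forall x t, 0 <= x -> a <= t <= b -> `|G x t| <= C * expR (- (e * x))) ->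
  forall T, 0 <= T ->
  `|integ (fun x => integ (G1 x) a b) 0 T - integ (fun t => - G 0 t) a b|
    <= C * (b - a) * expR (- (e * T)).
Proof.
move=> ab cG cG1 dG dG1 bG2 bG T T0.
have dPhi x : hasder (fun x => integ (G x) a b) x (integ (G1 x) a b).
  by have [L hL] := bG2 x; exact: (@hd_integ_smooth G G1 G2 a b x L).
rewrite (integE 0 T dPhi) integN // opprK subrK.
by rewrite mulrAC; apply: ler_norm_integ_cst => // t tab; exact: bG.
Qed.

(** [atan z + 1 / z] decreases to [pi / 2]. *)
Lemma atan_ge x : 0 < x -> pi / 2 - x^-1 <= atan x.
Proof.
move=> x0; rewrite leNgt; apply/negP => h.
have dist : 0 < pi / 2 - x^-1 - atan x by lra.
have /cvgrPdist_lt/(_ _ dist) := @cvgy_atan R.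
move=> [M [Mr hM]].
pose y : R := Num.max x (M + 1).
have xy : x <= y by rewrite le_max lexx.
have My : M < y by rewrite lt_max ltrDl ltr01 orbT.
have := hM y My; rewrite ger0_norm; last by rewrite subr_ge0 ltW// atan_ltpi2.
have dd z : x <= z <= y -> hasder (fun z => atan z + z^-1) z ((1 + z ^+ 2)^-1 - z ^- 2).
  move=> /andP[xz _]; have z0 : z != 0 by rewrite gt_eqF// (lt_le_trans x0).
  by apply: hd_eq; [der|rewrite /=; ring].
have : atan y + y^-1 <= atan x + x^-1.
  apply: (hasder_ge xy dd) => z /andP[xz _]; have z0 := lt_le_trans x0 xz.
  rewrite subr_le0 lef_pV2 ?posrE ?exprn_gt0// ?ltr_pwDl ?sqr_ge0//.
  by rewrite lerDr.
have : 0 < y^-1 by rewrite invr_gt0 (lt_le_trans x0).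
lra.
Qed.

(** A function of exact order [x^(-1/2)], whose constant is given by the Gauss
    integral and whose Laplace transform is an arctangent. *)
Definition gauss_ref x := integ (fun s => expR (- (x * s ^+ 2))) 0 1.

Lemma gauss_ref_continuous : continuous gauss_ref.
Proof.
move=> x; apply: (@hd_continuous _ _ _ (integ (fun s => - s ^+ 2 * expR (- (x * s ^+ 2))) 0 1)).
apply: (@hd_integ_smooth (fun x s => expR (- (x * s ^+ 2)))
   (fun x s => - s ^+ 2 * expR (- (x * s ^+ 2)))
   (fun x s => s ^+ 4 * expR (- (x * s ^+ 2))) 0 1 x (expR (1 + `|x|))) => //.
- by move=> y; cont.
- by cont.
- by move=> y t; apply: hd_eq; [der|rewrite /=; ring].
- by move=> y t; apply: hd_eq; [der|rewrite /=; ring].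
- move=> y t yx /andP[t0 t1].
  rewrite normrM [ `|expR _|]ger0_norm ?expR_ge0// ger0_norm ?exprn_ge0//.
  rewrite -[leRHS]mul1r ler_pM ?expR_ge0 ?exprn_ge0 ?exprn_ile1//.
  rewrite ler_expR.
  have ny : `|y| <= 1 + `|x|.
    by rewrite -{1}(subrK x y); apply: (le_trans (ler_normD _ _)); rewrite lerD2r.
  apply: (le_trans (ler_norm _)); rewrite normrN normrM -[leRHS]mulr1 ler_pM//.
  by rewrite ger0_norm ?sqr_ge0// exprn_ile1.
Qed.

Lemma gauss_ref_bound x : 0 <= x -> 0 <= gauss_ref x <= 1.
Proof.
move=> x0; have c : continuous (fun s : R => expR (- (x * s ^+ 2))) by cont.
have e1 s : expR (- (x * s ^+ 2)) <= 1.
  by rewrite -expR0 ler_expR oppr_le0 mulr_ge0 ?sqr_ge0.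
apply/andP; split; first by apply: integ_ge0 => // s _; exact: expR_ge0.
apply: (le_trans (ler_norm _)).
have -> : 1 = 1 * (1 - 0) :> R by ring.
apply: ler_norm_integ_cst => // s _.
by rewrite ger0_norm ?expR_ge0.
Qed.

Lemma gauss_ref_cvg : (fun x => Num.sqrt x * gauss_ref x) @ +oo --> (Num.sqrt pi / 2 : R).
Proof.
have cg : continuous (@gauss_fun R) by exact: continuous_gauss_fun.
have E x : 0 < x -> Num.sqrt x * gauss_ref x = gauss_integral_proof.integral0_gauss (Num.sqrt x).
  move=> x0; have s0 : 0 < Num.sqrt x by rewrite sqrtr_gt0.
  rewrite /gauss_integral_proof.integral0_gauss integ_Rintegral ?sqrtr_ge0// /gauss_ref -integZ; last by cont.
  rewrite (@integE _ _ (fun s => prim (@gauss_fun R) (Num.sqrt x * s))).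
    by rewrite mulr1 mulr0.
  move=> s; apply: hd_eq; first by apply: hd_comp; [exact: primP|der].
  rewrite /= /gauss_fun exprMn sqr_sqrtr ?ltW//; ring.
have A : Num.sqrt (@gauss_integral_proof.integral0_gauss R x ^+ 2) @[x --> +oo] --> Num.sqrt (pi / 4).
  by apply: cvg_comp; [exact: gauss_integral_proof.cvg_integral0_gauss_sqr|exact: sqrt_continuous].
have B : Num.sqrt (pi / 4) = Num.sqrt pi / 2 :> R.
  rewrite sqrtrM ?pi_ge0// sqrtrV// (_ : 4 = 2 ^+ 2) ?sqrtr_sqr ?ger0_norm//.
  by rewrite -natrX.
rewrite B in A.
have S : Num.sqrt (x : R) @[x --> +oo] --> +oo.
  apply/cvgryPge => M; exists (M ^+ 2); split; first exact: num_real.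
  move=> x Mx; apply: (le_trans (ler_norm M)).
  by rewrite -sqrtr_sqr ler_wsqrtr// ltW.
have := cvg_comp _ _ S A; apply: cvg_trans; apply: near_eq_cvg.
near=> x; rewrite /= E; last by near: x; exact: nbhs_pinfty_gt.
by rewrite sqrtr_sqr ger0_norm// gauss_integral_proof.integral0_gauss_ge0.
Unshelve. all: end_near. Qed.

(** At [e = d^-2] the transform is [int_0^1 ds / (e + s^2)]. *)
Lemma gauss_ref_laplace d : 0 < d -> exists C : R, forall T, 0 <= T ->
  `|integ (fun x => expR (- (d ^- 2 * x)) * gauss_ref x) 0 T - d * atan d| <= C * expR (- (d ^- 2 * T)).
Proof.
move=> d0; set e := d ^- 2; have e0 : 0 < e by rewrite invr_gt0 exprn_gt0.
have den s : e + s ^+ 2 != 0 by rewrite gt_eqF// ltr_pwDl// sqr_ge0.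
have den0 s : 0 < e + s ^+ 2 by rewrite ltr_pwDl// sqr_ge0.
pose G x s := - (expR (- (e * x)) * expR (- (x * s ^+ 2)) * (e + s ^+ 2)^-1).
pose G1 x s := expR (- (e * x)) * expR (- (x * s ^+ 2)).
pose G2 x s := - (e + s ^+ 2) * (expR (- (e * x)) * expR (- (x * s ^+ 2))).
exists (e^-1 * (1 - 0)) => T T0.
have cden : continuous (fun s : R => (e + s ^+ 2)^-1) by apply: cont_inv => //; cont.
have -> : d * atan d = integ (fun t => - G 0 t) 0 1.
  rewrite (@integE _ _ (fun s => d * atan (d * s))).
    by rewrite mulr1 !mulr0 atan0 mulr0 subr0.
  move=> s; apply: hd_eq; first by der.
  rewrite /= /G mulr0 !mul0r oppr0 expR0 !mul1r opprK /e.
  have ds : 1 + (d * s) ^+ 2 != 0 by rewrite gt_eqF// ltr_pwDl// sqr_ge0.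
  have dn : d != 0 by rewrite gt_eqF.
  by field; rewrite dn /= (mulrC s).
rewrite (_ : (fun x => _ * gauss_ref x) = fun x => integ (G1 x) 0 1); last first.
  by apply/funext => x; rewrite /gauss_ref -integZ //; cont.
apply: (@laplace_integ G G1 G2) => //.
- by move=> x; rewrite /G; cont.
- by move=> x; rewrite /G1; cont.
- move=> x t; apply: hd_eq; first by rewrite /G; der.
  by rewrite /G1 /=; field.
- by move=> x t; apply: hd_eq; [rewrite /G1; der|rewrite /G2 /=; ring].
- move=> x0; exists ((e + 1) * (expR (e * (1 + `|x0|)) * expR (1 + `|x0|))) => x t xx0 /andP[t0 t1].
  have nx : `|x| <= 1 + `|x0|.
    by rewrite -{1}(subrK x0 x); apply: (le_trans (ler_normD _ _)); rewrite lerD2r.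
  have t2 : t ^+ 2 <= 1 by rewrite exprn_ile1.
  have nx' : - x <= 1 + `|x0| by apply: le_trans nx; rewrite -normrN ler_norm.
  rewrite /G2 normrM normrN ler_pM//.
    by rewrite (ger0_norm (ltW (den0 t))) lerD2l.
  rewrite ger0_norm ?mulr_ge0 ?expR_ge0// ler_pM ?expR_ge0// ler_expR.
    by rewrite -mulrN ler_wpM2l// ltW.
  apply: (le_trans (ler_norm _)); rewrite normrN normrM -[leRHS]mulr1 ler_pM//.
  by rewrite ger0_norm ?sqr_ge0.
- move=> x t x0 _; have g0 : 0 <= expR (- (e * x)) * expR (- (x * t ^+ 2)).
    by rewrite mulr_ge0 ?expR_ge0.
  have -> : `|G x t| = (e + t ^+ 2)^-1 * (expR (- (e * x)) * expR (- (x * t ^+ 2))).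
    by rewrite /G normrN ger0_norm ?mulr_ge0 ?invr_ge0 ?(ltW (den0 t)) // mulrC.
  apply: ler_pM.
  - by rewrite invr_ge0 ltW.
  - by rewrite mulr_ge0 ?expR_ge0.
  - by rewrite lef_pV2 ?posrE// lerDl sqr_ge0.
  by rewrite ler_piMr ?expR_ge0// -expR0 ler_expR oppr_le0 mulr_ge0 ?sqr_ge0.
Qed.

(** If [Q] is close to [a x^(-1/2)], its Laplace transform at [d^-2] grows
    like [a sqrt pi d]. To see this, a multiple of [gauss_ref] is subtracted:
    what remains is [o(x^(-1/2))], and its transform is [o(d)]. So the growth
    [pi d] forces [a = sqrt pi]. *)
Lemma abelian (Q X : R -> R) a (C M : R) : continuous Q ->
  (forall x, 0 <= x -> `|Q x| <= M) ->
  (forall x, 1 <= x -> `|Num.sqrt x * Q x - a| <= C * x^-1) ->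
  (forall d, 0 < d -> exists C' : R, forall T, 0 <= T ->
    `|integ (fun x => expR (- (d ^- 2 * x)) * Q x) 0 T - X d| <= C' * expR (- (d ^- 2 * T))) ->
  (forall d, 1 <= d -> `|X d - pi * d| <= C) ->
  a = Num.sqrt pi.
Proof.
move=> cQ QM Qa lapQ Xpi.
have p0 : 0 < Num.sqrt pi :> R by rewrite sqrtr_gt0 pi_gt0.
pose l := 2 * a / Num.sqrt pi.
suff l2 : l = 2.
  have : l * Num.sqrt pi = 2 * Num.sqrt pi by rewrite l2.
  by rewrite /l divfK ?gt_eqF// => h; lra.
have la : l * (Num.sqrt pi / 2) = a by rewrite /l; field; rewrite gt_eqF.
pose D x := Q x - l * gauss_ref x.
have cg := gauss_ref_continuous.
have cD : continuous D by rewrite /D; cont.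
have DM x : 0 <= x -> `|D x| <= M + `|l|.
  move=> x0; apply: (le_trans (ler_normB _ _)); apply: lerD; first exact: QM.
  have /andP[g0 g1] := gauss_ref_bound x0.
  by rewrite normrM (ger0_norm g0) ler_piMr.
have C0 : 0 <= C by apply: le_trans (Xpi 1 (lexx _)).
have key eta : 0 < eta -> exists2 x0, 1 <= x0 & forall x, x0 <= x -> `|D x| <= 4 * eta * gauss_ref x.
  move=> eta0.
  have k1 : 0 < Num.min (eta / (2 * (`|l| + 1))) (1 / 4).
    by rewrite lt_min !divr_gt0 ?mulr_gt0 ?ltr_wpDl// ltr0n.
  have /cvgrPdist_le/(_ _ k1)[x1 [_ hx1]] := gauss_ref_cvg.
  pose x0 := Num.max (`|x1| + 1) (1 + 2 * C / eta).
  exists x0; first by rewrite /x0 le_max; apply/orP; left; rewrite lerDr.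
  move=> x; rewrite /x0 ge_max => /andP[h1 h2].
  have xx1 : x1 < x.
    by apply: lt_le_trans h1; rewrite (le_lt_trans (ler_norm _))// ltrDl.
  have xge1 : 1 <= x by apply: le_trans h1; rewrite lerDr.
  have xgt0 : 0 < x by apply: lt_le_trans xge1.
  have := hx1 x xx1; rewrite le_min distrC => /andP[h3 h4].
  have s0 : 0 < Num.sqrt x by rewrite sqrtr_gt0.
  have pi1 : 1 <= Num.sqrt pi :> R.
    by rewrite -[leLHS]sqrtr1 ler_wsqrtr// (le_trans _ (@pi_ge2 R))// ler1n.
  (* The limit [sqrt pi / 2] of [sqrt x * gauss_ref x] is at least [1 / 2]. *)
  have lo : 1 <= 4 * (Num.sqrt x * gauss_ref x).
    by move: h4; rewrite ler_norml => /andP[+ _]; lra.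
  have e1 : C * x^-1 <= eta / 2.
    rewrite ler_pdivrMr//.
    have : eta / 2 * (1 + 2 * C / eta) <= eta / 2 * x by rewrite ler_wpM2l// ltW// divr_gt0.
    apply: le_trans.
    have -> : eta / 2 * (1 + 2 * C / eta) = eta / 2 + C by field; rewrite gt_eqF.
    by rewrite lerDr ltW// divr_gt0.
  have e2 : `|l| * `|Num.sqrt x * gauss_ref x - Num.sqrt pi / 2| <= eta / 2.
    have l1 : 0 < `|l| + 1 by rewrite ltr_wpDl.
    apply: (@le_trans _ _ ((`|l| + 1) * (eta / (2 * (`|l| + 1))))).
      by apply: ler_pM => //; rewrite lerDl.
    by rewrite le_eqVlt; apply/orP; left; apply/eqP; field; rewrite gt_eqF.
  have sD : Num.sqrt x * `|D x| <= eta.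
    rewrite -{1}(gtr0_norm s0) -normrM.
    have -> : Num.sqrt x * D x = (Num.sqrt x * Q x - a) -
        l * (Num.sqrt x * gauss_ref x - Num.sqrt pi / 2).
      by rewrite /D -la; ring.
    apply: (le_trans (ler_normB _ _)); rewrite normrM.
    have := Qa x xge1; lra.
  rewrite -(ler_pM2l s0); apply: (le_trans sD).
  have := ler_wpM2l (ltW eta0) lo; rewrite mulr1 => h; apply: (le_trans h).
  by rewrite le_eqVlt; apply/orP; left; apply/eqP; ring.
have main eta : 0 < eta -> exists K : R, forall d, 1 <= d ->
    `|pi * d - l * (pi / 2 * d)| <= K + 8 * eta * d.
  move=> eta0; have [x0 x01 hx0] := key eta eta0.
  exists (C + `|l| + (M + `|l|) * x0 + 1) => d d1.
  have d0 : 0 < d by apply: lt_le_trans d1.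
  have [C1 lQ] := lapQ d d0.
  have [C2 lG] := gauss_ref_laplace d0.
  set e := d ^- 2 in lQ lG.
  have e0 : 0 < e by rewrite invr_gt0 exprn_gt0.
  (* [T] is so large that all the errors from truncating Laplace transforms at
     [T] add up to at most one. *)
  pose K0 := `|C1| + `|l| * `|C2| + 4 * eta * `|C2|.
  have K00 : 0 <= K0 by rewrite !addr_ge0 ?mulr_ge0// ltW.
  pose T := Num.max x0 (K0 / e).
  have T0 : 0 <= T by rewrite le_max divr_ge0 ?(ltW e0)// orbT.
  have x0T : x0 <= T by rewrite le_max lexx.
  have small : K0 * expR (- (e * T)) <= 1.
    rewrite expRN ler_pdivrMr ?expR_gt0// mul1r.
    apply: (@le_trans _ _ (1 + e * T)); last exact: expR_ge1Dx.
    have : K0 <= e * T.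
      by rewrite -ler_pdivrMl// mulrC le_max lexx orbT.
    lra.
  have ex x : 0 <= expR (- (e * x)) by exact: expR_ge0.
  have cex : continuous (fun x : R => expR (- (e * x))) by cont.
  have x00 : 0 <= x0 by apply: le_trans x01.
  have cn : continuous (fun x => `|D x|) by apply: cont_norm.
  have I1 : `|integ (fun x => expR (- (e * x)) * D x) 0 T| <=
     (M + `|l|) * x0 + 4 * eta * integ (fun x => expR (- (e * x)) * gauss_ref x) 0 T.
    rewrite -(integ_cat _ 0 x0); apply: (le_trans (ler_normD _ _)); apply: lerD.
      rewrite -[x in _ * x]subr0; apply: ler_norm_integ_cst => //; first by cont.
      move=> x /andP[xx0 _]; rewrite normrM (ger0_norm (ex x)) -[leRHS]mul1r ler_pM//.
        by rewrite -expR0 ler_expR oppr_le0 mulr_ge0// ltW.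
      exact: DM.
    rewrite -integZ; last by cont.
    apply: (@le_trans _ _ (integ (fun x => 4 * eta * (expR (- (e * x)) * gauss_ref x)) x0 T)).
      apply: ler_norm_integ => //; [by cont..|] => x /andP[xx0 _].
      rewrite normrM (ger0_norm (ex x)) mulrCA ler_wpM2l//; exact: hx0.
    rewrite -[leRHS](integ_cat _ 0 x0) lerDr.
    apply: integ_ge0 => //; [by cont..|] => x /andP[xx0 _].
    have /andP[g0 _] := gauss_ref_bound xx0.
    by rewrite !mulr_ge0// ltW.
  have I2 : integ (fun x => expR (- (e * x)) * D x) 0 T =
      integ (fun x => expR (- (e * x)) * Q x) 0 T -
      l * integ (fun x => expR (- (e * x)) * gauss_ref x) 0 T.
    rewrite -integZ; last by cont.
    rewrite -integB; [|by cont..]; congr integ; apply/funext => x.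
    by rewrite /D; ring.
  have J1 := lQ T T0; have J2 := lG T T0; have J3 := Xpi d d1.
  move: I1 J1 J2 small; rewrite I2.
  set IQ := integ _ 0 T; set IG := integ _ 0 T; set E := expR _ => I1 J1 J2 small.
  have E0 : 0 <= E by exact: expR_ge0.
  have J1' : `|IQ - X d| <= `|C1| * E.
    by apply: (le_trans J1); rewrite ler_wpM2r// ler_norm.
  have J2' : `|IG - d * atan d| <= `|C2| * E.
    by apply: (le_trans J2); rewrite ler_wpM2r// ler_norm.
  have at1 : atan d <= pi / 2 by rewrite ltW// atan_ltpi2.
  have at2 : `|d * atan d - pi / 2 * d| <= 1.
    have := atan_ge d0; rewrite -(ler_pM2l d0) mulrBr mulfV ?gt_eqF// => h.
    have : d * atan d <= d * (pi / 2) by rewrite ler_wpM2l// ltW.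
    by rewrite ler_norml => h2; apply/andP; split; lra.
  have p2 : d * atan d <= 2 * d.
    rewrite mulrC ler_wpM2r ?(ltW d0)//; apply: (le_trans at1).
    exact: ltW (pihalf_lt2 R).
  have -> : pi * d - l * (pi / 2 * d) = - (X d - pi * d) - (IQ - X d) +
     (IQ - l * IG) + l * ((IG - d * atan d) + (d * atan d - pi / 2 * d)) by ring.
  apply: (le_trans (ler_normD _ _)); rewrite normrM.
  have t1 := ler_normD (- (X d - pi * d) - (IQ - X d)) (IQ - l * IG).
  have t2 := ler_normB (- (X d - pi * d)) (IQ - X d); rewrite normrN in t2.
  have t3 := ler_wpM2l (normr_ge0 l) (ler_normD (IG - d * atan d) (d * atan d - pi / 2 * d)).
  have t4 := ler_wpM2l (normr_ge0 l) (lerD J2' at2).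
  have t5 : IG <= 2 * d + `|C2| * E.
    move: J2'; rewrite ler_norml => /andP[_]; lra.
  have t6 := ler_wpM2l (mulr_ge0 (ler0n _ 4) (ltW eta0)) t5.
  move: small; rewrite /K0; nra.
apply/eqP; rewrite -subr_eq0; apply: contraT => ln.
have n0 : 0 < `|l - 2| by rewrite normr_gt0.
(* With this [eta], the error [8 * eta * d] is half of [|l - 2| d], while the
    left-hand side of [main] is at least [|l - 2| d]. *)
pose eta := `|l - 2| / 16.
have eta0 : 0 < eta by rewrite divr_gt0.
have [K hK] := main eta eta0.
pose d := 1 + 2 * `|K| / `|l - 2|.
have d1 : 1 <= d by rewrite lerDl divr_ge0// mulr_ge0.
have d0 : 0 < d by apply: lt_le_trans d1.
have := hK d d1.
have -> : pi * d - l * (pi / 2 * d) = - (pi / 2 * d * (l - 2)) by field.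
have p2 := @pi_ge2 R.
rewrite normrN normrM ger0_norm ?mulr_ge0 ?divr_ge0 ?pi_ge0 ?(ltW d0)// /eta.
have e1 : d * `|l - 2| = `|l - 2| + 2 * `|K| by rewrite /d; field; rewrite gt_eqF.
have : d * `|l - 2| <= pi / 2 * d * `|l - 2|.
  by rewrite -mulrA ler_peMl ?mulr_ge0// ?(ltW d0)//; lra.
have := ler_norm K; have := normr_ge0 K.
have -> : 8 * (`|l - 2| / 16) * d = (d * `|l - 2|) / 2 by field.
lra.
Qed.

End Abelian.

(** * Bessel functions of order zero *)

Section Bessel.
Context {R : realType}.
Implicit Types (a b x t u d e T : R).

(** [pi J_0], and its derivatives. *)
Definition bessel x : R := integ (fun t => cos (x * cos t)) 0 pi.
Definition bessel' x : R := integ (fun t => - cos t * sin (x * cos t)) 0 pi.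
Definition bessel'' x : R := integ (fun t => - cos t ^+ 2 * cos (x * cos t)) 0 pi.

Lemma hd_bessel x : hasder bessel x (bessel' x).
Proof.
apply: (@hd_integ_smooth R (fun x t => cos (x * cos t))
   (fun x t => - cos t * sin (x * cos t))
   (fun x t => - cos t ^+ 2 * cos (x * cos t)) 0 pi x 1).
- exact: pi_ge0.
- by move=> y; cont.
- by cont.
- by move=> y t; apply: hd_eq; [der|rewrite /=; ring].
- by move=> y t; apply: hd_eq; [der|rewrite /=; ring].
- move=> y t _ _; rewrite normrM normrN normrX -[leRHS]mul1r ler_pM ?cos_bound//.
  by rewrite exprn_ile1// cos_bound.
Qed.

Lemma hd_bessel' x : hasder bessel' x (bessel'' x).
Proof.
apply: (@hd_integ_smooth R (fun x t => - cos t * sin (x * cos t))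
   (fun x t => - cos t ^+ 2 * cos (x * cos t))
   (fun x t => cos t ^+ 3 * sin (x * cos t)) 0 pi x 1).
- exact: pi_ge0.
- by move=> y; cont.
- by cont.
- by move=> y t; apply: hd_eq; [der|rewrite /=; ring].
- by move=> y t; apply: hd_eq; [der|rewrite /=; ring].
- move=> y t _ _; rewrite normrM normrX -[leRHS]mul1r ler_pM ?sin_bound//.
  by rewrite exprn_ile1// cos_bound.
Qed.

(** The function [- sin t sin (x cos t)], an antiderivative of the combination
    under the integral, vanishes at both ends. *)
Lemma bessel_ode x : x != 0 -> bessel'' x = - bessel x - bessel' x / x.
Proof.
move=> x0.
have key : x * bessel'' x + x * bessel x + bessel' x = 0.
  rewrite /bessel /bessel' /bessel'' -!integZ -?integD; try by cont.
  rewrite (@integE _ _ (fun t => - (sin t * sin (x * cos t)))).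
    by rewrite sinpi sin0; ring.
  move=> t; apply: hd_eq; first by der.
  rewrite /=.
  have -> : x * cos (x * cos t) = x * cos (x * cos t) * (cos t ^+ 2 + sin t ^+ 2).
    by rewrite cos2Dsin2 mulr1.
  by ring.
apply: (mulfI x0).
have -> : x * (- bessel x - bessel' x / x) = - (x * bessel x) - bessel' x by field.
by lra.
Qed.

(** The recurrence [x J_2 = 2 J_1 - x J_0]. *)
Lemma cap_hat_bessel x : x ^+ 3 * cap_hat x + 4 * x * bessel x + 8 * bessel' x = 0.
Proof.
rewrite /cap_hat mulrA /bessel /bessel' -!integZ -?integD; try by cont.
rewrite (@integE _ _ (fun t => - (4 / 3 * x ^+ 2 * (sin t ^+ 3 * sin (x * cos t)) -
   4 * x * (sin t * cos t * cos (x * cos t)) + 8 * (sin t * sin (x * cos t))))).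
  by rewrite sinpi sin0; ring.
move=> t; apply: hd_eq; first by der.
rewrite /=.
have -> : 4 * x * cos (x * cos t) = 4 * x * cos (x * cos t) * (cos t ^+ 2 + sin t ^+ 2).
  by rewrite cos2Dsin2 mulr1.
by field.
Qed.

Definition phase (th x : R) : R :=
  integ (fun t => (1 + cos t) * cos (x * (1 - cos t) - th)) 0 pi.

Lemma cos_reflect t : cos (pi - t) = - cos t :> R.
Proof. by rewrite cosB cospi sinpi mul0r addr0 mulN1r. Qed.

Lemma integ_cos_reflect (h : R -> R) : continuous h ->
  integ (fun t => h (- cos t)) 0 pi = integ (fun t => h (cos t)) 0 pi.
Proof.
move=> ch.
have := @integ_reflect R (fun t => h (cos t)) pi 0 pi (cont_comp ch (@continuous_cos R)).
rewrite subrr subr0 => <-; congr integ; apply/funext => t.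
by rewrite cos_reflect.
Qed.

(** If [bessel x] is close to [x^(-1/2) (a cos x + b sin x)], this combination
    is close to [x^(-1/2) (a cos th + b sin th)], without oscillation. As an
    integral it keeps only the frequencies [1 - cos t], which vanish at the
    stationary point [t = 0]; the reflection [t |-> pi - t] removes the
    others. *)
Lemma phaseE th x : phase th x = bessel x * cos (x - th) - bessel' x * sin (x - th).
Proof.
have E := @integ_cos_reflect (fun c => (1 + c) * cos (x * (1 - c) - th)) ltac:(cont).
rewrite /phase; set I := integ _ _ _.
have -> : I = 2^-1 * I + 2^-1 * integ (fun t => (1 - cos t) * cos (x * (1 + cos t) - th)) 0 pi.
  have -> : integ (fun t => (1 - cos t) * cos (x * (1 + cos t) - th)) 0 pi = I.
    by rewrite /I -E; congr integ; apply/funext => t; rewrite opprK.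
  by field.
rewrite -integ_lin; [|by cont..].
rewrite -!integZr -?integB; try by cont.
congr integ; apply/funext => t.
have -> : x * (1 - cos t) - th = (x - th) - x * cos t by ring.
have -> : x * (1 + cos t) - th = (x - th) + x * cos t by ring.
by rewrite [cos (_ - x * _)]cosB [cos (_ + x * _)]cosD; field.
Qed.

(** Antiderivatives of [1 / (1 + 4 u^4)] for [k = 1] and of
    [2 u^2 / (1 + 4 u^4)] for [k = - 1], by Sophie Germain's factorization. *)
Definition germain (k u : R) : R := (atan (2 * u + 1) + atan (2 * u - 1)) / 4 +
  k * (ln (1 + 2 * u + 2 * u ^+ 2) - ln (1 - 2 * u + 2 * u ^+ 2)) / 8.

Lemma hd_germain (k u : R) : hasder (germain k) u
  ((1 + 2 * u ^+ 2 + k * (1 - 2 * u ^+ 2)) / (2 * (1 + 4 * u ^+ 4))).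
Proof.
have p0 : 0 < 1 + 2 * u + 2 * u ^+ 2 by nra.
have m0 : 0 < 1 - 2 * u + 2 * u ^+ 2 by nra.
apply: hd_eq; first by rewrite /germain; der.
rewrite /=.
have e1 : 1 + (2 * u + 1) ^+ 2 = 2 * (1 + 2 * u + 2 * u ^+ 2) by ring.
have e2 : 1 + (2 * u - 1) ^+ 2 = 2 * (1 - 2 * u + 2 * u ^+ 2) by ring.
have e3 : 1 + 4 * u ^+ 4 = (1 + 2 * u + 2 * u ^+ 2) * (1 - 2 * u + 2 * u ^+ 2) by ring.
rewrite e1 e2 e3.
field.
by rewrite (gt_eqF p0) (gt_eqF m0).
Qed.

Lemma germain0 k : germain k 0 = 0.
Proof.
rewrite /germain !mulr0 add0r sub0r atanN subrr mul0r add0r oppr0 expr0n /= !mulr0.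
by rewrite !addr0 subrr mulr0 mul0r.
Qed.

(** The logarithms contribute [O(1 / u)] only, so the limit is the same for
    the two values of [k]: this is why the two leading constants of the
    expansion are equal. *)
Lemma germain_lim k u : `|k| <= 1 -> 1 <= u -> `|germain k u - pi / 4| <= u^-1.
Proof.
move=> k1 u1; have u0 : 0 < u by apply: lt_le_trans u1.
have p0 : 0 < 1 + 2 * u + 2 * u ^+ 2 by nra.
have m0 : 0 < 1 - 2 * u + 2 * u ^+ 2 by nra.
have v1 : u^-1 * u = 1 by rewrite mulVf// gt_eqF.
have v0 : 0 < u^-1 by rewrite invr_gt0.
have A (y : R) : u <= y -> `|atan y - pi / 2| <= u^-1.
  move=> uy; have y0 : 0 < y by apply: lt_le_trans uy.
  have := atan_ge y0; have := ltW (atan_ltpi2 y).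
  have : y^-1 <= u^-1 by rewrite lef_pV2 ?posrE.
  by rewrite ler_norml => *; apply/andP; split; lra.
have L : 0 <= ln (1 + 2 * u + 2 * u ^+ 2) - ln (1 - 2 * u + 2 * u ^+ 2) <= 4 * u^-1.
  rewrite -ln_div ?posrE//.
  have -> : (1 + 2 * u + 2 * u ^+ 2) / (1 - 2 * u + 2 * u ^+ 2) =
      1 + 4 * u / (1 - 2 * u + 2 * u ^+ 2) by field; rewrite gt_eqF.
  have q0 : 0 <= 4 * u / (1 - 2 * u + 2 * u ^+ 2) by rewrite divr_ge0 ?mulr_ge0// ltW.
  apply/andP; split; first by rewrite ln_ge0// lerDl.
  apply: (le_trans (le_ln1Dx _)); first by apply: lt_le_trans q0; rewrite ltrN10.
  rewrite ler_pdivrMr//.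
  have : u^-1 * (1 - 2 * u + 2 * u ^+ 2) - u = u^-1 * (u - 1) ^+ 2.
    have -> : u^-1 * (1 - 2 * u + 2 * u ^+ 2) - u =
      u^-1 - 2 * (u^-1 * u) + 2 * (u^-1 * u) * u - u by ring.
    have -> : u^-1 * (u - 1) ^+ 2 = (u^-1 * u) * u - 2 * (u^-1 * u) + u^-1 by ring.
    by rewrite v1; ring.
  have := sqr_ge0 (u - 1) => h1 h2.
  have : 0 <= u^-1 * (u - 1) ^+ 2 by rewrite mulr_ge0// ltW.
  by lra.
move: L; set l := ln _ - ln _ => /andP[l0 l1].
have h1 := A (2 * u + 1) ltac:(lra).
have h2 := A (2 * u - 1) ltac:(lra).
have kl : `|k * l| <= 4 * u^-1.
  by rewrite normrM (ger0_norm l0) -[leRHS]mul1r ler_pM.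
rewrite /germain -/l.
move: h1 h2 kl; rewrite !ler_norml => /andP[a1 a2] /andP[b1 b2] /andP[c1 c2].
by apply/andP; split; lra.
Qed.

Lemma half_angle t : cos t = 1 - 2 * sin (t / 2) ^+ 2 :> R.
Proof.
rewrite {1}(_ : t = t / 2 + t / 2); last by field.
by rewrite cosD -!expr2; have := cos2Dsin2 (t / 2); lra.
Qed.

(** Write [h = cos (t / 2)] and [s = sin (t / 2)]. Replacing the weight [h^2]
    by [h] makes [s] a new variable of integration, and the integral a value
    of [germain]. The error is bounded because [h - h^2 <= s^2] and
    [s^2 * X s <= 2]. *)
Lemma phase_laplace_main d (k : R) (X : R -> R) : 1 <= d -> `|k| <= 1 ->
  continuous X ->
  (forall s, 0 <= s <= 1 -> 0 <= X s) ->
  (forall s, X s = d ^+ 2 * (1 + 2 * (d * s) ^+ 2 + k * (1 - 2 * (d * s) ^+ 2)) /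
     (1 + 4 * (d * s) ^+ 4)) ->
  (forall s, s ^+ 2 * X s <= 2) ->
  `|integ (fun t => cos (t / 2) ^+ 2 * X (sin (t / 2))) 0 pi - pi * d| <= 4 + 2 * pi.
Proof.
move=> d1 k1 cX X0 XE XB.
have d0 : 0 < d by apply: lt_le_trans d1.
have ch : continuous (fun t : R => X (sin (t / 2))) by apply: cont_comp => //; cont.
have main : integ (fun t => cos (t / 2) * X (sin (t / 2))) 0 pi = 4 * d * germain k d.
  rewrite (@integE _ _ (fun t => 4 * d * germain k (d * sin (t / 2)))).
    rewrite mul0r sin0 mulr0 germain0 mulr0 subr0 (_ : sin (pi / 2) = 1) ?mulr1//.
    exact: sin_pihalf.
  move=> t; apply: hd_eq.
    by apply: hd_mul; [exact: hd_cst|apply: hd_comp; [exact: hd_germain|der]].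
  rewrite XE /=; field.
  by rewrite gt_eqF//; have := sqr_ge0 ((d * sin (t / 2)) ^+ 2); rewrite -exprM; lra.
have diff : `|integ (fun t => cos (t / 2) ^+ 2 * X (sin (t / 2))) 0 pi -
    integ (fun t => cos (t / 2) * X (sin (t / 2))) 0 pi| <= 2 * (pi - 0).
  rewrite -integB; [|by cont..].
  apply: ler_norm_integ_cst; [exact: pi_ge0|by cont|] => t /andP[t0 tp].
  have s0 : 0 <= sin (t / 2) by apply: sin_ge0_pi; apply/andP; split; lra.
  have c0 : 0 <= cos (t / 2).
    by apply: cos_ge0_pihalf; have := @pi_gt0 R => ?; apply/andP; split; lra.
  have c1 := cos_le1 (t / 2); have s1 := sin_le1 (t / 2).
  have s01 : 0 <= sin (t / 2) <= 1 by rewrite s0.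
  have x0 := X0 _ s01; have xb := XB (sin (t / 2)).
  have cs := cos2Dsin2 (t / 2).
  move: (X (sin (t / 2))) x0 xb => y y0 yb.
  have -> : cos (t / 2) ^+ 2 * y - cos (t / 2) * y = - ((cos (t / 2) * (1 - cos (t / 2))) * y) by ring.
  rewrite normrN ger0_norm; last by rewrite mulr_ge0// mulr_ge0// subr_ge0.
  apply: le_trans yb; rewrite ler_wpM2r//.
  have -> : sin (t / 2) ^+ 2 = 1 - cos (t / 2) ^+ 2 by lra.
  by nra.
rewrite main in diff.
have g : `|4 * d * germain k d - pi * d| <= 4.
  have -> : 4 * d * germain k d - pi * d = 4 * d * (germain k d - pi / 4) by field.
  rewrite normrM ger0_norm ?mulr_ge0 ?(ltW d0)//.
  by have := germain_lim k1 d1; rewrite -(ler_pM2l d0) mulfV ?gt_eqF//; lra.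
move: diff g; rewrite subr0 !ler_norml => /andP[? ?] /andP[? ?].
by apply/andP; split; lra.
Qed.

End Bessel.

(** * Asymptotic expansion of the transform *)

Section BesselAsymptotics.
Context {R : realType}.
Implicit Types (a b x t u d e T th : R).

Lemma phase_continuous th : continuous (phase th : R -> R).
Proof.
have cb : continuous (@bessel R) by move=> x; apply: hd_continuous; exact: hd_bessel.
have cb' : continuous (@bessel' R) by move=> x; apply: hd_continuous; exact: hd_bessel'.
rewrite (_ : phase th = fun x => bessel x * cos (x - th) - bessel' x * sin (x - th)).
  by cont.
by apply/funext => x; exact: phaseE.
Qed.

Lemma phase_bound th x : `|phase th x : R| <= 2 * pi.
Proof.
have -> : 2 * pi = 2 * (pi - 0) :> R by rewrite subr0.
apply: ler_norm_integ_cst; [exact: pi_ge0|by cont|] => t _.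
rewrite normrM -[leRHS]mulr1 ler_pM ?cos_bound//.
by have := cos_bound t; rewrite !ler_norml => /andP[? ?]; apply/andP; split; lra.
Qed.

(** The Laplace transform of [phase th] at [e = d^-2], the variable [x] being
    integrated first: the denominators are [e^2 + l^2] for the frequency
    [l = 1 - cos t]. *)
Definition phase_laplace th d : R := integ (fun t =>
  (1 + cos t) * ((1 - cos t) * sin th + d ^- 2 * cos th) /
  (d ^- 2 ^+ 2 + (1 - cos t) ^+ 2)) 0 pi.

Lemma laplace_phase th d : 0 < d -> exists C : R, forall T, 0 <= T ->
  `|integ (fun x => expR (- (d ^- 2 * x)) * phase th x) 0 T - phase_laplace th d|
     <= C * expR (- (d ^- 2 * T)).
Proof.
move=> d0; rewrite /phase_laplace; set e := d ^- 2.
have e0 : 0 < e by rewrite invr_gt0 exprn_gt0.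
pose l t : R := 1 - cos t.
have den0 t : 0 < e ^+ 2 + l t ^+ 2 by rewrite ltr_pwDl ?exprn_gt0 ?sqr_ge0.
pose G x t := (1 + cos t) * (expR (- (e * x)) *
   (l t * sin (x * l t - th) - e * cos (x * l t - th))) * (e ^+ 2 + l t ^+ 2)^-1.
pose G1 x t := expR (- (e * x)) * ((1 + cos t) * cos (x * l t - th)).
pose G2 x t := expR (- (e * x)) * ((1 + cos t) *
  (- e * cos (x * l t - th) - l t * sin (x * l t - th))).
have l2 t : 0 <= l t <= 2.
  have := cos_bound t; rewrite ler_norml /l => /andP[? ?]; apply/andP; split; lra.
have c2 t : 0 <= 1 + cos t <= 2.
  have := cos_bound t; rewrite ler_norml => /andP[? ?]; apply/andP; split; lra.
have bo (p q : R) t : `|p| <= 1 -> `|q| <= 1 -> `|(1 + cos t) * (l t * p - e * q)| <= 2 * (2 + e).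
  move=> p1 q1; have /andP[l0 ll] := l2 t; have /andP[c0 cc] := c2 t.
  rewrite normrM (ger0_norm c0) ler_pM//.
  apply: (le_trans (ler_normB _ _)); rewrite !normrM (ger0_norm l0) (gtr0_norm e0).
  by apply: lerD; rewrite -[leRHS]mulr1 ler_pM// ltW.
exists (2 * (2 + e) * e ^- 2 * (pi - 0)) => T T0.
have cl : continuous l by rewrite /l; cont.
have cden : continuous (fun t : R => (e ^+ 2 + l t ^+ 2)^-1).
  by apply: cont_inv => [t|]; [rewrite gt_eqF|cont].
rewrite (_ : (fun x => _ * phase th x) = fun x => integ (G1 x) 0 pi); last first.
  by apply/funext => x; rewrite /phase -integZ //; cont.
rewrite (_ : (fun t => _ / _) = fun t => - G 0 t); last first.
  apply/funext => t; rewrite /G mulr0 oppr0 expR0 !mul0r sub0r sinN cosN /l.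
  by ring.
apply: (@laplace_integ R G G1 G2) => //.
- exact: pi_ge0.
- by move=> x; rewrite /G; cont.
- by move=> x; rewrite /G1; cont.
- move=> x t; apply: hd_eq; first by rewrite /G; der.
  by rewrite /G1 /=; field; rewrite gt_eqF.
- by move=> x t; apply: hd_eq; [rewrite /G1; der|rewrite /G2 /=; ring].
- move=> x0; exists (expR (e * (1 + `|x0|)) * (2 * (2 + e))) => x t xx0 _.
  have nx : `|x| <= 1 + `|x0|.
    by rewrite -{1}(subrK x0 x); apply: (le_trans (ler_normD _ _)); rewrite lerD2r.
  have nx' : - x <= 1 + `|x0| by apply: le_trans nx; rewrite -normrN ler_norm.
  rewrite /G2 normrM (ger0_norm (expR_ge0 _)) ler_pM ?expR_ge0//.
    by rewrite ler_expR -mulrN ler_wpM2l// ltW.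
  have -> : - e * cos (x * l t - th) - l t * sin (x * l t - th) =
     l t * (- sin (x * l t - th)) - e * cos (x * l t - th) by ring.
  by apply: bo; rewrite ?normrN ?sin_bound ?cos_bound.
- move=> x t x0 _.
  have -> : G x t = ((1 + cos t) * (l t * sin (x * l t - th) - e * cos (x * l t - th))) *
     (e ^+ 2 + l t ^+ 2)^-1 * expR (- (e * x)) by rewrite /G; ring.
  rewrite normrM (ger0_norm (expR_ge0 _)) ler_wpM2r ?expR_ge0// normrM.
  apply: ler_pM => //.
    by apply: bo; rewrite ?sin_bound ?cos_bound.
  rewrite ger0_norm ?invr_ge0 ?(ltW (den0 t))// lef_pV2 ?posrE ?exprn_gt0//.
  by rewrite lerDl sqr_ge0.
Qed.

(** The two cases are the angles [0] and [pi / 2]; half-angle formulas bring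
    them to the same form, with [k = 1] and [k = - 1]. *)
Lemma phase_laplace_pi th d (k : R) : 1 <= d ->
  (cos th = 1 /\ sin th = 0 /\ k = 1) \/ (cos th = 0 /\ sin th = 1 /\ k = -1) ->
  `|phase_laplace th d - pi * d| <= 4 + 2 * pi.
Proof.
move=> d1 hth; have d0 : 0 < d by apply: lt_le_trans d1.
pose X s := d ^+ 2 * (1 + 2 * (d * s) ^+ 2 + k * (1 - 2 * (d * s) ^+ 2)) /
  (1 + 4 * (d * s) ^+ 4).
have den s : 0 < 1 + 4 * (d * s) ^+ 4.
  by have := sqr_ge0 ((d * s) ^+ 2); rewrite -exprM; lra.
have -> : phase_laplace th d = integ (fun t => cos (t / 2) ^+ 2 * X (sin (t / 2))) 0 pi.
  rewrite /phase_laplace; congr integ; apply/funext => t.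
  have e1 : cos t = 1 - 2 * sin (t / 2) ^+ 2 := half_angle t.
  have e2 : cos t = 2 * cos (t / 2) ^+ 2 - 1.
    by have := cos2Dsin2 (t / 2); move: e1; lra.
  rewrite {1}e2 e1 /X; set s := sin _; set h := cos (t / 2).
  have n1 := den s; have dn : d != 0 by rewrite gt_eqF.
  have n2 : d ^- 2 ^+ 2 + (1 - (1 - 2 * s ^+ 2)) ^+ 2 = d ^- 4 * (1 + 4 * (d * s) ^+ 4).
    by field.
  rewrite n2; move: n1; move: (1 + 4 * (d * s) ^+ 4) => q q0.
  by case: hth => [[-> [-> ->]]|[-> [-> ->]]]; field; rewrite dn gt_eqF.
have cX : continuous X.
  rewrite /X; have : continuous (fun s => (1 + 4 * (d * s) ^+ 4)^-1).
    by apply: cont_inv => [s|]; [rewrite gt_eqF|cont].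
  by move=> ?; cont.
apply: (@phase_laplace_main R d k) => //.
- by case: hth => [[_ [_ ->]]|[_ [_ ->]]]; rewrite ?normrN normr1.
- move=> s _; rewrite /X divr_ge0 ?(ltW (den s))// mulr_ge0 ?sqr_ge0//.
  by case: hth => [[_ [_ ->]]|[_ [_ ->]]]; have := sqr_ge0 (d * s); lra.
- move=> s; rewrite /X mulrA ler_pdivrMr//.
  have -> : s ^+ 2 * (d ^+ 2 * (1 + 2 * (d * s) ^+ 2 + k * (1 - 2 * (d * s) ^+ 2))) =
    (d * s) ^+ 2 * (1 + 2 * (d * s) ^+ 2 + k * (1 - 2 * (d * s) ^+ 2)) by ring.
  have -> : (d * s) ^+ 4 = ((d * s) ^+ 2) ^+ 2 by ring.
  move: ((d * s) ^+ 2) => y.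
  by case: hth => [[_ [_ ->]]|[_ [_ ->]]]; nra.
Qed.

(** The factor [sqrt x] removes the first-order term of Bessel's equation. *)
Definition sbessel x : R := Num.sqrt x * bessel x.
Definition sbessel' x : R := Num.sqrt x * bessel' x + (2 * Num.sqrt x)^-1 * bessel x.

Lemma hd_sbessel x : 1 <= x -> hasder sbessel x (sbessel' x).
Proof.
move=> x1; have x0 : 0 < x by apply: lt_le_trans x1.
have h := hd_bessel x.
apply: hd_eq; first by rewrite /sbessel; der.
by rewrite /sbessel' /=; ring.
Qed.

Lemma hd_sbessel' x : 1 <= x ->
  hasder sbessel' x (- (1 + 1 / 4 * x^-1 ^+ 2) * sbessel x).
Proof.
move=> x1; have x0 : 0 < x by apply: lt_le_trans x1.
have s0 : 0 < Num.sqrt x by rewrite sqrtr_gt0.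
have h := hd_bessel x; have h' := hd_bessel' x.
apply: hd_eq.
  rewrite /sbessel'; der.
  by rewrite mulf_neq0// gt_eqF.
rewrite /sbessel /= bessel_ode ?gt_eqF//.
move: (bessel x) (bessel' x) => k k'.
have := sqr_sqrtr (ltW x0); move: (Num.sqrt x) s0 => s s0 <-.
by field; rewrite gt_eqF.
Qed.

(** The angles [0] and [pi / 2] in [phase] isolate the two constants, and
    [abelian] evaluates them. *)
Lemma sbessel_leading : exists C : R, forall x, 1 <= x ->
  `|sbessel x - osc (Num.sqrt pi, Num.sqrt pi) x| <= C * x^-1 /\
  `|sbessel' x - osc' (Num.sqrt pi, Num.sqrt pi) x| <= C * x^-1.
Proof.
have [a [b [C hC]]] := liouville_leading hd_sbessel hd_sbessel'.
have C0 : 0 <= C.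
  have [h _] := hC 1 (lexx _); rewrite invr1 mulr1 in h.
  exact: le_trans h.
pose K := 2 * C + (`|a| + `|b| + C).
have lim th x : 1 <= x ->
    `|Num.sqrt x * phase th x - (a * cos th + b * sin th)| <= K * x^-1.
  move=> x1; have x0 : 0 < x by apply: lt_le_trans x1.
  have s0 : 0 < Num.sqrt x by rewrite sqrtr_gt0.
  have [h1 h2] := hC x x1.
  have y0 : 0 < x^-1 by rewrite invr_gt0.
  have y1 : x^-1 <= 1 by rewrite invf_le1.
  have wb : `|sbessel x| <= `|a| + `|b| + C.
    rewrite -(subrK (osc (a, b) x) (sbessel x)); apply: (le_trans (ler_normD _ _)).
    rewrite addrC; apply: lerD; first exact: osc_bound.
    by apply: (le_trans h1); rewrite ler_piMr.
  have E : Num.sqrt x * phase th x = sbessel x * cos (x - th) -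
     (sbessel' x - sbessel x * x^-1 / 2) * sin (x - th).
    rewrite phaseE /sbessel /sbessel'; move: (bessel x) (bessel' x) (cos _) (sin _) => k k' co si.
    have := sqr_sqrtr (ltW x0); move: (Num.sqrt x) s0 => s s0 <-.
    by field; rewrite gt_eqF.
  have E2 : a * cos th + b * sin th =
     osc (a, b) x * cos (x - th) - osc' (a, b) x * sin (x - th).
    have -> : cos th = cos (x - (x - th)) by congr cos; ring.
    have -> : sin th = sin (x - (x - th)) by congr sin; ring.
    by rewrite (cosB x (x - th)) (sinB x (x - th)) /osc /osc' /=; ring.
  rewrite E E2.
  have -> : sbessel x * cos (x - th) - (sbessel' x - sbessel x * x^-1 / 2) * sin (x - th) -
     (osc (a, b) x * cos (x - th) - osc' (a, b) x * sin (x - th)) =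
    (sbessel x - osc (a, b) x) * cos (x - th) - (sbessel' x - osc' (a, b) x) * sin (x - th) +
    sbessel x * (x^-1 / 2 * sin (x - th)) by ring.
  have c1 := cos_bound (x - th); have s1 := sin_bound (x - th).
  apply: (le_trans (ler_normD _ _)); rewrite /K [leRHS]mulrDl; apply: lerD.
    have -> : 2 * C * x^-1 = C * x^-1 + C * x^-1 by ring.
    apply: (le_trans (ler_normB _ _)); rewrite !normrM.
    by apply: lerD; rewrite -[leRHS]mulr1 ler_pM.
  rewrite normrM ler_pM// normrM -[leRHS]mulr1 ler_pM//.
  by rewrite ger0_norm; lra.
have pi0 := @pi_ge0 R.
have K0 : 0 <= K by rewrite /K !addr_ge0// mulr_ge0.
have concl (th k : R) : (cos th = 1 /\ sin th = 0 /\ k = 1) \/ (cos th = 0 /\ sin th = 1 /\ k = -1) ->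
    a * cos th + b * sin th = Num.sqrt pi.
  move=> hth.
  apply: (@abelian R (phase th) (phase_laplace th) _ (K + (4 + 2 * pi)) (2 * pi)).
  - exact: phase_continuous.
  - by move=> x _; exact: phase_bound.
  - move=> x x1; apply: (le_trans (lim th x x1)).
    by rewrite ler_wpM2r ?invr_ge0 ?(le_trans ler01 x1)// lerDl; lra.
  - by move=> d d0; exact: laplace_phase.
  - by move=> d d1; apply: (le_trans (phase_laplace_pi d1 hth)); rewrite lerDr.
have ea := @concl 0 1 (or_introl (conj (@cos0 R) (conj (@sin0 R) erefl))).
have eb := @concl (pi / 2) (-1) (or_intror (conj (@cos_pihalf R) (conj (@sin_pihalf R) erefl))).
rewrite cos0 sin0 mulr1 mulr0 addr0 in ea.
rewrite cos_pihalf sin_pihalf mulr0 mulr1 add0r in eb.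
by exists C => x x1; have := hC x x1; rewrite ea eb.
Qed.

(** [x^(5/2) * cap_hat x = 4 pi sqrt x J_2(x)] in terms of [sbessel]; for
    Bessel's equation of order two, [mu = 1 / 4 - 2^2 = - (15 / 4)]. *)
Definition scap x : R := - 4 * sbessel x - 8 * (sbessel' x * x^-1) + 4 * (sbessel x * x^-1 ^+ 2).
Definition scap' x : R := - 4 * sbessel' x + 8 * (sbessel x * x^-1) +
  12 * (sbessel' x * x^-1 ^+ 2) - 6 * (sbessel x * x^-1 ^+ 3).

Lemma cap_hatE x : 1 <= x -> cap_hat x = scap x / (x ^+ 2 * Num.sqrt x).
Proof.
move=> x1; have x0 : 0 < x by apply: lt_le_trans x1.
have s0 : 0 < Num.sqrt x by rewrite sqrtr_gt0.
have xn : x ^+ 3 != 0 by rewrite expf_neq0// gt_eqF.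
have -> : cap_hat x = (- (4 * x * bessel x) - 8 * bessel' x) / x ^+ 3.
  apply: (mulIf xn); rewrite divfK//.
  by have := cap_hat_bessel x; rewrite (mulrC (x ^+ 3)); lra.
rewrite /scap /sbessel /sbessel'.
move: (bessel x) (bessel' x) {xn} => k k'.
have := sqr_sqrtr (ltW x0); move: (Num.sqrt x) s0 => s s0 <-.
by field; rewrite gt_eqF.
Qed.

Lemma hd_scap x : 1 <= x -> hasder scap x (scap' x).
Proof.
move=> x1; have x0 : x != 0 by rewrite gt_eqF// (lt_le_trans _ x1).
have h1 := hd_sbessel x1; have h2 := hd_sbessel' x1.
apply: hd_eq; first by rewrite /scap; der.
by rewrite /scap' /=; field.
Qed.

Lemma hd_scap' x : 1 <= x -> hasder scap' x (- (1 + - (15 / 4) * x^-1 ^+ 2) * scap x).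
Proof.
move=> x1; have x0 : x != 0 by rewrite gt_eqF// (lt_le_trans _ x1).
have h1 := hd_sbessel x1; have h2 := hd_sbessel' x1.
apply: hd_eq; first by rewrite /scap'; der.
by rewrite /scap /=; field.
Qed.

Definition cap_sum N x := liouville_sum (- (15 / 4)) (- 4 * Num.sqrt pi) (- 4 * Num.sqrt pi) N x.

Lemma cap_hat_expansion N : exists C : R, forall x, 1 <= x ->
  `|cap_hat x - cap_sum N.+1 x / (x ^+ 2 * Num.sqrt x)| <=
    C * x^-1 ^+ N.+1 / (x ^+ 2 * Num.sqrt x).
Proof.
have [C hC] := sbessel_leading.
have [B hB] := liouville_bounded hd_sbessel hd_sbessel'.
have lead x : 1 <= x ->
    `|scap x - osc (- 4 * Num.sqrt pi, - 4 * Num.sqrt pi) x| <= (4 * C + 26 * B) * x^-1 /\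
    `|scap' x - osc' (- 4 * Num.sqrt pi, - 4 * Num.sqrt pi) x| <= (4 * C + 26 * B) * x^-1.
  move=> x1; have [h1 h2] := hC x x1; have [b1 b2] := hB x x1.
  have x0 : 0 < x by apply: lt_le_trans x1.
  have y0 : 0 < x^-1 by rewrite invr_gt0.
  have y1 : x^-1 <= 1 by rewrite invf_le1.
  have B0 : 0 <= B by apply: le_trans b1.
  have pw n : x^-1 ^+ n.+1 <= x^-1 by rewrite exprS ler_piMr ?exprn_ile1 ?(ltW y0).
  have tm (c p : R) n : 0 <= c -> `|p| <= B -> `|c * (p * x^-1 ^+ n.+1)| <= c * B * x^-1.
    move=> c0 pB; rewrite normrM (ger0_norm c0) -mulrA ler_wpM2l// normrM ler_pM//.
    by rewrite ger0_norm ?pw// exprn_ge0// ltW.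
  set p := Num.sqrt pi in h1 h2 *.
  split.
    have -> : scap x - osc (- 4 * p, - 4 * p) x = - (4 * (sbessel x - osc (p, p) x)) -
       8 * (sbessel' x * x^-1 ^+ 1) + 4 * (sbessel x * x^-1 ^+ 2).
      by rewrite /scap /osc /=; ring.
    apply: (le_trans (ler_normD _ _)).
    have t1 := ler_normB (- (4 * (sbessel x - osc (p, p) x))) (8 * (sbessel' x * x^-1 ^+ 1)).
    have t2 := tm 8 (sbessel' x) 0%N ltac:(lra) b2.
    have t3 := tm 4 (sbessel x) 1%N ltac:(lra) b1.
    rewrite normrN normrM (ger0_norm (_ : 0 <= 4 :> R)) // in t1.
    have : 0 <= B * x^-1 by rewrite mulr_ge0// ltW.
    by lra.
  have -> : scap' x - osc' (- 4 * p, - 4 * p) x = - (4 * (sbessel' x - osc' (p, p) x)) +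
     8 * (sbessel x * x^-1 ^+ 1) + 12 * (sbessel' x * x^-1 ^+ 2) - 6 * (sbessel x * x^-1 ^+ 3).
    by rewrite /scap' /osc' /=; ring.
  apply: (le_trans (ler_normB _ _)).
  have t0 := ler_normD (- (4 * (sbessel' x - osc' (p, p) x)) + 8 * (sbessel x * x^-1 ^+ 1))
     (12 * (sbessel' x * x^-1 ^+ 2)).
  have t1 := ler_normD (- (4 * (sbessel' x - osc' (p, p) x))) (8 * (sbessel x * x^-1 ^+ 1)).
  have t2 := tm 8 (sbessel x) 0%N ltac:(lra) b1.
  have t3 := tm 12 (sbessel' x) 1%N ltac:(lra) b2.
  have t4 := tm 6 (sbessel x) 2%N ltac:(lra) b1.
  rewrite normrN normrM (ger0_norm (_ : 0 <= 4 :> R)) // in t1.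
  have : 0 <= B * x^-1 by rewrite mulr_ge0// ltW.
  by lra.
have [D hD] := liouville_expansion hd_scap hd_scap' lead N.
exists D => x x1; have [h _] := hD x x1.
have x0 : 0 < x by apply: lt_le_trans x1.
have q0 : 0 < x ^+ 2 * Num.sqrt x by rewrite mulr_gt0 ?exprn_gt0 ?sqrtr_gt0.
rewrite cap_hatE// -mulrBl normrM [ `|_^-1|]ger0_norm ?invr_ge0 ?(ltW q0)//.
by rewrite ler_wpM2r// invr_ge0 ltW.
Qed.

End BesselAsymptotics.

(** * Unordered sums over the lattice *)

Section UnorderedSums.
Context {R : realType} {I : choiceType}.
Implicit Types (f g b : I -> R) (A B : {fset I}) (l m e : R).

Lemma sum_fset_sub f A B : (A `<=` B)%fset ->
  \sum_(i <- B) f i = \sum_(i <- A) f i + \sum_(i <- (B `\` A)%fset) f i.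
Proof.
move=> AB; rewrite (big_fsetID _ (mem A)) /=; congr (_ + _); congr bigop.
  by congr enum_fset; apply/fsetP => i; rewrite !inE /= andbC;
    case: (boolP (i \in A)) => //= /(fsubsetP AB) ->.
by congr enum_fset; apply/fsetP => i; rewrite !inE /= andbC.
Qed.

Lemma ler_sum_fset f A B : (forall i, 0 <= f i) -> (A `<=` B)%fset ->
  \sum_(i <- A) f i <= \sum_(i <- B) f i.
Proof. by move=> f0 AB; rewrite (sum_fset_sub f AB) lerDl sumr_ge0. Qed.

(** Unlike [summability.sum], which is a limit operator, this also asserts
    convergence. *)
Definition has_sum f l := forall e, 0 < e -> exists A, forall B, (A `<=` B)%fset ->
  `|l - \sum_(i <- B) f i| <= e.

Lemma has_sumE f l : has_sum f l -> summability.sum f = l.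
Proof.
move=> fl; have FF := @summability.totally_filter I.
apply: cvg_lim => //; apply/cvgrPdist_le => e e0.
have [A hA] := fl e e0; exists A => // B /= AB.
by have := hA B AB; rewrite /summability.partial_sum -(big_seq_fsetE _ B xpredT f).
Qed.

Lemma has_sum_unique f l m : has_sum f l -> has_sum f m -> l = m.
Proof. by move=> /has_sumE <- /has_sumE. Qed.

Lemma has_sum_lin k k' f g l m : has_sum f l -> has_sum g m ->
  has_sum (fun i => k * f i + k' * g i) (k * l + k' * m).
Proof.
move=> fl gm e e0.
pose c := 2 * (`|k| + `|k'| + 1).
have c0 : 0 < c by rewrite mulr_gt0// ltr_wpDl// addr_ge0.
have ec : 0 < e / c by rewrite divr_gt0.
have [A hA] := fl _ ec; have [B hB] := gm _ ec.
exists (A `|` B)%fset => D; rewrite fsubUset => /andP[AD BD].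
rewrite big_split /= -!mulr_sumr.
set F := \sum_(i <- D) f i; set G := \sum_(i <- D) g i.
have -> : k * l + k' * m - (k * F + k' * G) = k * (l - F) + k' * (m - G) by ring.
apply: (le_trans (ler_normD _ _)); rewrite !normrM.
have h1 := ler_wpM2l (normr_ge0 k) (hA D AD).
have h2 := ler_wpM2l (normr_ge0 k') (hB D BD).
apply: (le_trans (lerD h1 h2)); rewrite -mulrDl mulrCA ler_piMr ?(ltW e0)//.
rewrite ler_pdivrMr// mul1r /c; have := normr_ge0 k; have := normr_ge0 k'; lra.
Qed.

Lemma has_sumZ k f l : has_sum f l -> has_sum (fun i => k * f i) (k * l).
Proof.
move=> fl; have := has_sum_lin k 0 fl fl; rewrite mul0r addr0.
by congr has_sum; apply/funext => i; rewrite mul0r addr0.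
Qed.

Lemma has_sum_sum n (f : nat -> I -> R) (l : nat -> R) :
  (forall j, (j < n)%N -> has_sum (f j) (l j)) ->
  has_sum (fun i => \sum_(j < n) f j i) (\sum_(j < n) l j).
Proof.
elim: n => [|n IH] h.
  move=> e e0; exists fset0 => B _; rewrite big_ord0 big1 ?subrr ?normr0 ?ltW//.
  by move=> i _; rewrite big_ord0.
have h1 := IH (fun j jn => h j (ltnW jn)).
have := has_sum_lin 1 1 h1 (h n (ltnSn n)).
rewrite big_ord_recr /= !mul1r; congr has_sum; apply/funext => i.
by rewrite big_ord_recr /= !mul1r.
Qed.

Section Dominated.
Variables (b : I -> R) (M : R).
Hypotheses (b0 : forall i, 0 <= b i) (bM : forall A, \sum_(i <- A) b i <= M).

(** [A] nearly attains the supremum of the finite sums. *)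
Lemma dominated_tail e : 0 < e -> exists A, forall B,
  \sum_(i <- (B `\` A)%fset) b i <= e.
Proof.
move=> e0.
pose S := [set \sum_(i <- A) b i | A in [set: {fset I}]].
have S0 : S !=set0 by exists (\sum_(i <- fset0) b i); exists fset0.
have Sub : has_ubound S by exists M => _ [A _ <-]; exact: bM.
have [_ [A _ <-] hA] := sup_adherent e0 (conj S0 Sub).
exists A => B.
have : \sum_(i <- (A `|` B)%fset) b i <= sup S by apply: ub_le_sup => //; exists (A `|` B)%fset.
rewrite (sum_fset_sub b (fsubsetUl A B)).
have -> : ((A `|` B) `\` A = B `\` A)%fset.
  by apply/fsetP => i; rewrite !inE; case: (i \in A).
by move: hA; lra.
Qed.

(** [f] is the difference of the nonnegative families [f + b] and [b], whose
    sums are the suprema of their finite sums. *)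
Lemma dominated_has_sum f : (forall i, `|f i| <= b i) -> exists l, has_sum f l.
Proof.
move=> fb.
have nonneg g c : (forall i, 0 <= g i <= c * b i) -> 0 <= c -> exists l, has_sum g l.
  move=> gb c0.
  pose S := [set \sum_(i <- A) g i | A in [set: {fset I}]].
  have S0 : S !=set0 by exists (\sum_(i <- fset0) g i); exists fset0.
  have Sub : has_ubound S.
    exists (c * M) => _ [A _ <-]; apply: (@le_trans _ _ (\sum_(i <- A) c * b i)).
      by apply: ler_sum => i _; case/andP: (gb i).
    by rewrite -mulr_sumr ler_wpM2l.
  exists (sup S) => e e0; have [_ [A _ <-] hA] := sup_adherent e0 (conj S0 Sub).
  exists A => B AB.
  have h1 : \sum_(i <- B) g i <= sup S by apply: ub_le_sup => //; exists B.
  have h2 : \sum_(i <- A) g i <= \sum_(i <- B) g i.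
    by apply: ler_sum_fset => // i; case/andP: (gb i).
  by rewrite ger0_norm ?subr_ge0//; lra.
have fb' i : - b i <= f i <= b i by rewrite -ler_norml.
have [l hl] := nonneg (fun i => f i + b i) 2 ltac:(move=> i; move: (fb' i) => /andP[? ?]; apply/andP; split; lra) ltac:(lra).
have [m hm] := nonneg b 1 ltac:(move=> i; rewrite mul1r b0 lexx //) ltac:(lra).
exists (1 * l + -1 * m); have := has_sum_lin 1 (-1) hl hm.
by congr has_sum; apply/funext => i; ring.
Qed.

Lemma ler_norm_sum_fset f A : (forall i, `|f i| <= b i) ->
  `|\sum_(i <- A) f i| <= \sum_(i <- A) b i.
Proof.
move=> fb; apply: (le_trans (ler_norm_sum _ _ _)); apply: ler_sum => i _; exact: fb.
Qed.

Lemma has_sum_bound f l : (forall i, `|f i| <= b i) -> has_sum f l -> `|l| <= M.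
Proof.
move=> fb fl; apply/ler_addgt0Pr => e e0; have [A hA] := fl e e0.
rewrite -(subrK (\sum_(i <- A) f i) l) addrC; apply: (le_trans (ler_normD _ _)).
by apply: lerD; [exact: le_trans (ler_norm_sum_fset A fb) (bM A)|exact: hA].
Qed.

Lemma has_sum_tail f l A e : (forall i, `|f i| <= b i) ->
  (forall B, \sum_(i <- (B `\` A)%fset) b i <= e) ->
  has_sum f l -> `|l - \sum_(i <- A) f i| <= e.
Proof.
move=> fb hA fl; apply/ler_addgt0Pr => d d0; have [B hB] := fl d d0.
have := hB (A `|` B)%fset (fsubsetUr A B).
rewrite (sum_fset_sub f (fsubsetUl A B)).
set D := ((A `|` B) `\` A)%fset => h.
have h1 := le_trans (ler_norm_sum_fset D fb) (hA _).
have -> : l - \sum_(i <- A) f i = (l - (\sum_(i <- A) f i + \sum_(i <- D) f i)) +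
   \sum_(i <- D) f i by ring.
by apply: (le_trans (ler_normD _ _)); rewrite addrC lerD.
Qed.

Lemma dominated_esum f : (forall i, `|f i| <= b i) ->
  summable [set: I] (fun i => (f i)%:E).
Proof.
move=> fb; rewrite /summable; apply: (@le_lt_trans _ _ M%:E); last exact: ltry.
apply: ge_ereal_sup => _ [X [finX _] <-].
rewrite fsbig_finite //= sumEFin lee_fin; apply: le_trans (bM (fset_set X)).
by apply: ler_sum => i _; exact: fb.
Qed.

End Dominated.
End UnorderedSums.

Section LatticeSums.
Context {R : realType}.
Implicit Types (n : int * int) (A B : {fset (int * int)}).

(** The comparison of [k^(-5/4)] with a telescoping sum; after the
    substitution of fourth roots [y] and [z] it is an inequality between
    polynomials. *)
Lemma powR_step (k : nat) : (0 < k)%N ->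
  (k.+1)%:R `^ (- (5 / 4)) + 4 * (k.+1)%:R `^ (- (1 / 4)) <= 4 * k%:R `^ (- (1 / 4)) :> R.
Proof.
move=> k0; have k1 : 0 < k%:R :> R by rewrite ltr0n.
set y : R := k.+1%:R `^ (1 / 4); set z : R := k%:R `^ (1 / 4).
have z0 : 0 < z by rewrite powR_gt0.
have y0 : 0 < y by rewrite powR_gt0.
have y4 : y ^+ 4 = k%:R + 1.
  by rewrite -powR_mulrn ?(ltW y0)// -powRrM (_ : 1 / 4 * 4%:R = 1) ?powRr1 ?natr1//; field.
have z4 : z ^+ 4 = k%:R.
  by rewrite -powR_mulrn ?(ltW z0)// -powRrM (_ : 1 / 4 * 4%:R = 1) ?powRr1 ?ler0n//; field.
have -> : k.+1%:R `^ (- (5 / 4)) = y ^- 5 :> R.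
  by rewrite -powR_invn ?(ltW y0)// -powRrM; congr powR; field.
rewrite !powRN -/y -/z.
have zy : z <= y.
  rewrite leNgt; apply/negP => yz.
  have : y ^+ 4 <= z ^+ 4 by rewrite lerXn2r ?nnegrE ?ltW.
  by rewrite y4 z4; lra.
have h : 4 * (y ^+ 4) * (y - z) - z = y ^+ 4 * 4 * (y - z) - z * (y ^+ 4 - z ^+ 4).
  by rewrite y4 z4; ring.
have h2 : 0 <= 4 * (y ^+ 4) * (y - z) - z.
  rewrite h; have -> : y ^+ 4 * 4 * (y - z) - z * (y ^+ 4 - z ^+ 4) =
     (y - z) * (4 * y ^+ 4 - z * ((y + z) * (y ^+ 2 + z ^+ 2))) by ring.
  apply: mulr_ge0; first by rewrite subr_ge0.
  rewrite subr_ge0.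
  have -> : 4 * y ^+ 4 = y * ((y + y) * (y ^+ 2 + y ^+ 2)) by ring.
  have z2 : z ^+ 2 <= y ^+ 2 by rewrite lerXn2r ?nnegrE ?(ltW y0) ?(ltW z0).
  apply: ler_pM => //; [exact: ltW|by rewrite mulr_ge0// addr_ge0 ?sqr_ge0// ltW|].
  by apply: ler_pM; rewrite ?addr_ge0 ?sqr_ge0 ?(ltW y0) ?(ltW z0)// lerD.
rewrite -subr_ge0.
have -> : 4 * z^-1 - (y ^- 5 + 4 * y^-1) = (4 * y ^+ 4 * (y - z) - z) / (z * y ^+ 5).
  by field; rewrite !gt_eqF.
by rewrite divr_ge0// mulr_ge0 ?exprn_ge0 ?ltW.
Qed.

Definition decay (k : nat) : R := k.+1%:R `^ (- (5 / 4)).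

Lemma decay_ge0 k : 0 <= decay k. Proof. exact: powR_ge0. Qed.

Lemma sum_decay N : \sum_(k < N) decay k <= 5.
Proof.
case: N => [|N]; first by rewrite big_ord0.
suff : \sum_(k < N.+1) decay k + 4 * N.+1%:R `^ (- (1 / 4)) <= 5.
  by apply: le_trans; rewrite lerDl mulr_ge0// powR_ge0.
elim: N => [|N IH]; first by rewrite big_ord1 /decay powR1 mulr1; lra.
rewrite big_ord_recr /= -addrA; apply: le_trans IH; rewrite lerD2l.
exact: powR_step.
Qed.

Lemma sum_decay_int (s : seq int) : uniq s -> \sum_(a <- s) decay `|a| <= 10.
Proof.
move=> us.
pose P := [fset a in s | 0 <= a]%fset; pose Q := [fset a in s | a < 0]%fset.
have half (T : {fset int}) : {in T &, injective absz} -> \sum_(a <- T) decay `|a| <= 5.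
  move=> injT; pose m := \max_(a <- T) `|a|%N.
  apply: (le_trans _ (sum_decay m.+1)).
  rewrite -(big_mkord xpredT decay) -(big_map absz xpredT decay).
  have u1 : uniq [seq `|a|%N | a <- T] by rewrite map_inj_in_uniq ?fset_uniq.
  have -> : \sum_(i <- [seq `|a|%N | a <- T]) decay i =
     \sum_(i <- [fset x in [seq `|a|%N | a <- T]]%fset) decay i.
    apply: perm_big; rewrite uniq_perm ?fset_uniq//= => i.
    by rewrite !inE.
  have -> : \sum_(0 <= i < m.+1) decay i =
     \sum_(i <- [fset x in index_iota 0 m.+1]%fset) decay i.
    apply: perm_big; rewrite uniq_perm ?fset_uniq ?iota_uniq//= => i.
    by rewrite !inE.
  apply: ler_sum_fset; first exact: decay_ge0.
  apply/fsubsetP => i; rewrite !in_fset => /mapP[a aT ->].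
  rewrite mem_index_iota leq0n ltnS /=.
  by have := @leq_bigmax_seq _ (enum_fset T) xpredT absz a aT isT.
have -> : \sum_(a <- s) decay `|a| = \sum_(a <- P) decay `|a| + \sum_(a <- Q) decay `|a|.
  rewrite (bigID (fun a => 0 <= a)) /=; congr (_ + _).
    rewrite -big_filter; apply: perm_big; rewrite uniq_perm ?fset_uniq ?filter_uniq// => a.
    by rewrite mem_filter !inE andbC.
  rewrite -big_filter; apply: perm_big; rewrite uniq_perm ?fset_uniq ?filter_uniq// => a.
  by rewrite mem_filter !inE andbC -ltNge.
have hP : \sum_(a <- P) decay `|a| <= 5.
  by apply: half => a c; rewrite !inE /= => /andP[_ a0] /andP[_ c0]; lia.
have hQ : \sum_(a <- Q) decay `|a| <= 5.
  by apply: half => a c; rewrite !inE /= => /andP[_ a0] /andP[_ c0]; lia.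
by lra.
Qed.

Definition weight n : R := if n == 0 then 0 else enorm n `^ (- (5 / 2)).

Lemma weight_ge0 n : 0 <= weight n.
Proof. by rewrite /weight; case: ifP => // _; exact: powR_ge0. Qed.

Lemma enorm_sq n : enorm n ^+ 2 = n.1%:~R ^+ 2 + n.2%:~R ^+ 2 :> R.
Proof. by rewrite /enorm sqr_sqrtr// addr_ge0 ?sqr_ge0. Qed.

Lemma enorm_ge1 n : n != 0 -> 1 <= enorm n :> R.
Proof.
move=> n0; rewrite /enorm -[leLHS]sqrtr1 ler_wsqrtr//.
have [/eqP a0|a0] := boolP (n.1 == 0).
  have b0 : n.2 != 0.
    by apply: contra n0 => /eqP b0; case: n a0 b0 => a b /= -> ->.
  have : 1 <= n.2 ^+ 2 by move: b0; case: n {n0 a0} => a b /=; nia.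
  rewrite a0 expr0n /= add0r -(rmorphXn _ 2 n.2) /=.
  by rewrite -(ler_int R).
have : 1 <= n.1 ^+ 2 + n.2 ^+ 2.
  by move: a0; case: n {n0} => a b /=; nia.
by rewrite -(ler_int R) rmorphD /= !rmorphXn.
Qed.

(** Since [(1 + |a|) (1 + |b|) <= 4 |n|^2] for nonzero [n = (a, b)], the
    double sum is dominated by a product of two convergent series. *)
Lemma weight_le n : weight n <= 4 `^ (5 / 4) * (decay `|n.1| * decay `|n.2|).
Proof.
rewrite /weight; case: ifP => [_|/negbT n0].
  by rewrite mulr_ge0 ?powR_ge0// mulr_ge0 ?decay_ge0.
have e1 := enorm_ge1 n0; have en0 := lt_le_trans ltr01 e1.
set p : R := `|n.1|.+1%:R; set q : R := `|n.2|.+1%:R.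
have p0 : 0 < p by rewrite ltr0n.
have q0 : 0 < q by rewrite ltr0n.
have pq : p * q <= 4 * enorm n ^+ 2.
  rewrite enorm_sq /p /q -!natr1 !natr_absz !intr_norm.
  have := enorm_sq n; rewrite -(real_normK (num_real n.1%:~R)) -(real_normK (num_real n.2%:~R)).
  have sq (a : int) : `|a%:~R : R| <= `|a%:~R| ^+ 2.
    rewrite real_normK ?num_real// -intr_norm -rmorphXn /= ler_int.
    by case: a => a; nia.
  have := sq n.1; have := sq n.2.
  have : 1 <= (enorm n : R) ^+ 2 by rewrite exprn_ege1.
  have := normr_ge0 (n.1%:~R : R); have := normr_ge0 (n.2%:~R : R).
  move: `|n.1%:~R| `|n.2%:~R| (enorm n ^+ 2) => u v w; nra.
have -> : enorm n `^ (- (5 / 2)) = (enorm n ^+ 2) `^ (- (5 / 4)) :> R.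
  rewrite -powR_mulrn ?(le_trans ler01 e1)// -powRrM; congr powR; by field.
rewrite /decay -/p -/q -powRM ?(ltW p0) ?(ltW q0)// !powRN.
have e2 : 0 < enorm n ^+ 2 :> R by rewrite exprn_gt0.
rewrite -ler_pdivrMl ?powR_gt0// mulrC -invfM lef_pV2 ?posrE ?mulr_gt0 ?powR_gt0 ?mulr_gt0//.
rewrite mulrC -powRM ?ler0n ?(ltW e2)//.
by apply: ge0_ler_powR; rewrite ?nnegrE ?mulr_ge0 ?(ltW e2) ?(ltW p0) ?(ltW q0)//; lra.
Qed.

Definition weight_total : R := 4 `^ (5 / 4) * (10 * 10).

Lemma sum_weight A : \sum_(n <- A) weight n <= weight_total.
Proof.
pose s1 := undup [seq n.1 | n <- A]; pose s2 := undup [seq n.2 | n <- A].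
apply: (@le_trans _ _ (\sum_(n <- A) 4 `^ (5 / 4) * (decay `|n.1| * decay `|n.2|))).
  by apply: ler_sum => n _; exact: weight_le.
rewrite -mulr_sumr ler_wpM2l ?powR_ge0//.
pose F n : R := decay `|n.1| * decay `|n.2|.
have F0 n : 0 <= F n by rewrite mulr_ge0 ?decay_ge0.
pose T := [fset n in [seq (a, c) | a <- s1, c <- s2]]%fset.
have AT : (A `<=` T)%fset.
  apply/fsubsetP => n nA; rewrite !inE /=.
  apply/allpairsP; exists n; rewrite !mem_undup !map_f//; split => //.
  by case: (n).
apply: (le_trans (ler_sum_fset F0 AT)).
have -> : \sum_(n <- T) F n = \sum_(n <- [seq (a, c) | a <- s1, c <- s2]) F n.
  apply: perm_big; rewrite uniq_perm ?fset_uniq ?allpairs_uniq ?undup_uniq//.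
    by move=> [? ?] [? ?] _ _ /= [-> ->].
  by move=> n; rewrite !inE.
rewrite big_allpairs /F /= -big_distrlr /=.
by apply: ler_pM; rewrite ?sumr_ge0 ?sum_decay_int ?undup_uniq// => i _; exact: decay_ge0.
Qed.

End LatticeSums.

(** * Cesaro means over boxes *)

Section Cesaro.
Context {R : realType}.
Implicit Types (f : int -> int -> R).

Definition box (N j j' : nat) : {fset (int * int)} :=
  [fset n in [seq ((Posz i - Posz j)%R, (Posz i' - Posz j')%R) | i <- index_iota 0 N, i' <- index_iota 0 N]]%fset.

Lemma sum_box (h : int * int -> R) N j j' : \sum_(n <- box N j j') h n =
  \sum_(i < N) \sum_(i' < N) h ((i%:Z - j%:Z)%R, (i'%:Z - j'%:Z)%R).
Proof.
have -> : \sum_(n <- box N j j') h n = \sum_(n <-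
    [seq ((Posz i - Posz j)%R, (Posz i' - Posz j')%R) | i <- index_iota 0 N, i' <- index_iota 0 N]) h n.
  apply: perm_big; rewrite uniq_perm ?fset_uniq ?allpairs_uniq ?iota_uniq//.
    by move=> [? ?] [? ?] _ _ /= [] ? ?; congr pair; lia.
  by move=> n; rewrite !in_fset.
rewrite big_allpairs_dep /= big_mkord; apply: eq_bigr => i _.
by rewrite big_mkord.
Qed.

Lemma fset_sub_box (A : {fset (int * int)}) : exists m, forall N j j',
  (m <= j)%N -> (j + m < N)%N -> (m <= j')%N -> (j' + m < N)%N -> (A `<=` box N j j')%fset.
Proof.
exists (\max_(n <- A) (`|n.1| + `|n.2|)%N) => N j j' h1 h2 h3 h4.
apply/fsubsetP => n nA.
have := @leq_bigmax_seq _ (enum_fset A) xpredT (fun n => (`|n.1| + `|n.2|)%N) n nA isT => /= hn.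
move: hn h1 h2 h3 h4; move: (\max_(i <- A) _)%N => m.
case: n {nA} => a b /= hn h1 h2 h3 h4.
rewrite in_fset; apply/allpairsP; exists (`|(a + j%:Z)%R|%N, `|(b + j'%:Z)%R|%N) => /=.
by rewrite !mem_index_iota /=; split; [lia|lia|congr pair; lia].
Qed.

Lemma sum_pred_le (P : pred nat) N k : (forall j, (j < N)%N -> P j -> (j < k)%N) ->
  \sum_(j < N) (P j)%:R <= k%:R :> R.
Proof.
move=> Pk; rewrite -(big_mkord xpredT (fun j => (P j)%:R)) -natr_sum ler_nat.
have -> : \sum_(0 <= i < N) nat_of_bool (P i) = count P (index_iota 0 N).
  by elim: (index_iota 0 N) => [|i r IH]; rewrite ?big_nil ?big_cons //= IH.
rewrite -size_filter -[leqRHS](size_iota 0).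
apply: uniq_leq_size; first by rewrite filter_uniq// iota_uniq.
by move=> j; rewrite mem_filter mem_index_iota mem_iota /= add0n => /andP[Pj jN]; exact: Pk.
Qed.

(** Regrouped by the indices [j], [j'], the Fejer means are averages of
    partial sums over boxes, all but a proportion [O(1/N)] of which contain a
    given finite set. *)
Lemma cesaro_has_sum (f : int -> int -> R) (l M : R) :
  has_sum (fun n => f n.1 n.2) l ->
  (forall A : {fset (int * int)}, `|\sum_(n <- A) f n.1 n.2| <= M) -> `|l| <= M ->
  forall e, 0 < e -> exists K : R, forall N, (0 < N)%N ->
   `|l - N%:R^-1 * (\sum_(i < N) \sum_(j < N) (N%:R^-1 * \sum_(i' < N) \sum_(j' < N)
      f (i%:Z - j%:Z)%R (i'%:Z - j'%:Z)%R))| <= e + K / N%:R.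
Proof.
move=> fl fM lM e e0.
have [A hA] := fl e e0; have [m hm] := fset_sub_box A.
pose bad N j : bool := (j < m)%N || (N <= j + m)%N.
exists (2 * M * (4 * m%:R)) => N N0.
have N1 : 0 < N%:R :> R by rewrite ltr0n.
have M0 : 0 <= M by apply: le_trans lM.
pose S j j' := \sum_(n <- box N j j') f n.1 n.2.
have -> : N%:R^-1 * (\sum_(i < N) \sum_(j < N) (N%:R^-1 * \sum_(i' < N) \sum_(j' < N)
      f (i%:Z - j%:Z)%R (i'%:Z - j'%:Z)%R)) =
    N%:R^-1 ^+ 2 * \sum_(j < N) \sum_(j' < N) S j j'.
  rewrite expr2 -mulrA; congr (_ * _); rewrite exchange_big /= mulr_sumr.
  apply: eq_bigr => j _; rewrite -mulr_sumr; congr (_ * _).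
  have -> : \sum_(i < N) \sum_(i' < N) \sum_(j' < N)
      f (i%:Z - j%:Z)%R (i'%:Z - j'%:Z)%R =
    \sum_(i < N) \sum_(j' < N) \sum_(i' < N) f (i%:Z - j%:Z)%R (i'%:Z - j'%:Z)%R.
    by apply: eq_bigr => i _; exact: exchange_big.
  rewrite exchange_big /=; apply: eq_bigr => j' _.
  by rewrite /S sum_box.
have lE : l = N%:R^-1 ^+ 2 * \sum_(j < N) \sum_(j' < N) l.
  rewrite !sumr_const !card_ord -[_ *+ N]mulr_natr -[l *+ N]mulr_natr; field.
  by rewrite gt_eqF.
rewrite {1}lE -mulrBr -sumrB normrM ger0_norm ?exprn_ge0 ?invr_ge0 ?ler0n//.
have cnt : \sum_(j < N) (bad N j)%:R <= 2 * m%:R :> R.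
  apply: (@le_trans _ _ (\sum_(j < N) ((j < m)%N%:R + (N <= j + m)%N%:R))).
    apply: ler_sum => j _; rewrite /bad.
    by case: (j < m)%N; case: (N <= j + m)%N => /=; rewrite ?addr0 ?add0r// lerDl.
  rewrite big_split /= mulr2n mulrDl mul1r; apply: lerD.
    exact: (@sum_pred_le (fun j => (j < m)%N) N m (fun j _ h => h)).
  rewrite (reindex_inj rev_ord_inj) /=; apply: (@sum_pred_le (fun j => N <= N - j.+1 + m)%N) => j jN.
  by lia.
have bound (j j' : 'I_N) : `|l - S j j'| <= e + 2 * M * ((bad N j)%:R + (bad N j')%:R).
  case: (boolP (bad N j || bad N j')) => hb.
    apply: (@le_trans _ _ (2 * M)).
      apply: (le_trans (ler_normB _ _)); rewrite mulr2n mulrDl mul1r; apply: lerD => //.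
      exact: fM.
    rewrite -[leLHS]add0r; apply: lerD; first exact: ltW.
    rewrite ler_peMr ?mulr_ge0//.
    by case/orP: hb => ->; rewrite ?lerDl ?lerDr.
  move: hb; rewrite negb_or /bad !negb_or -!leqNgt -!ltnNge => /andP[/andP[? ?] /andP[? ?]].
  apply: (@le_trans _ _ e); first by apply: hA; exact: hm.
  by rewrite lerDl mulr_ge0 ?mulr_ge0// addr_ge0.
have total : `|\sum_(j < N) (\sum_(j' < N) l - \sum_(j' < N) S j j')| <=
    N%:R ^+ 2 * e + 2 * M * (N%:R * (4 * m%:R)).
  apply: (le_trans (ler_norm_sum _ _ _)).
  apply: (@le_trans _ _ (\sum_(j < N) \sum_(j' < N) (e + 2 * M * ((bad N j)%:R + (bad N j')%:R)))).
    apply: ler_sum => j _; rewrite -sumrB; apply: (le_trans (ler_norm_sum _ _ _)).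
    by apply: ler_sum => j' _; exact: bound.
  under eq_bigr => j _.
    rewrite big_split /= -mulr_sumr big_split /= !sumr_const !card_ord.
    over.
  rewrite big_split /= -mulr_sumr big_split /= !sumr_const !card_ord.
  rewrite sumrMnl -(mulr_natr e) -(mulr_natr (e * _)) -(mulr_natr (\sum_(i < N) _)).
  apply: lerD; first by rewrite le_eqVlt; apply/orP; left; apply/eqP; ring.
  rewrite ler_wpM2l ?mulr_ge0//.
  by have := ler_wpM2l (ltW N1) cnt; lra.
apply: (@le_trans _ _ (N%:R^-1 ^+ 2 * (N%:R ^+ 2 * e + 2 * M * (N%:R * (4 * m%:R))))).
  by rewrite ler_wpM2l ?exprn_ge0 ?invr_ge0 ?ler0n.
rewrite le_eqVlt; apply/orP; left; apply/eqP; field.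
by rewrite gt_eqF.
Qed.

End Cesaro.

(** * The average discrepancy as a sum over the dual lattice *)

Section Counting.
Context {R : realType}.
Implicit Types (n : int * int) (A B : {fset (int * int)}) (t r x y : R).
Local Notation mu := (@lebesgue_measure R).

Definition step (s t : R) : R := if s <= t then 1 else 0.

Lemma step_indic s : step s = \1_`[s, +oo[.
Proof.
by apply/funext => t; rewrite indicE mem_setE in_itv /= andbT /step; case: (s <= t).
Qed.

Lemma integrable_step (s r : R) : mu.-integrable `[0, r] (EFin \o step s).
Proof.
rewrite step_indic; apply: measurable_bounded_integrable => //.
- by rewrite /= lebesgue_measure_itv /= lte_fin; case: ifP => _; rewrite ?ltry.
- exists 1; split; first exact: num_real.
  move=> M M1 t _; rewrite /= indicE; case: (_ \in _); rewrite ?normr1 ?normr0.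
    exact: ltW.
  by apply: le_trans (ltW M1).
Qed.

Lemma Rintegral_step (s r : R) : 0 <= s <= r ->
  \int[mu]_(t in `[0, r]) step s t = r - s.
Proof.
move=> /andP[s0 sr]; rewrite /Rintegral step_indic integral_indic //=.
have -> : `[s, +oo[ `&` `[0, r] = `[s, r]%classic.
  apply/seteqP; split => t /=; rewrite !in_itv /= andbT.
    by move=> [-> /andP[_ ->]].
  by move=> /andP[st tr]; rewrite st tr (le_trans s0 st).
rewrite lebesgue_measure_itv /= lte_fin; case: ltP => // rs.
by have -> : s = r by [apply/eqP; rewrite eq_le sr rs]; rewrite subrr.
Qed.

Definition eigenvalue_of n : R := 4 * pi ^+ 2 * enorm n ^+ 2.

Lemma lattice_diskE t n : 0 <= t -> lattice_disk t n <-> eigenvalue_of n <= t.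
Proof.
move=> t0; rewrite /lattice_disk /= /eigenvalue_of.
have p0 : 0 < 2 * pi :> R by rewrite mulr_gt0 ?pi_gt0.
have e0 : 0 <= enorm n :> R by exact: sqrtr_ge0.
have -> : 4 * pi ^+ 2 * enorm n ^+ 2 = (enorm n * (2 * pi)) ^+ 2 :> R by ring.
rewrite ler_pdivlMr// -[X in _ <-> (_ <= X)](sqr_sqrtr t0).
by rewrite ler_pXn2r // nnegrE ?sqrtr_ge0// mulr_ge0// ltW.
Qed.

(** On [0, r] the count is a finite sum of step functions, and [step s] has
    integral [r - s]. *)
Lemma avg_discrepancy_riesz r A : 0 < r ->
  (forall n, eigenvalue_of n <= r -> n \in A) ->
  avg_discrepancy r = r^-1 * (\sum_(n <- A) Num.max 0 (r - eigenvalue_of n) - r ^+ 2 / (8 * pi)).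
Proof.
move=> r0 hA; have pi0 := @pi_gt0 R.
rewrite /avg_discrepancy; congr (_ * _).
have eig0 n : 0 <= eigenvalue_of n.
  by rewrite /eigenvalue_of mulr_ge0 ?sqr_ge0// mulr_ge0 ?sqr_ge0.
pose D := fset_set (lattice_disk r).
have inD n : (n \in D) = (eigenvalue_of n <= r).
  rewrite in_fset_set; last exact: finite_lattice_disk.
  by apply/idP/idP; rewrite inE; move=> /(lattice_diskE n (ltW r0)).
have count t : 0 <= t <= r -> (lattice_count t)%:R = \sum_(n <- D) step (eigenvalue_of n) t :> R.
  move=> /andP[t0 tr]; rewrite /lattice_count card_fset_sum1 natr_sum.
  have sub : (fset_set (lattice_disk t) `<=` D)%fset.
    apply/fsubsetP => n; rewrite in_fset_set; last exact: finite_lattice_disk.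
    by rewrite inE => /(lattice_diskE n t0) h; rewrite inD (le_trans h).
  rewrite (sum_fset_sub (fun n => step (eigenvalue_of n) t) sub).
  rewrite [X in _ + X]big_seq [X in _ + X]big1 ?addr0.
    rewrite big_seq [RHS]big_seq; apply: eq_bigr => n.
    rewrite in_fset_set; last exact: finite_lattice_disk.
    by rewrite inE => /(lattice_diskE n t0) h; rewrite /step h.
  move=> n; rewrite inE in_fset_set; last exact: finite_lattice_disk.
  move=> /andP[/negP h _]; rewrite /step; case: ifP => // le.
  by exfalso; apply: h; rewrite inE; exact/lattice_diskE.
have isum (E : seq (int * int)) :
    mu.-integrable `[0, r] (EFin \o (fun t => \sum_(n <- E) step (eigenvalue_of n) t)).
  have -> : EFin \o (fun t => \sum_(n <- E) step (eigenvalue_of n) t) =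
     (fun t => \sum_(n <- E) (step (eigenvalue_of n) t)%:E)%E.
    by apply/funext => t /=; rewrite sumEFin.
  by apply: integrable_sum => // n _; exact: integrable_step.
have clin : continuous (fun t : R => t / (4 * pi)) by cont.
rewrite (@eq_Rintegral _ _ _ mu _ (fun t => \sum_(n <- D) step (eigenvalue_of n) t - t / (4 * pi))); last first.
  move=> t; rewrite inE /= in_itv /= => tr; rewrite /discrepancy count//.
rewrite RintegralB //; last exact: continuous_integrable.
congr (_ - _); last first.
  rewrite integ_Rintegral ?(ltW r0)// (@integE _ _ (fun t => t ^+ 2 / (8 * pi))).
    by rewrite expr0n /= mul0r subr0.
  by move=> t; move: (pi : R) (lt0r_neq0 pi0) => p pn; apply: hd_eq; [der|rewrite /=; field].
have -> : \int[mu]_(t in `[0, r]) \sum_(n <- D) step (eigenvalue_of n) t =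
    \sum_(n <- D) (r - eigenvalue_of n).
  have : all (fun n => eigenvalue_of n <= r) D by apply/allP => n; rewrite inD.
  elim: (enum_fset D) => [_|n E IH /= /andP[h1 h2]].
    by under eq_Rintegral do rewrite big_nil; rewrite big_nil Rintegral_cst // mul0r.
  under eq_Rintegral do rewrite big_cons.
  rewrite RintegralD //; last exact: integrable_step.
  by rewrite big_cons IH// Rintegral_step// eig0.
have DA : (D `<=` A)%fset by apply/fsubsetP => n; rewrite inD => /hA.
rewrite (sum_fset_sub _ DA) [X in _ = _ + X]big_seq [X in _ = _ + X]big1 ?addr0.
  rewrite big_seq [RHS]big_seq; apply: eq_bigr => n; rewrite inD => h.
  by rewrite (max_idPr _)// subr_ge0.
move=> n; rewrite inE inD => /andP[h _].
by apply/max_idPl; rewrite subr_le0 ltW// ltNge.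
Qed.

Lemma cap_hat0 : cap_hat 0 = pi / 2 :> R.
Proof.
rewrite /cap_hat (_ : (fun t => _) = fun t => sin t ^+ 4); last first.
  by apply/funext => t; rewrite mul0r cos0 mul1r.
rewrite (@integE _ _ (fun t => 3 / 8 * t - 3 / 8 * (sin t * cos t) - 1 / 4 * (sin t ^+ 3 * cos t))).
  by rewrite sinpi sin0; field.
move=> t; apply: hd_eq; first by der.
rewrite /=.
have -> : cos t * 1 * cos t = 1 - sin t ^+ 2 by have := cos2Dsin2 t; lra.
have -> : sin t ^+ 3 * (- sin t * 1) = - sin t ^+ 4 by ring.
have -> : 3%:R * sin t ^+ 3.-1 * (cos t * 1) * cos t = 3 * (sin t ^+ 2 - sin t ^+ 4).
  have -> : 3%:R * sin t ^+ 3.-1 * (cos t * 1) * cos t = 3 * (sin t ^+ 2 * cos t ^+ 2) :> R by ring.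
  have -> : cos t ^+ 2 = 1 - sin t ^+ 2 by have := cos2Dsin2 t; lra.
  by ring.
by field.
Qed.

Lemma powR_n52 x : 0 < x -> (x ^+ 2 * Num.sqrt x)^-1 = x `^ (- (5 / 2)).
Proof.
move=> x0; rewrite -powR12_sqrt ?(ltW x0)// -powR_mulrn ?(ltW x0)//.
rewrite -powRD ?powRN ?(gt_eqF x0) ?implybT//.
by congr (_ `^ _)^-1; field.
Qed.

Lemma cap_hat_decay : exists2 C : R, 0 <= C & forall x, 1 <= x ->
  `|cap_hat x| <= C * x `^ (- (5 / 2)).
Proof.
have [C hC] := @cap_hat_expansion R 0.
pose p : R := Num.sqrt pi.
have K0 : 0 <= `|- 4 * p| + `|- 4 * p| + `|C| by rewrite !addr_ge0.
exists (`|- 4 * p| + `|- 4 * p| + `|C|) => // x x1.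
have x0 : 0 < x by apply: lt_le_trans x1.
have q0 : 0 < (x ^+ 2 * Num.sqrt x)^-1 by rewrite invr_gt0 mulr_gt0 ?exprn_gt0 ?sqrtr_gt0.
have := hC x x1; rewrite expr1 -powR_n52//; set q := (_ * _)^-1.
rewrite /cap_sum /liouville_sum big_ord1 expr0 mul1r /= -/p => h.
rewrite -(subrK (osc (- 4 * p, - 4 * p) x * q) (cap_hat x)).
apply: (le_trans (ler_normD _ _)); rewrite [leLHS]addrC [leRHS]mulrDl; apply: lerD.
  rewrite normrM (gtr0_norm q0) ler_wpM2r ?(ltW q0)//.
  exact: (osc_bound (- 4 * p, - 4 * p)).
apply: (le_trans h); rewrite ler_wpM2r ?(ltW q0)//.
apply: (le_trans (ler_norm _)); rewrite normrM ler_piMr// normfV invf_le1 ?normr_gt0 ?gt_eqF//.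
by rewrite (le_trans x1)// ler_norm.
Qed.

Definition dual_term x n : R := if n == 0 then 0 else cap_hat (x * enorm n).

Lemma dual_term_bound : exists2 C : R, 0 <= C & forall x n, 1 <= x ->
  `|dual_term x n| <= C * x `^ (- (5 / 2)) * weight n.
Proof.
have [C C0 hC] := cap_hat_decay; exists C => // x n x1.
rewrite /dual_term /weight; case: ifP => [_|/negbT n0]; first by rewrite normr0 mulr0.
have e1 := @enorm_ge1 R n n0.
have x0 : 0 <= x by apply: le_trans x1.
apply: (le_trans (hC _ _)); first by rewrite -[leLHS]mulr1 ler_pM.
by rewrite powRM ?mulrA// (le_trans ler01 e1).
Qed.

Lemma dual_has_sum x : 1 <= x -> exists l, has_sum (dual_term x) l.
Proof.
move=> x1; have [C C0 hC] := dual_term_bound.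
apply: (@dominated_has_sum _ _ (fun n => C * x `^ (- (5 / 2)) * weight n)
   (C * x `^ (- (5 / 2)) * weight_total)) => [n|A|n].
- by rewrite !mulr_ge0 ?powR_ge0 ?weight_ge0.
- by rewrite -mulr_sumr ler_wpM2l ?mulr_ge0 ?powR_ge0// sum_weight.
- exact: hC.
Qed.

Lemma has_sum_delta (c : R) : has_sum (fun n : int * int => if n == 0 then c else 0) c.
Proof.
move=> e e0; exists [fset (0 : int * int)]%fset => B sB.
rewrite (sum_fset_sub _ sB) big_seq_fset1 eqxx big_seq big1 ?addr0 ?subrr ?normr0 ?ltW//.
by move=> n; rewrite !inE => /andP[/negbTE -> _].
Qed.

(** The Fejer means of the Fourier coefficients have both sides as limits: the
    left one by [fejer_poisson], the right one by [cesaro_has_sum]. *)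
Lemma cap_lattice_sum r l M : 1 <= 2 * pi * r -> 8 * r < half_side M ->
  has_sum (dual_term (2 * pi * r)) l ->
  \sum_(i < M.*2.+1) \sum_(j < M.*2.+1) cap r (node M i) (node M j) =
  r ^+ 4 * (pi / 2 + l).
Proof.
move=> r1 rM hl; have pi0 := @pi_gt0 R.
have p2 : 0 < 2 * pi :> R by rewrite mulr_gt0.
have r0 : 0 < r by rewrite -(pmulr_rgt0 r p2); exact: lt_le_trans ltr01 r1.
pose f k k' := fourier (cap r) M k k'.
have fE n : f n.1 n.2 = r ^+ 4 * (if n == 0 then pi / 2 else 0) + r ^+ 4 * dual_term (2 * pi * r) n.
  rewrite /f fourier_cap// /dual_term; case: n => k k' /=.
  case: ifP => [/eqP -> |_]; last by rewrite mulr0 add0r.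
  by rewrite mulr0 addr0 /enorm /= expr0n /= addr0 sqrtr0 mulr0 cap_hat0.
have hf : has_sum (fun n => f n.1 n.2) (r ^+ 4 * (pi / 2 + l)).
  rewrite mulrDr; have := has_sum_lin (r ^+ 4) (r ^+ 4) (has_sum_delta (pi / 2)) hl.
  by congr has_sum; apply/funext => n; rewrite fE.
have [C C0 hC] := dual_term_bound.
pose b n := r ^+ 4 * (if n == 0 then pi / 2 else 0) +
  r ^+ 4 * (C * (2 * pi * r) `^ (- (5 / 2)) * weight n).
pose T := r ^+ 4 * (pi / 2) + r ^+ 4 * (C * (2 * pi * r) `^ (- (5 / 2)) * weight_total).
have r4 : 0 <= r ^+ 4 by rewrite exprn_ge0// ltW.
have d0 (n : int * int) : 0 <= (if n == 0 then pi / 2 else 0 : R).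
  by case: ifP => // _; rewrite divr_ge0// ltW.
have fb n : `|f n.1 n.2| <= b n.
  rewrite fE; apply: (le_trans (ler_normD _ _)); apply: lerD.
    by rewrite ger0_norm// mulr_ge0.
  by rewrite normrM ger0_norm// ler_wpM2l// hC.
have bT A : \sum_(n <- A) b n <= T.
  rewrite big_split /= -!mulr_sumr; apply: lerD; rewrite ler_wpM2l//; last first.
    by rewrite ler_wpM2l ?mulr_ge0 ?powR_ge0// sum_weight.
  case: (boolP ((0 : int * int) \in A)) => A0.
    rewrite (sum_fset_sub _ (_ : [fset (0 : int * int)] `<=` A)%fset) ?fsub1set//.
    rewrite big_seq_fset1 eqxx [X in _ + X]big_seq [X in _ + X]big1 ?addr0//.
    by move=> n; rewrite !inE => /andP[/negbTE -> _].
  rewrite big_seq big1 ?divr_ge0 ?(ltW pi0)// => n nA; case: ifP => // /eqP n0.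
  by rewrite -n0 nA in A0.
have lip := lip2_cap (ltW r0).
set G := \sum_(i < _) _; set l' := r ^+ 4 * _.
have fA A : `|\sum_(n <- A) f n.1 n.2| <= T.
  exact: le_trans (ler_norm_sum_fset A fb) (bT A).
have l'T : `|l'| <= T by exact: (has_sum_bound bT fb hf).
apply/eqP; rewrite -subr_eq0 -normr_le0; apply/ler_addgt0Pr => e e0; rewrite add0r.
have [K hK] := cesaro_has_sum hf fA l'T (divr_gt0 e0 (ltr0n R 4)).
(* The Cesaro error is at most [e / 4 + e / 4], and with [d = e / (4 k)] the
    Fejer error [k (d + 1 / (d N))] is at most [e / 2] for large [N]. *)
pose k := 2 * grid_size M ^+ 2 * (2 * r) : R.
have k0 : 0 < k by rewrite /k !mulr_gt0 // exprn_gt0// /grid_size ltr0n.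
pose d := e / (4 * k).
have dp : 0 < d by rewrite divr_gt0// mulr_gt0.
pose Z := `|K| * 4 / e + k * 4 / (d * e).
pose N := (Num.truncn Z).+1.
have NZ : Z < N%:R by exact: truncnS_gt.
have N0 : 0 < N%:R :> R by rewrite ltr0n.
have Z1 : 0 <= `|K| * 4 / e by rewrite divr_ge0 ?(ltW e0)// mulr_ge0.
have Z2 : 0 <= k * 4 / (d * e) by rewrite divr_ge0 // mulr_ge0 // ltW.
have h1 := hK N isT.
have h2 := fejer_poisson M lip (mulr_ge0 (ler0n R 2) (ltW r0)) (isT : (0 < N)%N) dp.
rewrite -/f -/G in h2.
have a1 : K / N%:R <= e / 4.
  rewrite ler_pdivrMr//; apply: (le_trans (ler_norm K)).
  have : `|K| * 4 / e <= N%:R by rewrite /Z in NZ; lra.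
  rewrite ler_pdivrMr// => h; lra.
have a2 : k * (d + (d * N%:R)^-1) <= e / 2.
  rewrite mulrDr; have -> : k * d = e / 4 by rewrite /d; field; rewrite gt_eqF.
  have : k * (d * N%:R)^-1 <= e / 4.
    rewrite (ler_pdivrMr _ _ (mulr_gt0 dp N0)).
    have : k * 4 / (d * e) <= N%:R by rewrite /Z in NZ; lra.
    rewrite (ler_pdivrMr _ _ (mulr_gt0 dp e0)).
    by clear; move: (d : R) (N%:R : R) => d' N'; lra.
  by lra.
have a3 : 2 * grid_size M ^+ 2 * (2 * r * (d + (d * N%:R)^-1)) <= e / 2.
  by apply: le_trans a2; rewrite le_eqVlt; apply/orP; left; apply/eqP; rewrite /k; ring.
have -> : G - l' = - ((l' - N%:R^-1 * (\sum_(i < N) \sum_(j < N) (N%:R^-1 * \sum_(i' < N) \sum_(j' < N)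
      f (i%:Z - j%:Z)%R (i'%:Z - j'%:Z)%R))) + (N%:R^-1 * (\sum_(i < N) \sum_(j < N) (N%:R^-1 * \sum_(i' < N) \sum_(j' < N)
      f (i%:Z - j%:Z)%R (i'%:Z - j'%:Z)%R)) - G)) by ring.
rewrite normrN; apply: (le_trans (ler_normD _ _)).
by have := le_trans h2 a3; lra.
Qed.

(** Hardy's formula. The term [pi / 2 = cap_hat 0] of the zero frequency
    cancels the area term [r^2 / (8 pi)]. *)
Lemma avg_discrepancy_dual r l : 1 <= r -> has_sum (dual_term (Num.sqrt r)) l ->
  avg_discrepancy r = r / (4 * pi ^+ 2) * l.
Proof.
move=> r1 hl; have r0 : 0 < r by apply: lt_le_trans r1.
have pi0 := @pi_gt0 R.
have s1 : 1 <= Num.sqrt r by rewrite -[leLHS]sqrtr1 ler_wsqrtr.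
have s2 : Num.sqrt r ^+ 2 = r by rewrite sqr_sqrtr// ltW.
pose q := Num.sqrt r / (2 * pi).
have p2 : 2 * pi != 0 :> R by rewrite mulf_neq0// lt0r_neq0.
have qE : 2 * pi * q = Num.sqrt r by rewrite /q mulrC divfK.
have q0 : 0 <= q by rewrite /q divr_ge0 ?sqrtr_ge0// mulr_ge0// ltW.
pose M := (Num.truncn (8 * q)).+1.
have qM : 8 * q < M%:R by exact: truncnS_gt.
have eqv n : r - eigenvalue_of n = 4 * pi ^+ 2 * (q ^+ 2 - n.1%:~R ^+ 2 - n.2%:~R ^+ 2).
  rewrite -s2 -qE /eigenvalue_of enorm_sq; ring.
rewrite (@avg_discrepancy_riesz r (box M.*2.+1 M M)) //.
  rewrite sum_box /=.
  have -> : \sum_(i < M.*2.+1) \sum_(j < M.*2.+1)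
      Num.max 0 (r - eigenvalue_of ((i%:Z - M%:Z)%R, (j%:Z - M%:Z)%R)) =
    4 * pi ^+ 2 * \sum_(i < M.*2.+1) \sum_(j < M.*2.+1) cap q (node M i) (node M j).
    rewrite mulr_sumr; apply: eq_bigr => i _; rewrite mulr_sumr; apply: eq_bigr => j _.
    rewrite eqv /cap !nodeE /= maxr_pMr ?mulr0// mulr_ge0 ?sqr_ge0//.
  rewrite (@cap_lattice_sum q l) ?qE//; last by rewrite /half_side; lra.
  rewrite -s2 -qE; have pn : pi != 0 :> R by rewrite lt0r_neq0.
  have qn : q != 0 by rewrite mulf_neq0 ?invr_eq0// lt0r_neq0// sqrtr_gt0.
  by move: (pi : R) pn (q : R) qn => p pn c cn; field; rewrite pn cn.
move=> [a b] h; rewrite in_fset; apply/allpairsP.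
have : 0 <= r - eigenvalue_of (a, b) by rewrite subr_ge0.
rewrite eqv pmulr_rge0 ?mulr_gt0 ?exprn_gt0//= => h2.
have small (c : int) : (c%:~R : R) ^+ 2 <= q ^+ 2 -> (`|c| < M)%N.
  move=> hc; have cq : `|c%:~R : R| <= q by rewrite -(ger0_norm q0) -ler_sqr ?nnegrE// !real_normK ?num_real.
  have : `|c%:~R : R| < M%:R by lra.
  by rewrite -intr_norm -[M%:R]/((Posz M)%:~R) ltr_int.
have ha : (`|a| < M)%N by apply: small; have := sqr_ge0 (b%:~R : R); lra.
have hb : (`|b| < M)%N by apply: small; have := sqr_ge0 (a%:~R : R); lra.
clear -ha hb; move: M ha hb => M ha hb.
exists (`|(a + M%:Z)%R|%N, `|(b + M%:Z)%R|%N) => /=.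
by rewrite !mem_index_iota /=; split; [lia|lia|congr pair; lia].
Qed.

End Counting.

(** * Almost periodic series *)

Section AlmostPeriodicSeries.
Context {R : realType}.
Implicit Types (x y e : R) (f : R -> R).

Definition is_trig_poly f := exists (m : nat) (c : 'I_m -> R[i]) (l : 'I_m -> R),
  forall x, (f x)%:C%C = trig_poly c l x.

Lemma is_trig_polyD f1 f2 : is_trig_poly f1 -> is_trig_poly f2 ->
  is_trig_poly (fun x => f1 x + f2 x).
Proof.
move=> [m1 [c1 [l1 h1]]] [m2 [c2 [l2 h2]]].
exists (m1 + m2)%N.
exists (fun k => match fintype.split k with inl i => c1 i | inr i => c2 i end).
exists (fun k => match fintype.split k with inl i => l1 i | inr i => l2 i end) => x.
rewrite rmorphD /= h1 h2 /trig_poly big_split_ord /=; congr (_ + _);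
  apply: eq_bigr => i _.
  by have := unsplitK (inl i : 'I_m1 + 'I_m2); rewrite /= => ->.
by have := unsplitK (inr i : 'I_m1 + 'I_m2); rewrite /= => ->.
Qed.

Lemma is_trig_poly_osc (c : R * R) (l : R) : is_trig_poly (fun x => osc c (l * x)).
Proof.
exists 2%N, (fun k => if k == ord0 then Complex (c.1 / 2) (- (c.2 / 2)) else Complex (c.1 / 2) (c.2 / 2)).
exists (fun k => if k == ord0 then l else - l) => x.
rewrite /trig_poly !big_ord_recl big_ord0 /= addr0 mulNr /cis cosN sinN /osc.
by apply/eqP; rewrite eq_complex /=; apply/andP; split; apply/eqP; field.
Qed.

Lemma is_trig_poly_sum (I : Type) (s : seq I) (h : I -> R -> R) :
  (forall i, is_trig_poly (h i)) -> is_trig_poly (fun x => \sum_(i <- s) h i x).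
Proof.
move=> hh; elim: s => [|i s IH].
  exists 0%N, (fun=> 0), (fun=> 0) => x.
  by rewrite big_nil /trig_poly big_ord0.
have [m [c [l E]]] := is_trig_polyD (hh i) IH.
by exists m, c, l => x; rewrite -E big_cons.
Qed.

Lemma norm_real_complex (x : R) : `|x%:C%C| = `|x|%:C%C.
Proof. by rewrite normc_def /= expr0n /= addr0 sqrtr_sqr. Qed.

Lemma uniform_limit_almost_periodic f :
  (forall e, 0 < e -> exists2 h, is_trig_poly h & forall x, `|f x - h x| <= e) ->
  uniformly_almost_periodic_real f.
Proof.
move=> H e e0; have [h [m [c [l E]]] fh] := H e e0.
exists m, c, l => x; rewrite -E -rmorphB /= norm_real_complex lecR.
exact: fh.
Qed.

Lemma cont_osc (c : R * R) (l : R) : conti (fun x => osc c (l * x)).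
Proof. by rewrite /osc; cont. Qed.

(** A wave of nonzero frequency has an antiderivative which is again a wave,
    hence bounded. *)
Lemma integ_osc (c : R * R) (l T : R) : 0 <= T -> (l = 0 -> c = (0, 0)) ->
  `|integ (fun x => osc c (l * x)) (- T) T| <= 2 * (`|c.1| + `|c.2|) * `|l^-1|.
Proof.
move=> T0 lc.
rewrite (@integE _ _ (fun x => osc (- c.2, c.1) (l * x) * l^-1)); last first.
  move=> x; rewrite /osc /=; apply: hd_eq; first by der.
  have [l0|l0] := eqVneq l 0; last by field.
  by rewrite (lc l0) /= !(mul0r, mulr0, oppr0, addr0).
rewrite -mulrBl normrM ler_wpM2r//.
apply: (le_trans (ler_normB _ _)); rewrite mulr2n mulrDl mul1r.
by apply: lerD; apply: (le_trans (osc_bound _ _)); rewrite /= normrN addrC.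
Qed.

(** The mean of [f] over [- T, T] is within [e / 2] of that of [h], which is
    at most [K / (2 T)]. *)
Lemma mean_value_zero f : continuous f ->
  (forall e, 0 < e -> exists2 h, continuous h & (forall x, `|f x - h x| <= e) /\
     exists K, forall T, 0 <= T -> `|integ h (- T) T| <= K) ->
  has_mean_value f 0.
Proof.
move=> cf H; rewrite /has_mean_value.
apply/cvgrPdist_le => e e0.
have e2 : 0 < e / 2 by rewrite divr_gt0.
have [h ch [fh [K hK]]] := H _ e2.
near=> T.
have T1 : 1 <= T by near: T; apply: nbhs_pinfty_ge; exact: num_real.
have TK : K / e <= T by near: T; apply: nbhs_pinfty_ge; exact: num_real.
have T0 : 0 < T by apply: lt_le_trans T1.
have TT : - T <= T by lra.
rewrite integ_Rintegral// sub0r normrN normrM ger0_norm; last first.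
  by rewrite invr_ge0 mulr_ge0// ltW.
rewrite ler_pdivrMl; last by rewrite mulr_gt0.
have c1 : continuous (fun x => f x - h x) by cont.
have := @ler_norm_integ_cst R (fun x => f x - h x) (e / 2) (- T) T TT c1 (fun x _ => fh x).
rewrite (integB _ _ cf ch) => h1.
rewrite -(subrK (integ h (- T) T) (integ f (- T) T)).
apply: (le_trans (ler_normD _ _)).
have h2 := hK T (ltW T0).
have h3 : K <= e * T by rewrite mulrC -ler_pdivrMr.
by lra.
Unshelve. all: end_near. Qed.

Lemma uniform_limit_continuous f :
  (forall e, 0 < e -> exists2 h, continuous h & forall x, `|f x - h x| <= e) ->
  continuous f.
Proof.
move=> H x; apply/cvgrPdist_le => e e0.
have e3 : 0 < e / 3 by rewrite divr_gt0.
have [h ch fh] := H _ e3.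
near=> y.
have hxy : `|h x - h y| <= e / 3.
  by near: y; move/cvgrPdist_le : (ch x); exact.
have -> : f x - f y = (f x - h x) + (h x - h y) + - (f y - h y) by ring.
have := fh x; have := fh y.
have := ler_normD (f x - h x + (h x - h y)) (- (f y - h y)).
have := ler_normD (f x - h x) (h x - h y).
by rewrite normrN; lra.
Unshelve. all: end_near. Qed.

Section Series.
Variables (I : choiceType) (c : I -> R * R) (l : I -> R) (b : I -> R) (M : R).
Hypotheses (cb : forall i, `|(c i).1| + `|(c i).2| <= b i)
  (bM : forall A : {fset I}, \sum_(i <- A) b i <= M).
Variable F : R -> R.
Hypothesis sumF : forall x, has_sum (fun i => osc (c i) (l i * x)) (F x).

Lemma osc_series_approx e : 0 < e -> exists A : {fset I},
  forall x, `|F x - \sum_(i <- A) osc (c i) (l i * x)| <= e.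
Proof.
move=> e0; have [A hA] := dominated_tail bM e0.
exists A => x; apply: (has_sum_tail _ hA (sumF x)) => i.
exact: le_trans (osc_bound _ _) (cb i).
Qed.

Lemma osc_series_almost_periodic : uniformly_almost_periodic_real F.
Proof.
apply: uniform_limit_almost_periodic => e e0; have [A hA] := osc_series_approx e0.
exists (fun x => \sum_(i <- A) osc (c i) (l i * x)) => //.
by apply: is_trig_poly_sum => i; exact: is_trig_poly_osc.
Qed.

Lemma osc_series_mean_value : (forall i, l i = 0 -> c i = (0, 0)) ->
  has_mean_value F 0.
Proof.
move=> lc.
have ch (A : {fset I}) : continuous (fun x => \sum_(i <- A) osc (c i) (l i * x)).
  by apply: cont_sum => i; exact: cont_osc.
apply: mean_value_zero.
  apply: uniform_limit_continuous => e e0; have [A hA] := osc_series_approx e0.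
  by exists (fun x => \sum_(i <- A) osc (c i) (l i * x)).
move=> e e0; have [A hA] := osc_series_approx e0.
exists (fun x => \sum_(i <- A) osc (c i) (l i * x)) => //; split => //.
exists (\sum_(i <- A) 2 * (`|(c i).1| + `|(c i).2|) * `|(l i)^-1|) => T T0.
rewrite integ_sum; last by move=> i; exact: cont_osc.
apply: (le_trans (ler_norm_sum _ _ _)); apply: ler_sum => i _.
exact: integ_osc (lc i).
Qed.

End Series.
End AlmostPeriodicSeries.

(** * The expansion of the average discrepancy *)

Section Expansion.
Context {R : realType}.
Implicit Types (n : int * int) (r x y : R) (k : nat).

Definition cap_coef k : R * R := liouville_coef (-(15/4)) (-4 * Num.sqrt pi) (-4 * Num.sqrt pi) k.

Definition damping k n : R := (4 * pi ^+ 2)^-1 * (enorm n)^-1 ^+ k * weight n.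

(** The amplitude at [n] of the [k]-th term in the expansion of
    [r / (4 pi^2) * cap_hat (sqrt r * enorm n)], apart from the power of [r]. *)
Definition amplitude k n : R * R := (damping k n * (cap_coef k).1, damping k n * (cap_coef k).2).

Lemma osc_amplitude k n y : osc (amplitude k n) y = damping k n * osc (cap_coef k) y.
Proof. by rewrite /osc /=; ring. Qed.

Lemma damping_bound k n : 0 <= damping k n <= (4 * pi ^+ 2)^-1 * weight n.
Proof.
have p0 : 0 <= (4 * pi ^+ 2)^-1 :> R by rewrite invr_ge0 mulr_ge0// sqr_ge0.
rewrite /damping /weight; case: ifP => [_|/negbT n0]; first by rewrite !mulr0 lexx.
have e1 := @enorm_ge1 R n n0; have e0 := lt_le_trans ltr01 e1.
have k0 : 0 <= (enorm n)^-1 ^+ k :> R by rewrite exprn_ge0// invr_ge0 ltW.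
apply/andP; split; first exact: mulr_ge0 (mulr_ge0 p0 k0) (powR_ge0 _ _).
rewrite ler_wpM2r ?powR_ge0//.
by rewrite ler_piMr// exprn_ile1 ?invr_ge0 ?(ltW e0)// invf_le1.
Qed.

Definition amplitude_bound k n : R :=
  (4 * pi ^+ 2)^-1 * (`|(cap_coef k).1| + `|(cap_coef k).2|) * weight n.

Lemma ler_amplitude k n : `|(amplitude k n).1| + `|(amplitude k n).2| <= amplitude_bound k n.
Proof.
have /andP[d0 dw] := damping_bound k n.
rewrite /= !(normrM (damping k n)) (ger0_norm d0) -mulrDr.
by rewrite /amplitude_bound [leRHS]mulrAC ler_wpM2r// addr_ge0.
Qed.

Lemma amplitude_bound_ge0 k n : 0 <= amplitude_bound k n.
Proof. by apply: le_trans (ler_amplitude k n); rewrite addr_ge0. Qed.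

Lemma sum_amplitude_bound k (A : {fset (int * int)}) : \sum_(n <- A) amplitude_bound k n <=
  (4 * pi ^+ 2)^-1 * (`|(cap_coef k).1| + `|(cap_coef k).2|) * weight_total.
Proof.
rewrite -mulr_sumr ler_wpM2l ?sum_weight// mulr_ge0 ?addr_ge0//.
by rewrite invr_ge0 mulr_ge0// sqr_ge0.
Qed.

(** The coefficient of [r^(- 1/4 - k/2)], as a function of [sqrt r]. *)
Definition profile k y : R := summability.sum (fun n => osc (amplitude k n) (enorm n * y)).

Lemma has_sum_profile k y : has_sum (fun n => osc (amplitude k n) (enorm n * y)) (profile k y).
Proof.
have [l hl] := dominated_has_sum (amplitude_bound_ge0 k) (sum_amplitude_bound k)
  (fun n => le_trans (osc_bound (amplitude k n) (enorm n * y)) (ler_amplitude k n)).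
by rewrite /profile (has_sumE hl).
Qed.

Lemma profile_almost_periodic k : uniformly_almost_periodic_real (profile k).
Proof.
exact: (osc_series_almost_periodic (ler_amplitude k) (sum_amplitude_bound k) (has_sum_profile k)).
Qed.

Lemma profile_mean_value k : has_mean_value (profile k) 0.
Proof.
apply: (osc_series_mean_value (ler_amplitude k) (sum_amplitude_bound k) (has_sum_profile k)).
move=> n e0; rewrite /amplitude /damping /weight; case: ifP => [_|/negbT n0].
  by rewrite mulr0 !mul0r.
by have := @enorm_ge1 R n n0; rewrite e0 ler10.
Qed.

Lemma g_term_bound x n : `|g_term x n| <= weight n.
Proof.
rewrite /g_term /weight; case: ifP => _; first by rewrite normr0.
by rewrite normrM ger0_norm ?powR_ge0// ler_piMr ?powR_ge0// cos_bound.
Qed.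

Lemma powR_n32 x : 0 < x -> x `^ (3 / 2) = x * Num.sqrt x.
Proof.
move=> x0; rewrite -powR12_sqrt ?(ltW x0)// -{2}(powRr1 (ltW x0)) -powRD ?(gt_eqF x0) ?implybT//.
by congr powR; field.
Qed.

Lemma cos_pi4 : cos (pi / 4) = Num.sqrt 2 / 2 :> R.
Proof.
have c0 : 0 < cos (pi / 4 : R).
  by apply: cos_gt0_pihalf; have := @pi_gt0 R; lra.
have := cos_mulr2n (pi / 4 : R).
have -> : pi / 4 *+ 2 = pi / 2 :> R by rewrite -mulr_natr; lra.
rewrite cos_pihalf => h.
have st : Num.sqrt 2 ^+ 2 = 2 :> R by rewrite sqr_sqrtr.
apply/eqP; rewrite -(eqrXn2 (_ : 0 < 2)%N) ?divr_ge0 ?sqrtr_ge0 ?(ltW c0)//.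
by apply/eqP; rewrite expr_div_n st; move: h; rewrite -mulr_natr; lra.
Qed.

Lemma sin_pi4 : sin (pi / 4) = Num.sqrt 2 / 2 :> R.
Proof. by rewrite -cos_pi4 -cosBpihalf -cosN; congr cos; lra. Qed.

(** The leading wave is [- 4 sqrt pi (cos u + sin u) = - 4 sqrt (2 pi) cos (u
    - pi / 4)], and [4 sqrt (2 pi) / (4 pi^2) = sqrt 2 / pi^(3/2)]. *)
Lemma profile0 : profile 0 = @g R.
Proof.
apply/funext => x.
have [l hl] := dominated_has_sum weight_ge0 (@sum_weight R) (g_term_bound x).
rewrite /g (has_sumE hl).
apply: has_sum_unique (has_sum_profile 0 x) _.
have := has_sumZ (- (Num.sqrt 2 / pi `^ (3 / 2))) hl.
congr has_sum; apply/funext => n.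
rewrite osc_amplitude /damping expr0 mulr1 /g_term /weight.
case: ifP => _; first by rewrite !mulr0 mul0r.
rewrite cosB cos_pi4 sin_pi4 /osc /= powR_n32 ?pi_gt0//.
have sp : Num.sqrt pi ^+ 2 = pi :> R by rewrite sqr_sqrtr// pi_ge0.
have sp0 : Num.sqrt pi != 0 :> R by rewrite lt0r_neq0// sqrtr_gt0 pi_gt0.
have st : Num.sqrt 2 ^+ 2 = 2 :> R by rewrite sqr_sqrtr.
have st0 : Num.sqrt 2 != 0 :> R by rewrite lt0r_neq0// sqrtr_gt0.
set w := enorm n `^ _; set a := cos _; set b := sin _.
have -> : - (Num.sqrt 2 / (pi * Num.sqrt pi)) * (w * (a * (Num.sqrt 2 / 2) + b * (Num.sqrt 2 / 2))) =
  - (Num.sqrt 2 ^+ 2 / 2) / (pi * Num.sqrt pi) * w * (a + b) by ring.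
rewrite st; move: (pi : R) (Num.sqrt pi : R) sp sp0 => p s <- s0.
by field.
Qed.

(** The expansion of [cap_hat] is inserted at [p = sqrt r * enorm n >= 1]; its
    error, multiplied by [r], is a power of [sqrt r] times [O(weight n)]. *)
Lemma avg_discrepancy_expansion N : exists K : R, forall r, 1 <= r ->
  `|avg_discrepancy r - \sum_(k < N.+1) profile k (Num.sqrt r) *
     ((Num.sqrt (Num.sqrt r))^-1 * (Num.sqrt r)^-1 ^+ k)| <=
  K * ((Num.sqrt (Num.sqrt r))^-1 * (Num.sqrt r)^-1 ^+ N.+1).
Proof.
have [C hC] := @cap_hat_expansion R N.
exists ((4 * pi ^+ 2)^-1 * `|C| * weight_total) => r r1.
have pi0 := @pi_gt0 R.
have r0 : 0 < r by apply: lt_le_trans r1.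
set x := Num.sqrt r.
have x1 : 1 <= x by rewrite -[leLHS]sqrtr1 ler_wsqrtr.
have x0 : 0 < x by apply: lt_le_trans x1.
have x2 : r = x ^+ 2 by rewrite sqr_sqrtr// ltW.
have [l hl] := dual_has_sum x1.
rewrite (avg_discrepancy_dual r1 hl).
pose q k := (Num.sqrt x)^-1 * x^-1 ^+ k.
have hS : has_sum (fun n => \sum_(k < N.+1) q k * osc (amplitude k n) (enorm n * x))
   (\sum_(k < N.+1) q k * profile k x).
  by apply: (@has_sum_sum _ _ N.+1 (fun k n => q k * osc (amplitude k n) (enorm n * x))
     (fun k => q k * profile k x)) => k _; apply: has_sumZ; exact: has_sum_profile.
have := has_sum_lin (r / (4 * pi ^+ 2)) (-1) hl hS.
have -> : r / (4 * pi ^+ 2) * l + -1 * \sum_(k < N.+1) q k * profile k x =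
  r / (4 * pi ^+ 2) * l - \sum_(k < N.+1) profile k x * q k.
  by rewrite mulN1r; congr (_ - _); apply: eq_bigr => k _; rewrite mulrC.
set D := (fun n => _) => hD.
have p0 : 0 < (4 * pi ^+ 2)^-1 :> R by rewrite invr_gt0 mulr_gt0// exprn_gt0.
have q0 k : 0 < q k by rewrite mulr_gt0 ?exprn_gt0 ?invr_gt0 ?sqrtr_gt0.
have DB n : `|D n| <= (4 * pi ^+ 2)^-1 * `|C| * q N.+1 * weight n.
  rewrite /D mulN1r /dual_term; have [n0|n0] := eqVneq n 0.
    rewrite n0 mulr0 sub0r big1 ?oppr0 ?normr0.
      exact: mulr_ge0 (mulr_ge0 (mulr_ge0 (ltW p0) (normr_ge0 C)) (ltW (q0 _))) (weight_ge0 _).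
    by move=> k _; rewrite osc_amplitude /damping /weight eqxx !mulr0 mul0r mulr0.
  have e1 := @enorm_ge1 R n n0; set e := enorm n in e1 *.
  have e0 : 0 < e := lt_le_trans ltr01 e1.
  have w : weight n = (e ^+ 2 * Num.sqrt e)^-1 by rewrite /weight (negbTE n0) powR_n52.
  have xe1 : 1 <= x * e by rewrite -[leLHS]mulr1 ler_pM.
  have := hC _ xe1; rewrite sqrtrM ?(ltW x0)//.
  set P := ((x * e) ^+ 2 * _).
  have wP : x ^+ 2 * P^-1 = (Num.sqrt x)^-1 * weight n.
    rewrite w /P; have : Num.sqrt x != 0 by rewrite lt0r_neq0 // sqrtr_gt0.
    have : Num.sqrt e != 0 by rewrite lt0r_neq0 // sqrtr_gt0.
    move: (Num.sqrt e) (Num.sqrt x) => se sx se0 sx0.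
    by field; rewrite se0 sx0 !lt0r_neq0.
  move=> h.
  have -> : r / (4 * pi ^+ 2) * cap_hat (x * e) - \sum_(k < N.+1) q k * osc (amplitude k n) (e * x) =
    (4 * pi ^+ 2)^-1 * (x ^+ 2 * (cap_hat (x * e) - cap_sum N.+1 (x * e) / P)).
    rewrite x2 mulrBr mulrBr; congr (_ - _); first by ring.
    have -> : x ^+ 2 * (cap_sum N.+1 (x * e) / P) = (x ^+ 2 * P^-1) * cap_sum N.+1 (x * e) by ring.
    rewrite wP /cap_sum /liouville_sum !mulr_sumr; apply: eq_bigr => k _.
    rewrite osc_amplitude /damping /q -/(cap_coef k) (mulrC e) (invfM x e) exprMn -/e; ring.
  rewrite normrM (gtr0_norm p0).
  have -> : (4 * pi ^+ 2)^-1 * `|C| * q N.+1 * weight n =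
    (4 * pi ^+ 2)^-1 * (`|C| * (q N.+1 * weight n)) by ring.
  rewrite ler_wpM2l ?(ltW p0)// (normrM (x ^+ 2)) (ger0_norm (sqr_ge0 x)).
  apply: (@le_trans _ _ (x ^+ 2 * (C * (x * e)^-1 ^+ N.+1 / P))).
    by rewrite ler_wpM2l ?sqr_ge0.
  have -> : x ^+ 2 * (C * (x * e)^-1 ^+ N.+1 / P) = C * e^-1 ^+ N.+1 * (q N.+1 * weight n).
    have -> : x ^+ 2 * (C * (x * e)^-1 ^+ N.+1 / P) = (x ^+ 2 * P^-1) * (C * (x * e)^-1 ^+ N.+1) by ring.
    by rewrite wP /q (invfM x e) exprMn; ring.
  apply: ler_wpM2r; first exact: mulr_ge0 (ltW (q0 _)) (weight_ge0 _).
  apply: (@le_trans _ _ (`|C| * e^-1 ^+ N.+1)).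
    by rewrite ler_wpM2r ?ler_norm// exprn_ge0// invr_ge0 ltW.
  by rewrite ler_piMr// exprn_ile1 ?invr_ge0 ?(ltW e0)// invf_le1.
rewrite [leRHS]mulrAC.
apply: (has_sum_bound _ DB hD) => A.
rewrite -mulr_sumr; apply: ler_wpM2l; last exact: sum_weight.
exact: mulr_ge0 (mulr_ge0 (ltW p0) (normr_ge0 C)) (ltW (q0 _)).
Qed.

Lemma powR_quarter r k : 0 < r ->
  (Num.sqrt (Num.sqrt r))^-1 * (Num.sqrt r)^-1 ^+ k = r `^ (- (1 / 4) - k%:R / 2).
Proof.
move=> r0; have s0 : 0 < Num.sqrt r by rewrite sqrtr_gt0.
rewrite -(powR12_sqrt (ltW s0)) -(powR12_sqrt (ltW r0)) -powRrM.
rewrite exprVn -powR_mulrn ?powR_ge0// -powRrM -!powRN -powRD ?(gt_eqF r0) ?implybT//.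
by congr powR; field.
Qed.

Lemma avg_discrepancy_bigO m : (1 <= m)%N ->
  @avg_discrepancy R =
    (fun r => \sum_(1 <= j < m.+1) profile j.-1 (Num.sqrt r) * r `^ (1 / 4 - j%:R / 2))
    +O_ +oo (fun r => r `^ (- (1 / 4) - m%:R / 2)).
Proof.
case: m => // N _; have [K hK] := avg_discrepancy_expansion N.
apply/eqaddOP; near=> k; near=> r => /=.
have r1 : 1 <= r by near: r; apply: nbhs_pinfty_ge; exact: num_real.
have r0 : 0 < r by apply: lt_le_trans r1.
have Kk : K <= k by near: k; apply: nbhs_pinfty_ge; exact: num_real.
have := hK r r1; rewrite (powR_quarter N.+1 r0) => h.
rewrite (ger0_norm (powR_ge0 _ _)).
have h2 := le_trans h (ler_wpM2r (powR_ge0 _ _) Kk).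
apply: le_trans h2.
rewrite le_eqVlt; apply/orP; left; apply/eqP.
have <- : \sum_(1 <= j < N.+2) profile j.-1 (Num.sqrt r) * r `^ (1 / 4 - j%:R / 2) =
  \sum_(k < N.+1) profile k (Num.sqrt r) *
    ((Num.sqrt (Num.sqrt r))^-1 * (Num.sqrt r)^-1 ^+ k).
  rewrite big_add1 big_mkord; apply: eq_bigr => j _; rewrite (powR_quarter j r0) /=.
  by congr (_ * _ `^ _); rewrite -natr1; field.
by [].
Unshelve. all: end_near. Qed.

End Expansion.

Theorem theorem2 (R : realType) :
  [/\ (forall x : R, summable [set: int * int] (fun n => (g_term x n)%:E)),
      uniformly_almost_periodic_real (@g R),
      has_mean_value (@g R) 0,
      @avg_discrepancy R =
        (fun r => g (Num.sqrt r) * r `^ (- (1 / 4)))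
        +O_ +oo (fun r => r `^ (- (3 / 4))) &
      exists g_ : nat -> R -> R,
        [/\ g_ 1%N = @g R,
            (forall j : nat, (1 <= j)%N ->
               uniformly_almost_periodic_real (g_ j)) &
            forall m : nat, (1 <= m)%N ->
              @avg_discrepancy R =
                (fun r => \sum_(1 <= j < m.+1)
                   g_ j (Num.sqrt r) * r `^ (1 / 4 - j%:R / 2))
                +O_ +oo (fun r => r `^ (- (1 / 4) - m%:R / 2))]].
Proof.
split.
- by move=> x; exact: (dominated_esum (@sum_weight R) (g_term_bound x)).
- by rewrite -profile0; exact: profile_almost_periodic.
- by rewrite -profile0; exact: profile_mean_value.
- have := @avg_discrepancy_bigO R 1 isT; rewrite -profile0.
  under eq_fun do rewrite big_nat1 /=.
  rewrite (_ : 1 / 4 - 1%:R / 2 = - (1 / 4)); last by field.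
  by rewrite (_ : - (1 / 4) - 1%:R / 2 = - (3 / 4)); last by field.
(* The power [r^(1/4 - j/2)] is that of the profile of index [j - 1]. *)
exists (fun j => profile j.-1); split.
- exact: profile0.
- by move=> j _; exact: profile_almost_periodic.
- by move=> m; exact: avg_discrepancy_bigO.
Qed.
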